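(* Let $H:\mathbb{T}^d\times\mathbb{R}^d\to\mathbb{R}$ be of class $C^1$, with $p\mapsto H(x,p)$ strictly convex for every $x\in\mathbb{T}^d$, and $\lim_{|p|\to\infty}\inf_{x\in\mathbb{T}^d}H(x,p)=+\infty$. Let $f:\mathbb{T}^d\times[0,\infty)\to\mathbb{R}$ be continuous, with $r\mapsto f(x,r)$ strictly increasing for every $x\in\mathbb{T}^d$, and suppose there is $C>0$ with $|f(x,r)|\le C(1+r^{q-1})$ for all $(x,r)\in\mathbb{T}^d\times[0,\infty)$. Let $(m,\lambda)$ be an ergodic pair, and assume that for any $u_0,u_1\in\mathcal{M}_J$ one has $$Du_0=Du_1\quad\text{a.e. on }\mathcal{R}_m^{\rm gap}.$$ Then $\mathcal{M}_J$ contains at most one element up to additive constants (i.e. any two elements of $\mathcal{M}_J$ differ by a constant). Consequently, if in addition $(u^\varepsilon,m^\varepsilon)_{\varepsilon>0}$ is a family of weak solutions to the discounted problem which satisfies the compactness and stability property, then the whole family converges as $\varepsilon\to0$: $$\langle u^\varepsilon\rangle\rightharpoonup u_*\quad\text{weakly in }W^{1,s}(\mathbb{T}^d),$$ where $u_*$ is the unique element of $\mathcal{M}_J$ with $\int_{\mathbb{T}^d}u_*\,dx=0$.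
   Context: $\mathbb{T}^d$ is the $d$-dimensional flat torus, identified with $[0,1]^d$ (so $|\mathbb{T}^d|=1$). Fix $s>1$, $q>1$ with conjugate exponents $s',q'$, and assume the Sobolev embedding $W^{1,s}(\mathbb{T}^d)\hookrightarrow L^{q'}(\mathbb{T}^d)$. Write $\langle u\rangle:=u-\int_{\mathbb{T}^d}u\,dx$. Weak solutions of the ergodic problem: a triple $(u,m,\lambda)\in W^{1,s}(\mathbb{T}^d)\times L^q(\mathbb{T}^d)\times\mathbb{R}$ is a weak solution to the ergodic problem if (i) $m\ge0$ a.e., $\int_{\mathbb{T}^d}m\,dx=1$ and $mD_pH(x,Du)\in L^{s'}(\mathbb{T}^d;\mathbb{R}^d)$; (ii) $H(x,Du)\le f(x,m)+\lambda$ a.e. on $\mathbb{T}^d$; (iii) $H(x,Du)=f(x,m)+\lambda$ a.e. on $\{m>0\}$; (iv) $-\operatorname{div}(mD_pH(x,Du))=0$ in $\mathcal{D}'(\mathbb{T}^d)$. For fixed $(m,\lambda)$, $\mathcal{E}(m,\lambda)$ denotes the set of $u$ such that $(u,m,\lambda)$ is a weak solution. An ergodic pair is a pair $(m,\lambda)\in L^q(\mathbb{T}^d)\times\mathbb{R}$ with $\mathcal{E}(m,\lambda)\neq\emptyset$. Weak solutions of the discounted problem: for $\varepsilon>0$, $(u^\varepsilon,m^\varepsilon)\in W^{1,s}(\mathbb{T}^d)\times L^q(\mathbb{T}^d)$ is a weak solution to the discounted problem if $m^\varepsilon\ge0$ a.e., $\int m^\varepsilon\,dx=1$, $m^\varepsilon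 D_pH(x,Du^\varepsilon)\in L^{s'}(\mathbb{T}^d;\mathbb{R}^d)$, $\varepsilon u^\varepsilon+H(x,Du^\varepsilon)\le f(x,m^\varepsilon)$ a.e. on $\mathbb{T}^d$ with equality a.e. on $\{m^\varepsilon>0\}$, and $\varepsilon m^\varepsilon-\operatorname{div}(m^\varepsilon D_pH(x,Du^\varepsilon))=\varepsilon$ in $\mathcal{D}'(\mathbb{T}^d)$. Compactness and stability property of a family $(u^\varepsilon,m^\varepsilon)_{\varepsilon>0}$ of weak solutions to the discounted problem: for every sequence $\varepsilon_n\to0$ there exist a subsequence (not relabeled) and a triple $(\bar u,\bar m,\bar\lambda)\in W^{1,s}(\mathbb{T}^d)\times L^q(\mathbb{T}^d)\times\mathbb{R}$, which is a weak solution to the ergodic problem, such that $\langle u^{\varepsilon_n}\rangle\rightharpoonup\bar u$ weakly in $W^{1,s}(\mathbb{T}^d)$, $m^{\varepsilon_n}\rightharpoonup\bar m$ weakly in $L^q(\mathbb{T}^d)$, and $\varepsilon_n\int_{\mathbb{T}^d}u^{\varepsilon_n}\,dx\to-\bar\lambda$. Selection functional: for $u\in\mathcal{E}(m,\lambda)$, $J(u):=\int_{\mathbb{T}^d}\langle u\rangle\,m\,dx$, and $\mathcal{M}_J:=\operatorname*{argmin}_{u\in\mathcal{E}(m,\lambda)}J(u)$. Regions: $\mathcal{O}_m$ is the union of all open $U\subset\mathbb{T}^d$ such that $m=0$ a.e. in $U$. After fixing a measurable representative of $m$, $\mathcal{P}_m:=\{m>0\}\setminus\mathcal{O}_m$ and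 $\mathcal{R}_m:=\mathbb{T}^d\setminus(\mathcal{P}_m\cup\mathcal{O}_m)$ (statements about these sets are understood up to Lebesgue null sets). With $\ell(x):=\lambda+f(x,0)$ and $\underline{H}(x):=\min_{p\in\mathbb{R}^d}H(x,p)$, set $\mathcal{R}_m^{\rm gap}:=\mathcal{R}_m\cap\{x:\ell(x)>\underline{H}(x)\}$. *)

(* Defs.v *)
From HB Require Import structures.
From mathcomp Require Import all_boot all_order all_algebra.
From mathcomp Require Import all_classical all_reals all_analysis.

Set Implicit Arguments.
Unset Strict Implicit.
Unset Printing Implicit Defensive.

Import Order.TTheory GRing.Theory Num.Theory.
Import numFieldNormedType.Exports.

Local Open Scope classical_set_scope.
Local Open Scope ring_scope.

(* R^d carries the sigma-algebra generated by the d coordinates, i.e. the Borel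
   sigma-algebra. *)
Section measurable_row_vectors.
Context (R : realType) (d : nat).

Definition coord (i : 'I_d) (x : 'rV[R]_d) : R := x 0 i.

Definition cylinders : set_system 'rV[R]_d :=
  \bigcup_i preimage_set_system setT (coord i) measurable.

Let rv_set0 : <<s cylinders >> set0.
Proof. exact: sigma_algebra0. Qed.

Let rv_setC A : <<s cylinders >> A -> <<s cylinders >> (~` A).
Proof. exact: sigma_algebraC. Qed.

Let rv_bigcup (F : (set 'rV[R]_d)^nat) :
  (forall i, <<s cylinders >> (F i)) -> <<s cylinders >> (\bigcup_i (F i)).
Proof. exact: sigma_algebra_bigcup. Qed.

HB.instance Definition _ :=
  @isMeasurable.Build default_measure_display 'rV[R]_d
    <<s cylinders >> rv_set0 rv_setC rv_bigcup.

Lemma measurable_coord (i : 'I_d) : measurable_fun setT (coord i).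
Proof.
move=> _ Y mY; apply: sub_sigma_algebra.
by exists i => //; exists Y.
Qed.

Lemma measurable_coordP d' (T : measurableType d') (f : T -> 'rV[R]_d) :
  (forall i, measurable_fun setT (coord i \o f)) -> measurable_fun setT f.
Proof.
move=> mf; apply: (measurability cylinders) => //.
move=> _ [B [i _ [Y mY <-]] <-].
rewrite !setTI -comp_preimage -[X in measurable X]setTI.
exact: mf.
Qed.

End measurable_row_vectors.

Section torus_measure.
Context (R : realType).

Definition row_cons d (z : measurableTypeR R * 'rV[R]_d) : 'rV[R]_d.+1 :=
  \row_i oapp (fun j => z.2 0 j) z.1 (unlift ord0 i).

Lemma measurable_row_cons d : measurable_fun setT (@row_cons d).
Proof.
apply: measurable_coordP => i; rewrite /comp /coord /row_cons.
under eq_fun do rewrite mxE.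
case: unliftP => [j|] _ /=; last exact: measurable_fst.
exact: (measurableT_comp (@measurable_coord R d j) measurable_snd).
Qed.

HB.instance Definition _ d :=
  isMeasurableFun.Build _ _ _ _ (@row_cons d) (@measurable_row_cons d).

(* Lebesgue measure on the cube [0, 1]^d, as a probability measure on R^d:
   the d-fold product of Lebesgue measure on [0, 1] (torus_measure_box). *)
Fixpoint torus_measure d : probability 'rV[R]_d R :=
  match d return probability 'rV[R]_d R with
  | 0 => \d_(0 : 'rV[R]_0)
  | d'.+1 =>
    distribution (uniform_prob (@ltr01 R) \x torus_measure d')%E (@row_cons d')
  end.

Lemma torus_measure_box d (A : 'I_d -> set R) :
  (forall i, measurable (A i)) ->
  torus_measure d [set x | forall i, A i (x 0 i)] =
  (\prod_(i < d) lebesgue_measure (A i `&` `[0%R, 1%R]))%E.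
Proof.
elim: d A => [|d IH] A mA.
  rewrite big_ord0 /= diracE mem_set//.
  by case.
rewrite big_ord_recl -(IH (fun i => A (lift ord0 i)))//.
transitivity ((uniform_prob (@ltr01 R) \x torus_measure d)%E
  (@row_cons d @^-1` [set x | forall i, A i (x 0%R i)])); first by [].
rewrite (_ : _ @^-1` _ =
    A ord0 `*` [set x : 'rV[R]_d | forall i, A (lift ord0 i) (x 0 i)]).
  have mS : measurable [set x : 'rV[R]_d | forall i, A (lift ord0 i) (x 0 i)].
    rewrite (_ : mkset _ = \bigcap_i (coord i @^-1` A (lift ord0 i))).
      apply: fin_bigcap_measurable => // i _.
      by rewrite -[X in measurable X]setTI; apply: measurable_coord.
    by apply/seteqP; split => x /= Ax i; [move=> _|]; apply: Ax.
  rewrite product_measure1E//; last exact: mA.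
  congr (_ * _)%E.
  rewrite [LHS]/(uniform_prob _ _) integral_uniform_pdf.
  transitivity
      (\int[lebesgue_measure]_(x in A ord0 `&` `[0%R, 1%R]) cst 1 x)%E.
    apply: eq_integral => x; rewrite inE/= in_itv/= => -[_ x01].
    by rewrite /uniform_pdf x01 subr0 invr1.
  rewrite integral_cst; first by rewrite mul1e.
  by apply: measurableI; [exact: mA|exact: measurable_itv].
apply/seteqP; split => [[x y]/= Ax|[x y]/= [Ax Ay] i].
  split=> [|i]; first by have := Ax ord0; rewrite mxE unlift_none.
  by have := Ax (lift ord0 i); rewrite mxE liftK.
by rewrite mxE; case: unliftP => [j ->|->].
Qed.

End torus_measure.

(* Functions on the torus T^d = R^d / Z^d are Z^d-periodic functions on R^d, and
   subsets of T^d are Z^d-periodic predicates; "almost everywhere" and integrals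
   are taken with respect to Lebesgue measure on the fundamental domain
   [0, 1]^d. Elements of L^p and W^{1,s} are functions rather than classes of
   functions. *)
Section torus_functions.
Context (R : realType) (d : nat).
Local Notation X := 'rV[R]_d.
Local Notation mu := (torus_measure R d).

Definition unit_vec (i : 'I_d) : X := delta_mx 0 i.

Definition Zd_periodic (T : Type) (g : X -> T) :=
  forall i x, g (x + unit_vec i) = g x.

Definition dot (v w : X) : R := \sum_i v 0 i * w 0 i.

Definition partial (g : X -> R) (i : 'I_d) : X -> R :=
  fun x => 'D_(unit_vec i) g x.

Definition gradient (g : X -> R) (x : X) : X := \row_i partial g i x.

Definition smooth (g : X -> R) :=
  forall (ks : seq 'I_d) (x : X), differentiable (foldl partial g ks) x.

Definition test_function (g : X -> R) := Zd_periodic g /\ smooth g.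

Definition Lp (p : \bar R) : set (X -> R) :=
  [set g | Zd_periodic g /\ g \in Lfun mu p].

Definition norm_Lp (p : \bar R) (g : X -> R) : R :=
  fine ('N[mu]_p[EFin \o g])%E.

Definition mean (g : X -> R) : R := \int[mu]_x g x.

(* <u> = u - \int u *)
Definition centered (u : X -> R) : X -> R := fun x => u x - mean u.

Definition weak_gradient (u : X -> R) (G : X -> X) :=
  (forall i, Lp 1 (coord i \o G)) /\
  (forall phi i, test_function phi ->
    \int[mu]_x (u x * partial phi i x) = - \int[mu]_x (G x 0 i * phi x)).

Definition W1 (s : R) : set (X -> R) :=
  [set u | Lp s%:E u /\
    exists2 G, weak_gradient u G & forall i, Lp s%:E (coord i \o G)].

(* A representative of the weak gradient, which is unique almost everywhere;
   the default value 0 is never used on W^{1,s}. *)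
Definition Dw (u : X -> R) : X -> X := xget (fun=> 0) [set G | weak_gradient u G].

Definition norm_W1 (s : R) (u : X -> R) : R :=
  norm_Lp s%:E u + \sum_i norm_Lp s%:E (coord i \o Dw u).

Definition sobolev_embedding (s : R) (r : \bar R) :=
  W1 s `<=` Lp r /\
  exists C : R, forall u, W1 s u -> norm_Lp r u <= C * norm_W1 s u.

(* Phi restricts to a continuous linear functional on the space V with norm N. *)
Definition dual_functional (V : set (X -> R)) (N : (X -> R) -> R)
    (Phi : (X -> R) -> R) :=
  (forall a u v, V u -> V v ->
    Phi (fun x => a * u x + v x) = a * Phi u + Phi v) /\
  (exists C : R, forall u, V u -> `|Phi u| <= C * N u).

Definition weakly_cvg (V : set (X -> R)) (N : (X -> R) -> R)
    (I : Type) (F : set_system I) (v : I -> X -> R) (l : X -> R) :=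
  forall Phi, dual_functional V N Phi -> Phi (v i) @[i --> F] --> Phi l.

Definition weakly_cvg_W1 (s : R) := weakly_cvg (W1 s) (norm_W1 s).

Definition weakly_cvg_Lp (p : \bar R) := weakly_cvg (Lp p) (norm_Lp p).

End torus_functions.

Definition C1 (R : realType) (V : normedModType R) (F : V -> R) :=
  (forall z, differentiable F z) /\ (forall v, continuous (fun z => 'd F z v)).

Section mean_field_games.
Context (R : realType) (d : nat).
Local Notation X := 'rV[R]_d.
Local Notation mu := (torus_measure R d).
Variables (H : X -> X -> R) (f : X -> R -> R) (s q : R).

Definition DpH (x p : X) : X := gradient (H x) p.

Definition flux (u m : X -> R) (x : X) : X := m x *: DpH x (Dw u x).

Definition ergodic_sol (u m : X -> R) (lam : R) :=
  W1 s u /\ Lp q%:E m /\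
  [/\ [/\ {ae mu, forall x, 0 <= m x}, \int[mu]_x m x = 1 &
          forall i, Lp (hoelder_conjugate s%:E) (coord i \o flux u m)],
      {ae mu, forall x, H x (Dw u x) <= f x (m x) + lam},
      {ae mu, forall x, 0 < m x -> H x (Dw u x) = f x (m x) + lam} &
      forall phi, test_function phi ->
        \int[mu]_x dot (flux u m x) (gradient phi x) = 0].

Definition ergodic_sols (m : X -> R) (lam : R) : set (X -> R) :=
  [set u | ergodic_sol u m lam].

Definition ergodic_pair (m : X -> R) (lam : R) :=
  Lp q%:E m /\ ergodic_sols m lam !=set0.

Definition discounted_sol (eps : R) (u m : X -> R) :=
  W1 s u /\ Lp q%:E m /\
  [/\ [/\ {ae mu, forall x, 0 <= m x}, \int[mu]_x m x = 1 &
          forall i, Lp (hoelder_conjugate s%:E) (coord i \o flux u m)],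
      {ae mu, forall x, eps * u x + H x (Dw u x) <= f x (m x)},
      {ae mu, forall x, 0 < m x -> eps * u x + H x (Dw u x) = f x (m x)} &
      forall phi, test_function phi ->
        eps * (\int[mu]_x (m x * phi x)) +
        \int[mu]_x dot (flux u m x) (gradient phi x) =
        eps * \int[mu]_x phi x].

Definition compact_stable (ue me : R -> X -> R) :=
  forall e : nat -> R, (forall n, 0 < e n) -> e n @[n --> \oo] --> 0 ->
  exists (k : nat -> nat) (u m : X -> R) (lam : R),
    {homo k : i j / (i < j)%N} /\ ergodic_sol u m lam /\
    [/\ weakly_cvg_W1 s \oo (fun n => centered (ue (e (k n)))) u,
        weakly_cvg_Lp q%:E \oo (fun n => me (e (k n))) m &
        e (k n) * mean (ue (e (k n))) @[n --> \oo] --> - lam].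

Definition J (m u : X -> R) : R := \int[mu]_x (centered u x * m x).

Definition MJ (m : X -> R) (lam : R) : set (X -> R) :=
  [set u | ergodic_sols m lam u /\
           forall v, ergodic_sols m lam v -> J m u <= J m v].

Definition O_ (m : X -> R) : set X :=
  \bigcup_(U in [set U : set X | [/\ open U, Zd_periodic U &
    {ae mu, forall x, U x -> m x = 0}]]) U.

Definition P_ (m : X -> R) : set X := [set x | 0 < m x] `\` O_ m.

Definition R_ (m : X -> R) : set X := ~` (P_ m `|` O_ m).

Definition ell (lam : R) (x : X) : R := lam + f x 0.

(* The minimum is attained when H is continuous and coercive in p. *)
Definition Hmin (x : X) : R := inf (range (H x)).

Definition R_gap (m : X -> R) (lam : R) : set X :=
  R_ m `&` [set x | Hmin x < ell lam x].

End mean_field_games.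

(* Main.v *)
Require Import Defs.
From HB Require Import structures.
From mathcomp Require Import all_boot all_order all_algebra.
From mathcomp Require Import all_classical all_reals all_analysis.
From mathcomp Require Import measurable_realfun ring lra.

Set Implicit Arguments.
Unset Strict Implicit.
Unset Printing Implicit Defensive.

Import Order.TTheory GRing.Theory Num.Theory.
Import numFieldNormedType.Exports.
Import Defs.

Local Open Scope classical_set_scope.
Local Open Scope ring_scope.

(** Let u0 and u1 minimise J over the solutions with density m and ergodic
constant lam. It suffices to prove Du0 = Du1 almost everywhere, since a
Sobolev function with zero gradient is constant (zero_gradient_cst).

On {m > 0}, test the continuity equation of u0 with u1 - u0. Both functions
solve the Hamilton-Jacobi equation there, so strict convexity of H in p
leaves no room for two different gradients (erg_same_gradient). The equation
is given for smooth test functions only. To test it with a Sobolev function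
w, consider the correlations
h |-> \int F_i(x) G_i(x + h) dx of the flux F with the gradient G of w. Their
sum is continuous at 0, and the equation makes it orthogonal to every
trigonometric polynomial, hence it vanishes almost everywhere and so at 0
(weak_form_extend).

Outside O_m and where m = 0, either the gap hypothesis applies, or
ell <= min H and both gradients are the unique minimiser of H(x, .)
(MJ_off_O).

On O_m, where m = 0, the midpoint v of u0 and u1 is again a minimiser
(MJ_midpoint), because the constraints are convex and J is affine. If
Du0 <> Du1 on a non-null subset of O_m, then by strict convexity
H(x, Dv) < ell there. This is impossible for a minimiser (MJ_no_slack): a
strict subsolution can be raised a little inside O_m, which leaves
\int v m unchanged and increases \int v, so that J(v) = \int v m - \int v
decreases.

Raising v is the analytic heart (local_improvement). On O_m the coercivity of
H bounds Dv, so that v is Lipschitz there, and at a point x0 of the bad set v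
is uniformly close to its affine part at some small scale r, as in
Rademacher's theorem (rademacher_point). Let phi be this affine part, shifted
up by a multiple of r and bent down by a paraboloid: it lies above v near x0
and below v on the boundary of a ball of radius of order r. The function
v + gamma(phi - v), cut off outside the ball, with gamma of class C1,
nondecreasing and of slope at most 1, has a gradient on the segment between
Dv and Dphi. Both satisfy H <= ell, hence so does the new gradient, by
convexity. Affine functions and paraboloids are replaced by trigonometric
polynomials, so that everything is periodic.

For the second part, Lasry-Lions monotonicity identifies the density and the
constant of every ergodic solution (ergodic_pair_unique), so each limit given
by the compactness property solves the ergodic problem with m and lam.
Testing the discounted equation with v - ue and the ergodic one with ue - v
gives J(ue) <= \int me <v> for every competitor v (selection_ineq); in the
limit this says that the weak limit of <ue> minimises J (limit_minimizer).
Being unique with mean zero, the minimiser is the limit along every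
subsequence, and the whole family converges. *)

(** * Lebesgue measure on the torus and translations *)

Section translation_dim1.
Context (R : realType).
Local Notation leb := (@lebesgue_measure R).

Lemma lebesgue_measure_shift (a : R) (A : set R) : measurable A ->
  pushforward leb (fun t : measurableTypeR R => t + a : measurableTypeR R) A =
  leb A.
Proof.
move=> mA; apply/esym; apply: lebesgue_measure_unique => //.
  exact: measurable_funD.
move=> ? _ [[x y]] _ <-/=.
rewrite /pushforward.
rewrite (_ : _ @^-1` _ = `]x - a, y - a]%classic); last first.
  by apply/seteqP; split => t /=; rewrite !in_itv/= ltrBlDr lerBrDr.
rewrite !lebesgue_measure_itv/= !lte_fin ltrD2r.
by case: ifP => // _; rewrite -!EFinD; congr (_%:E); ring.
Qed.

Lemma integral_shift_itv (f : R -> \bar R) (a x y : R) :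
  measurable_fun [set: R] f -> (forall t, 0 <= f t)%E ->
  (\int[leb]_(t in `]x, y]) f (t + a)%R = \int[leb]_(t in `](x + a)%R, (y + a)%R]) f t)%E.
Proof.
move=> mf f0.
have m : measurable_fun [set: measurableTypeR R]
  (fun t : measurableTypeR R => t + a : measurableTypeR R).
  exact: measurable_funD.
rewrite (_ : `]x, y]%classic =
    (fun t : measurableTypeR R => t + a : measurableTypeR R) @^-1` `](x + a), (y + a)]); last first.
  by apply/seteqP; split => t /=; rewrite !in_itv/= ltrD2r lerD2r.
transitivity (\int[pushforward leb (fun t : measurableTypeR R => (t + a)%R : measurableTypeR R)]_(t in `](x + a)%R, (y + a)%R]) f t)%E.
  by rewrite ge0_integral_pushforward//; exact: measurable_funTS.
by apply: eq_measure_integral => //= A mA AS; exact: lebesgue_measure_shift.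
Qed.

Let shift_lt1 (f : R -> \bar R) (a : R) :
  measurable_fun [set: R] f -> (forall t, 0 <= f t)%E ->
  (forall t, f (t + 1) = f t) -> 0 <= a <= 1 ->
  (\int[leb]_(t in `[0%R, 1%R]) f (t + a)%R = \int[leb]_(t in `[0%R, 1%R]) f t)%E.
Proof.
move=> mf f0 pf /andP[a0 a1].
rewrite -[LHS]integral_itv_obnd_cbnd; last first.
  by apply: measurable_funTS; apply: measurableT_comp => //; exact: measurable_funD.
rewrite -[RHS]integral_itv_obnd_cbnd; last exact: measurable_funTS.
rewrite integral_shift_itv// add0r.
rewrite (@itv_bndbnd_setU _ _ _ (BRight 1)) ?bnd_simp ?lerDl//.
rewrite ge0_integral_setU//=; [|exact: measurable_funTS|]; last first.
  by apply/disj_set2P; rewrite -subset0 => t [] /=; rewrite !in_itv/= => /andP[_ t1] /andP[/(le_lt_trans t1)]; rewrite ltxx.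
rewrite [X in (_ + X)%E](_ : _ = \int[leb]_(t in `]0%R, a]) f t)%E; last first.
  have := @integral_shift_itv f 1 0 a mf f0; rewrite add0r [a + 1]addrC => <-.
  by apply: eq_integral => t _; rewrite pf.
rewrite [in RHS](@itv_bndbnd_setU _ _ _ (BRight a)) ?bnd_simp//.
rewrite ge0_integral_setU//=; [exact: addeC|exact: measurable_funTS|].
by apply/disj_set2P; rewrite -subset0 => t [] /=; rewrite !in_itv/= => /andP[_ t1] /andP[/(le_lt_trans t1)]; rewrite ltxx.
Qed.

Lemma integral_uniform_shift (f : R -> \bar R) (a : R) :
  measurable_fun [set: R] f -> (forall t, 0 <= f t)%E ->
  (forall t, f (t + 1) = f t) ->
  (\int[uniform_prob (@ltr01 R)]_t f (t + a)%R = \int[uniform_prob (@ltr01 R)]_t f t)%E.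
Proof.
move=> mf f0 pf.
have pz (z : int) t : f (t + z%:~R) = f t.
  have pn (n : nat) s : f (s + n%:R) = f s.
    elim: n => [|n IH]; first by rewrite addr0.
    by rewrite -natr1 addrA pf.
  by case: z => n; [exact: pn|rewrite NegzE mulrNz -{2}(subrK (n.+1%:~R) t) pn].
have -> : (fun t => f (t + a)) = (fun t => f (t + (a - (Num.floor a)%:~R))).
  by apply/funext => t; rewrite -[in RHS](pz (Num.floor a)) -addrA subrK.
have mfa b : measurable_fun [set: R] (fun t => f (t + b)).
  by apply: measurableT_comp => //; exact: measurable_funD.
rewrite [LHS]integral_uniform//=; last exact: (mfa _).
rewrite [RHS]integral_uniform//= subr0 invr1 !mul1e shift_lt1//.
rewrite subr_ge0 floor_le_tmp/= lerBlDr addrC -intrD1.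
by rewrite ltW// floorD1_gt.
Qed.

End translation_dim1.

Section translation.
Context (R : realType).
Local Notation mu d := (torus_measure R d).

Lemma measurable_shift d (a : 'rV[R]_d) : measurable_fun setT (fun x : 'rV[R]_d => x + a).
Proof.
apply: measurable_coordP => i; rewrite /comp /coord.
under eq_fun do rewrite mxE.
by apply: measurable_funD => //; exact: measurable_coord.
Qed.

Lemma row_consD d (t s : R) (x y : 'rV[R]_d) :
  row_cons (t, x) + row_cons (s, y) = row_cons (t + s, x + y).
Proof.
apply/rowP => i; rewrite !mxE /=.
by case: unliftP => [j|] _ //=; rewrite mxE.
Qed.

Lemma row_cons_split d (a : 'rV[R]_d.+1) :
  a = row_cons (a 0 ord0, \row_j a 0 (lift ord0 j)).
Proof. by apply/rowP => i; rewrite !mxE/=; case: unliftP => [j|] -> //=; rewrite mxE. Qed.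

Lemma unit_vec0 d : unit_vec R ord0 = row_cons (1, 0 : 'rV[R]_d).
Proof.
apply/rowP => i; rewrite !mxE/=; case: unliftP => [j|] -> //=.
by rewrite mxE.
Qed.

Lemma unit_vecS d (j : 'I_d) :
  unit_vec R (lift ord0 j) = row_cons (0, unit_vec R j).
Proof.
apply/rowP => i; rewrite !mxE/=; case: unliftP => [k|] -> /=.
  by rewrite mxE (inj_eq lift_inj).
by [].
Qed.

Lemma integral_torusS d (f : 'rV[R]_d.+1 -> \bar R) :
  measurable_fun setT f -> (forall x, 0 <= f x)%E ->
  (\int[mu d.+1]_x f x =
   \int[uniform_prob (@ltr01 R)]_t \int[mu d]_y f (row_cons (t, y)))%E.
Proof.
move=> mf f0.
transitivity (\int[(uniform_prob (@ltr01 R) \x mu d)%E]_z f (row_cons z))%E.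
  rewrite [LHS](@ge0_integral_pushforward _ _ _ _ _ (@row_cons R d))//.
rewrite fubini_tonelli1//.
by apply: measurableT_comp => //; exact: measurable_row_cons.
Qed.

(** By induction on d: the torus measure is a product, a translation is a
composition of translations of the factors, and in dimension one the interval
is cut at the point that wraps around. *)
Lemma integral_torus_shift d (f : 'rV[R]_d -> \bar R) (a : 'rV[R]_d) :
  measurable_fun setT f -> (forall x, 0 <= f x)%E -> Zd_periodic f ->
  (\int[mu d]_x f (x + a)%R = \int[mu d]_x f x)%E.
Proof.
elim: d f a => [|d IH] f a mf f0 pf.
  by apply: eq_integral => x _; congr f; apply/rowP => -[].
have mfa : measurable_fun setT (fun x : 'rV[R]_d.+1 => f (x + a)).
  exact: (measurableT_comp mf (measurable_shift a)).
rewrite (integral_torusS mfa)// (integral_torusS mf f0).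
set a0 := a 0 ord0; set a' : 'rV[R]_d := \row_j a 0 (lift ord0 j).
have m2 : measurable_fun setT (fun z : measurableTypeR R * 'rV[R]_d => f (row_cons z)).
  by apply: measurableT_comp => //; exact: measurable_row_cons.
transitivity (\int[uniform_prob (@ltr01 R)]_t \int[mu d]_y f (row_cons ((t + a0)%R, y)))%E.
  apply: eq_integral => t _.
  rewrite -[RHS](IH _ a')//.
  - by apply: eq_integral => y _; rewrite [a in LHS]row_cons_split row_consD.
  - exact: (measurableT_comp m2 (pair1_measurable (t + a0))).
  - by move=> i x /=; rewrite -[RHS](pf (lift ord0 i)) unit_vecS row_consD addr0.
pose g (t : R) := (\int[mu d]_y f (row_cons (t, y)))%E.
apply: (@integral_uniform_shift _ g) => //.
- exact: (measurable_fun_fubini_tonelli_F (fun z : measurableTypeR R * 'rV[R]_d => f (row_cons z))).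
- by move=> t; apply: integral_ge0.
- move=> t; apply: eq_integral => y _.
  by rewrite -(pf ord0 (row_cons (t, y))) unit_vec0 row_consD addr0.
Qed.

Lemma periodic_int d T (g : 'rV[R]_d -> T) (z : 'I_d -> int) x : Zd_periodic g ->
  g (x + \row_i (z i)%:~R) = g x.
Proof.
move=> pg.
have pn i (n : nat) y : g (y + n%:R *: unit_vec R i) = g y.
  elim: n => [|n IH]; first by rewrite scale0r addr0.
  by rewrite -natr1 scalerDl scale1r addrA pg.
have pz i (k : int) y : g (y + k%:~R *: unit_vec R i) = g y.
  case: k => n; first exact: pn.
  by rewrite NegzE mulrNz scaleNr -(pn i n.+1) subrK.
have -> : \row_i (z i)%:~R = \sum_i (z i)%:~R *: unit_vec R i.
  by rewrite {1}[\row_i _]row_sum_delta; apply: eq_bigr => i _; rewrite mxE.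
elim: (index_enum _) => [|i r IH]; first by rewrite big_nil addr0.
by rewrite big_cons addrC -addrA addrC pz addrC IH.
Qed.

(** The representative in the fundamental cube. *)
Definition frac d (x : 'rV[R]_d) : 'rV[R]_d :=
  \row_i (x 0 i - (Num.floor (x 0 i))%:~R).

Lemma periodic_frac d T (g : 'rV[R]_d -> T) x : Zd_periodic g ->
  g (frac x) = g x.
Proof.
move=> pg; rewrite -(periodic_int (fun i => Num.floor (x 0 i)) (frac x) pg).
by congr g; apply/rowP => i; rewrite !mxE subrK.
Qed.

Lemma measurable_frac d : measurable_fun setT (@frac d).
Proof.
apply: measurable_coordP => i; rewrite /comp /coord /frac.
under eq_fun do rewrite mxE.
apply: measurable_funB; first exact: measurable_coord.
apply: (@measurableT_comp _ _ _ _ _ _ (fun t : R => (Num.floor t)%:~R : R)) => //;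
  last exact: measurable_coord.
apply: nondecreasing_measurable => // x y xy.
by rewrite ler_int; exact: le_floor.
Qed.

Lemma frac_periodic d : Zd_periodic (@frac d).
Proof.
move=> i x; apply/rowP => j; rewrite !mxE eqxx/=.
have fb (b : bool) (t : R) :
  t + b%:R - (Num.floor (t + b%:R))%:~R = t - (Num.floor t)%:~R.
  case: b; last by rewrite addr0.
  rewrite (_ : true%:R = 1 :> R)// floorDrz// floor1 (rmorphD (intmul 1)).
  by transitivity (t + 1 - ((Num.floor t)%:~R + 1)); [|ring].
exact: fb.
Qed.

Lemma ae_torus_box d (A : set R) : measurable A ->
  lebesgue_measure (A `&` `[0%R, 1%R]) = 1%E ->
  {ae mu d, forall x : 'rV[R]_d, forall i, A (x 0 i)}.
Proof.
move=> mA A1.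
have mS : measurable [set x : 'rV[R]_d | forall i, A (x 0 i)].
  rewrite (_ : mkset _ = \bigcap_i (coord i @^-1` A)).
    apply: fin_bigcap_measurable => // i _.
    by rewrite -[X in measurable X]setTI; apply: measurable_coord.
  by apply/seteqP; split => x /= Ax i; [move=> _|]; apply: Ax.
exists (~` [set x : 'rV[R]_d | forall i, A (x 0 i)]); split => //.
  exact: measurableC.
rewrite probability_setC//.
have := torus_measure_box (d := d) (fun=> mA).
rewrite [X in _ = X]big1// => ->.
by rewrite subee.
Qed.

Lemma ae_torus_oo d : {ae mu d, forall x : 'rV[R]_d, forall i, 0 < x 0 i < 1}.
Proof.
have := @ae_torus_box d `]0%R, 1%R[; rewrite /= setIidl; last first.
  by apply: subset_itvW.
rewrite lebesgue_measure_itv/= lte_fin ltr01 -EFinD subr0.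
by move=> /(_ (measurable_itv _) erefl); apply: filterS => x h i; have := h i; rewrite in_itv.
Qed.

Lemma ae_frac d : {ae mu d, forall x, frac x = x}.
Proof.
apply: filterS (ae_torus_oo d) => x h; apply/rowP => i; rewrite !mxE.
have /andP[h0 h1] := h i.
have -> : Num.floor (x 0 i) = 0 by apply/floor_def; rewrite (ltW h0) add0r.
by rewrite subr0.
Qed.

(** A null set of the measure on the cube need not be periodic, so its translate
need not be null. Periodicity of S allows the exceptional set to be replaced
by its periodic extension. *)
Lemma ae_shift d (S : 'rV[R]_d -> Prop) (a : 'rV[R]_d) : Zd_periodic S ->
  {ae mu d, forall x, S x} -> {ae mu d, forall x, S (x + a)}.
Proof.
move=> pS [N [mN N0 SN]].
pose f (x : 'rV[R]_d) : \bar R := (\1_N (frac x))%:E.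
have mf : measurable_fun setT f.
  apply/measurable_EFinP; apply: measurableT_comp; last exact: measurable_frac.
  exact: measurable_indic.
have f0 x : (0 <= f x)%E by rewrite lee_fin.
have pf : Zd_periodic f by move=> i x; rewrite /f frac_periodic.
have If : (\int[mu d]_x f x = 0)%E.
  transitivity (\int[mu d]_x (\1_N x)%:E)%E.
    apply: ae_eq_integral => //; first by apply/measurable_EFinP; exact: measurable_indic.
    by apply: filterS (ae_frac d) => x fx _; rewrite /f fx.
  by rewrite integral_indic// setIT.
have mfa : measurable_fun setT (fun x : 'rV[R]_d => f (x + a)).
  exact: (measurableT_comp mf (measurable_shift a)).
have : (\int[mu d]_x `|f (x + a)%R| = 0)%E.
  rewrite -If -[RHS](integral_torus_shift a mf f0 pf).
  by apply: eq_integral => x _; rewrite gee0_abs.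
move/(ae_eq_integral_abs (mu d) measurableT mfa); apply: filterS => x /(_ I).
rewrite /f -(periodic_frac (x + a) pS) => -[] /eqP.
rewrite indicE pnatr_eq0 eqb0 => /negP h.
by apply: contrapT => /SN ?; apply: h; rewrite inE.
Qed.

End translation.

(** * Real integrals on a probability space *)

Section probability_calculus.
Context dsp (T : measurableType dsp) (R : realType) (P : probability T R).
Implicit Types f g h : T -> R.

(** Integrability of a real function on the whole space; the lemmas below redo the
extended-real calculus for real-valued functions and integrals. *)
Definition intg f := P.-integrable setT (EFin \o f).

Lemma intg_meas f : intg f -> measurable_fun setT f.
Proof. by move=> /integrableP[/measurable_EFinP]. Qed.

Lemma intgP f : intg f <->
  measurable_fun setT f /\ (\int[P]_x `|f x|%:E < +oo)%E.
Proof.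
split=> [/integrableP[/measurable_EFinP mf fi]//|[mf fi]].
by apply/integrableP; split => //; exact/measurable_EFinP.
Qed.

Lemma intgD f g : intg f -> intg g -> intg (fun x => f x + g x).
Proof. by move=> fi gi; have := integrableD measurableT fi gi. Qed.

Lemma intgB f g : intg f -> intg g -> intg (fun x => f x - g x).
Proof. by move=> fi gi; have := integrableB measurableT fi gi. Qed.

Lemma intgN f : intg f -> intg (fun x => - f x).
Proof. by move=> fi; have := integrableN fi. Qed.

Lemma intgZ (a : R) f : intg f -> intg (fun x => a * f x).
Proof. by move=> fi; have := integrableZl measurableT a fi. Qed.

Lemma intg_norm f : intg f -> intg (fun x => `|f x|).
Proof. exact: integrable_norm. Qed.

Lemma intg_sum (I : Type) (r : seq I) (F : I -> T -> R) :
  (forall i, intg (F i)) -> intg (fun x => \sum_(i <- r) F i x).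
Proof.
move=> Fi; have := integrable_sum measurableT r (P := xpredT) (fun i _ => Fi i).
by apply: eq_integrable => // x _ /=; rewrite sumEFin.
Qed.

Lemma intg_cst (a : R) : intg (fun=> a).
Proof. exact: finite_measure_integrable_cst. Qed.

Lemma intg_le f g : measurable_fun setT f -> intg g ->
  {ae P, forall x, `|f x| <= g x} -> intg f.
Proof.
move=> mf /intgP[mg gi] fg; apply/intgP; split => //.
apply: le_lt_trans gi; apply: ae_ge0_le_integral => //.
- by apply/measurable_EFinP; exact: measurableT_comp.
- by apply/measurable_EFinP; exact: measurableT_comp.
- by apply: filterS fg => x fg _; rewrite lee_fin (le_trans fg)// ler_norm.
Qed.

Lemma intg_bounded f (M : R) : measurable_fun setT f ->
  {ae P, forall x, `|f x| <= M} -> intg f.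
Proof. by move=> mf; apply: intg_le => //; exact: intg_cst. Qed.

Lemma intg_mull f g (M : R) : measurable_fun setT f ->
  {ae P, forall x, `|f x| <= M} -> intg g -> intg (fun x => f x * g x).
Proof.
move=> mf fM gi; apply: (intg_le (g := fun x => `|M| * `|g x|)).
- by apply: measurable_funM => //; exact: intg_meas.
- by apply: intgZ; exact: intg_norm.
- by apply: filterS fM => x fM; rewrite normrM ler_wpM2r// (le_trans fM)// ler_norm.
Qed.

Lemma IntD f g : intg f -> intg g ->
  \int[P]_x (f x + g x) = \int[P]_x f x + \int[P]_x g x.
Proof. by move=> fi gi; rewrite RintegralD. Qed.

Lemma IntB f g : intg f -> intg g ->
  \int[P]_x (f x - g x) = \int[P]_x f x - \int[P]_x g x.
Proof. by move=> fi gi; rewrite RintegralB. Qed.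

Lemma IntZ (a : R) f : intg f -> \int[P]_x (a * f x) = a * \int[P]_x f x.
Proof. by move=> fi; rewrite RintegralZl. Qed.

Lemma IntN f : intg f -> \int[P]_x (- f x) = - \int[P]_x f x.
Proof.
move=> fi; rewrite -mulN1r -IntZ//.
by apply: eq_Rintegral => x _; rewrite mulN1r.
Qed.

Lemma Int_cst (a : R) : \int[P]_x a = a.
Proof. by rewrite Rintegral_cst//= probability_setT mulr1. Qed.

Lemma Int_sum (I : Type) (r : seq I) (F : I -> T -> R) :
  (forall i, intg (F i)) ->
  \int[P]_x (\sum_(i <- r) F i x) = \sum_(i <- r) \int[P]_x F i x.
Proof.
move=> Fi; elim: r => [|i r IH].
  by under eq_Rintegral do rewrite big_nil; rewrite big_nil Int_cst.
under eq_Rintegral do rewrite big_cons.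
by rewrite IntD//; [rewrite IH big_cons|exact: intg_sum].
Qed.

Lemma eq_ae_Int f g : measurable_fun setT f -> measurable_fun setT g ->
  {ae P, forall x, f x = g x} -> \int[P]_x f x = \int[P]_x g x.
Proof.
move=> mf mg fg; congr fine; apply: ae_eq_integral => //.
- exact/measurable_EFinP.
- exact/measurable_EFinP.
- by apply: filterS fg => x -> _.
Qed.

Lemma Int_ge0 f : measurable_fun setT f -> {ae P, forall x, 0 <= f x} ->
  0 <= \int[P]_x f x.
Proof.
move=> mf f0; rewrite (@eq_ae_Int f (fun x => `|f x|))//.
- exact: Rintegral_ge0.
- exact: measurableT_comp.
- by apply: filterS f0 => x /ger0_norm.
Qed.

Lemma Int_le f g : intg f -> intg g -> {ae P, forall x, f x <= g x} ->
  \int[P]_x f x <= \int[P]_x g x.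
Proof.
move=> fi gi fg; rewrite -subr_ge0 -IntB//; apply: Int_ge0.
  by apply: measurable_funB; exact: intg_meas.
by apply: filterS fg => x; rewrite subr_ge0.
Qed.

Lemma Int_norm_le f : intg f -> `|\int[P]_x f x| <= \int[P]_x `|f x|.
Proof. by move=> fi; exact: le_normr_Rintegral. Qed.

Lemma Int_EFin f : intg f -> (\int[P]_x (f x)%:E)%E = (\int[P]_x f x)%:E.
Proof. by move=> fi; rewrite /Rintegral fineK//; exact: integrable_fin_num. Qed.

Lemma Int_eq0 f : intg f -> {ae P, forall x, 0 <= f x} ->
  \int[P]_x f x <= 0 -> {ae P, forall x, f x = 0}.
Proof.
move=> fi f0 If.
have mf := intg_meas fi.
have : (\int[P]_x `|(f x)%:E| = 0)%E.
  transitivity (\int[P]_x (f x)%:E)%E.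
    apply: ae_eq_integral => //.
    - by apply/measurable_EFinP; exact: measurableT_comp.
    - exact/measurable_EFinP.
    - by apply: filterS f0 => x fx _ /=; rewrite ger0_norm.
  by rewrite Int_EFin//; congr EFin; apply/eqP; rewrite eq_le If Int_ge0.
move/(ae_eq_integral_abs P measurableT (proj2 (measurable_EFinP _ _) mf)).
by apply: filterS => x /(_ I) [].
Qed.

Lemma Int_norm_eq0 f : intg f -> \int[P]_x `|f x| <= 0 ->
  {ae P, forall x, f x = 0}.
Proof.
move=> fi If; have := Int_eq0 (intg_norm fi) (aeW _ (fun x => normr_ge0 _)) If.
by apply: filterS => x /eqP; rewrite normr_eq0 => /eqP.
Qed.

Lemma Int_dct (f_ : nat -> T -> R) f g :
  (forall n, measurable_fun setT (f_ n)) -> measurable_fun setT f ->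
  {ae P, forall x, f_ n x @[n --> \oo] --> f x} -> intg g ->
  (forall n, {ae P, forall x, `|f_ n x| <= g x}) ->
  [/\ intg f, forall n, intg (f_ n) &
  \int[P]_x `|f_ n x - f x| @[n --> \oo] --> 0].
Proof.
move=> mf_ mf f_f gi f_g.
have f_g' : {ae P, forall x, forall n, `|f_ n x| <= g x} by exact: (ae_foralln f_g).
have h1 : {ae P, forall x, setT x -> ((f_ n x)%:E @[n --> \oo] --> (f x)%:E)%E}.
  by apply: filterS f_f => x h _; apply: cvg_EFin => //; exact: nearW.
have h2 : {ae P, forall x, forall n, setT x -> (`|(f_ n x)%:E| <= (g x)%:E)%E}.
  by apply: filterS f_g' => x h n _; rewrite abse_EFin lee_fin.
have f_i n : intg (f_ n) by apply: (intg_le (mf_ n) gi).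
have [fi + _] := @dominated_convergence _ _ _ P setT measurableT
  (fun n => EFin \o f_ n) (EFin \o f) (EFin \o g)
  (fun n => proj2 (measurable_EFinP _ _) (mf_ n)) (proj2 (measurable_EFinP _ _) mf)
  h1 gi h2.
move=> c; split => //.
rewrite (_ : (fun n => _) = fine \o (fun n => \int[P]_x `|(f_ n x)%:E - (f x)%:E|)%E)//.
exact: fine_cvg.
Qed.

Lemma Int_cvg (f_ : nat -> T -> R) f : intg f -> (forall n, intg (f_ n)) ->
  \int[P]_x `|f_ n x - f x| @[n --> \oo] --> 0 ->
  \int[P]_x f_ n x @[n --> \oo] --> \int[P]_x f x.
Proof.
move=> fi f_i h; apply/cvgrPdist_le => e e0.
move/cvgr0_norm_le : h => /(_ e e0); apply: filterS => n.
rewrite ger0_norm; last by apply: Int_ge0; [apply: intg_meas; exact/intg_norm/intgB|exact: aeW].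
move=> h; rewrite distrC -IntB//; apply: le_trans h.
by apply: Int_norm_le; exact: intgB.
Qed.

End probability_calculus.

Section fubini_real.
Context d1 d2 (T1 : measurableType d1) (T2 : measurableType d2) (R : realType).
Variables (P : probability T1 R) (Q : probability T2 R).

Lemma Fubini_R (F : T1 * T2 -> R) : measurable_fun setT F ->
  (\int[P]_x \int[Q]_y `|F (x, y)|%:E < +oo)%E ->
  [/\ intg P (fun x => \int[Q]_y F (x, y)),
      intg Q (fun y => \int[P]_x F (x, y)) &
      \int[P]_x \int[Q]_y F (x, y) = \int[Q]_y \int[P]_x F (x, y)].
Proof.
move=> mF Foo.
have mF' : measurable_fun setT (EFin \o F) by exact/measurable_EFinP.
have iF : (P \x Q)%E.-integrable setT (EFin \o F) by apply/integrable12ltyP.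
have i1 := integrable_fubini_F iF.
have mA : measurable_fun setT (abse \o (EFin \o F)) by exact: measurableT_comp.
have A0 z : (0 <= (abse \o (EFin \o F)) z)%E by exact: abse_ge0.
have i2 : Q.-integrable setT (fubini_G P (EFin \o F)).
  apply/integrableP; split; first exact: measurable_fubini_G iF.
  have := (integrable21ltyP P Q mF').1 iF; apply: le_lt_trans.
  have mG := measurable_fubini_G iF.
  apply: ge0_le_integral => //.
  - exact: measurableT_comp.
  - exact: (measurable_fun_fubini_tonelli_G _ mA A0).
  - move=> y _; apply: le_abse_integral => //.
    exact: (measurableT_comp mF' (pair2_measurable y)).
have a1 : {ae P, forall x, fubini_F Q (EFin \o F) x = (\int[Q]_y F (x, y))%:E}.
  apply: filterS (integrable_ae measurableT i1) => x /(_ I) h.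
  by rewrite /Rintegral fineK.
have a2 : {ae Q, forall y, fubini_G P (EFin \o F) y = (\int[P]_x F (x, y))%:E}.
  apply: filterS (integrable_ae measurableT i2) => x /(_ I) h.
  by rewrite /Rintegral fineK.
have m1 : measurable_fun setT (fun x => \int[Q]_y F (x, y)).
  by apply: (measurableT_comp (fine_measurable measurableT)); exact: measurable_int i1.
have m2 : measurable_fun setT (fun y => \int[P]_x F (x, y)).
  by apply: (measurableT_comp (fine_measurable measurableT)); exact: measurable_int i2.
have j1 : intg P (fun x => \int[Q]_y F (x, y)).
  apply/integrableP; split; first exact/measurable_EFinP.
  have /integrableP[_] := i1; congr (_ < _)%E; apply: ae_eq_integral => //.
  - by apply: measurableT_comp => //; exact: measurable_int i1.
  - by apply: measurableT_comp => //; exact/measurable_EFinP.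
  - by apply: filterS a1 => x + _ => ->.
have j2 : intg Q (fun y => \int[P]_x F (x, y)).
  apply/integrableP; split; first exact/measurable_EFinP.
  have /integrableP[_] := i2; congr (_ < _)%E; apply: ae_eq_integral => //.
  - by apply: measurableT_comp => //; exact: measurable_int i2.
  - by apply: measurableT_comp => //; exact/measurable_EFinP.
  - by apply: filterS a2 => x + _ => ->.
split => //; congr fine.
transitivity (\int[P]_x fubini_F Q (EFin \o F) x)%E.
  apply: ae_eq_integral => //; [exact/measurable_EFinP|exact: measurable_int i1|].
  by apply: filterS a1 => x ->.
rewrite (Fubini iF); apply: ae_eq_integral => //; [exact: measurable_int i2|exact/measurable_EFinP|].
by apply: filterS a2 => x h _; exact: h.
Qed.

Lemma Fubini_ae (F : T1 * T2 -> R) : measurable_fun setT F ->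
  (\int[P]_x \int[Q]_y `|F (x, y)|%:E < +oo)%E ->
  {ae Q, forall y, intg P (fun x => F (x, y))}.
Proof.
move=> mF Foo.
have mF' : measurable_fun setT (EFin \o F) by exact/measurable_EFinP.
have iF : (P \x Q)%E.-integrable setT (EFin \o F) by apply/integrable12ltyP.
exact: ae_integrable2 iF.
Qed.

(** On a probability space a uniform bound on the slice integrals already gives
integrability for the product measure. *)
Lemma unif_Fubini (F : T1 * T2 -> R) (C : R) : measurable_fun setT F ->
  (forall t, intg Q (fun x => F (t, x))) ->
  (forall t, \int[Q]_x `|F (t, x)| <= C) ->
  [/\ intg Q (fun x => \int[P]_t F (t, x)),
   \int[Q]_x \int[P]_t F (t, x) = \int[P]_t \int[Q]_x F (t, x),
   {ae Q, forall x, intg P (fun t => F (t, x))} &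
   intg P (fun t => \int[Q]_x F (t, x))].
Proof.
move=> mF Fi FC.
suff Foo : (\int[P]_t \int[Q]_x `|F (t, x)|%:E < +oo)%E.
  by have [h1 h2 h3] := Fubini_R mF Foo; split => //; exact: Fubini_ae mF Foo.
apply: (@le_lt_trans _ _ (\int[P]_t (Num.max C 0)%:E)%E).
  have C0 : 0 <= Num.max C 0 by rewrite le_max lexx orbT.
  apply: ge0_le_integral => //.
  - by move=> t _; exact: integral_ge0.
  - apply: (measurable_fun_fubini_tonelli_F (fun z => `|F z|%:E)) => //.
    by apply/measurable_EFinP; exact: measurableT_comp.
  - by move=> t _; rewrite (Int_EFin (intg_norm (Fi t))) lee_fin le_max FC.
by rewrite integral_cst//= probability_setT mule1 ltry.
Qed.

(** For nonnegative F both assertions say that the double integral vanishes. *)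
Lemma ae_swap (F : T1 * T2 -> R) : measurable_fun setT F ->
  (forall z, 0 <= F z) ->
  {ae Q, forall y, {ae P, forall x, F (x, y) = 0}} ->
  {ae P, forall x, {ae Q, forall y, F (x, y) = 0}}.
Proof.
move=> mF F0 h.
have mF' : measurable_fun setT (EFin \o F) by exact/measurable_EFinP.
have F0' z : (0 <= (EFin \o F) z)%E by rewrite lee_fin.
have m1 : measurable_fun setT (fubini_F Q (EFin \o F)).
  exact: measurable_fun_fubini_tonelli_F.
have : (\int[P]_x `|fubini_F Q (EFin \o F) x| = 0)%E.
  transitivity (\int[P]_x fubini_F Q (EFin \o F) x)%E.
    by apply: eq_integral => x _; rewrite gee0_abs//; exact: integral_ge0.
  rewrite /fubini_F (fubini_tonelli _ mF' F0') -(integral0 Q setT).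
  apply: ae_eq_integral => //.
    exact: (measurable_fun_fubini_tonelli_G _ mF' F0').
  apply: filterS h => y h _; rewrite -(integral0 P setT).
  apply: ae_eq_integral => //.
    exact: (measurableT_comp mF' (pair2_measurable y)).
  by apply: filterS h => x /= -> .
move/(ae_eq_integral_abs P measurableT m1); apply: filterS => x /(_ I) Fx.
have mx : measurable_fun setT (fun y => F (x, y)).
  exact: (measurableT_comp mF (pair1_measurable x)).
apply: Int_eq0; [|exact: aeW|by rewrite /Rintegral -/(fubini_F Q (EFin \o F) x) Fx].
apply/intgP; split => //.
have : (fubini_F Q (EFin \o F) x < +oo)%E by rewrite Fx ltry.
by congr (_ < _)%E; apply: eq_integral => y _ /=; rewrite ger0_norm.
Qed.

End fubini_real.

(** * The Borel structure of row vectors *)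

Section borel_row_vectors.
Context (R : realType).

Lemma cvg_pair2 (T U V : topologicalType) (f : T -> U) (g : T -> V) x :
  {for x, continuous f} -> {for x, continuous g} ->
  {for x, continuous (fun z => (f z, g z))}.
Proof. by move=> cf cg; apply: (@cvg_pair _ _ _ _ (nbhs (f x)) (nbhs (g x))). Qed.

(** A countable base of the topology. *)
Definition rat_box d (p : 'rV[rat]_d * nat) : set 'rV[R]_d :=
  [set y | forall i, `|ratr (p.1 0 i) - y 0 i| < p.2.+1%:R^-1].

Lemma measurable_rat_box d (p : 'rV[rat]_d * nat) : measurable (rat_box p).
Proof.
rewrite (_ : rat_box p = \bigcap_i (coord i @^-1` ball (ratr (p.1 0 i) : R) p.2.+1%:R^-1)).
  apply: fin_bigcap_measurable => // i _.
  by rewrite -[X in measurable X]setTI; apply: measurable_coord => //; exact: measurable_ball.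
by apply/seteqP; split => [y By i _|y By i]; exact: By.
Qed.

(** Open sets are countable unions of rational boxes. This makes the sigma-algebra
generated by the coordinates contain the open sets, and it turns assertions
about all open sets into countably many. *)
Lemma rat_box_open d (O : set 'rV[R]_d) x : open O -> O x ->
  exists p, rat_box p x /\ rat_box p `<=` O.
Proof.
move=> oO Ox.
have /nbhs_ballP[e e0 eO] : nbhs x O by apply: open_nbhs_nbhs.
have [k ke] : exists k, 2 * (k.+1%:R^-1 : R) < e.
  exists (Num.truncn (2 / e)).
  rewrite -ltr_pdivlMl// invf_plt ?posrE ?mulr_gt0// ?invr_gt0//.
  by rewrite invfM invrK truncnS_gt.
have h i : exists r : rat, `|ratr r - x 0 i| < (k.+1%:R^-1 : R).
  have [r] := @rat_in_itvoo R (x 0 i - k.+1%:R^-1) (x 0 i + k.+1%:R^-1) ltac:(by rewrite ltrD2l gtrN ?invr_gt0).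
  by rewrite in_itv/= => /andP[r1 r2]; exists r; rewrite ltr_norml ltrBrDr addrC r1/= ltrBlDr addrC r2.
have [q qx] := @boolp.choice _ _ _ h.
exists (\row_i q i, k); split => [i|y yB]; first by rewrite !mxE; exact: qx.
apply: eO; split => // i j; rewrite (ord1 i) /ball/= /ball_.
have := yB j; rewrite !mxE/= => yj.
rewrite (le_lt_trans (ler_distD (ratr (q j)) _ _))//.
by rewrite (lt_trans _ ke)// mulr_natl mulr2n ltrD// distrC.
Qed.

Lemma measurable_open d (O : set 'rV[R]_d) : open O -> measurable O.
Proof.
move=> oO.
rewrite (_ : O = \bigcup_(p in [set p | rat_box p `<=` O]) rat_box p).
  rewrite bigcup_mkcond; apply: countable_bigcupT_measurable => [|p]; first exact: countableP.
  by case: ifP => // _; exact: measurable_rat_box.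
apply/seteqP; split => [x /(rat_box_open oO)[p [xp pO]]|x [p pO]]; last exact: pO.
by exists p.
Qed.

Lemma measurable_continuous d (f : 'rV[R]_d -> R) : continuous f ->
  measurable_fun setT f.
Proof.
move=> /continuousP cf; apply: (measurability _ (RGenOpens.measurableE R)).
move=> _ [_ [a [b ->] <-]]; rewrite setTI; apply: measurable_open.
exact/cf/interval_open.
Qed.

Lemma continuous_rV dT (T : topologicalType) (f : T -> 'rV[R]_dT) :
  (forall i, continuous (fun x => f x 0 i)) -> continuous f.
Proof.
move=> cf x; apply/cvg_ballP => e e0.
have : \forall y \near x, forall i, ball (f x 0 i) e (f y 0 i).
  apply: filter_forall => i.
  by have /cvg_ballP := cf i x; apply.
by apply: filterS => y h; split => // i j; rewrite (ord1 i).
Qed.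

Lemma continuous_coord d (i : 'I_d) : continuous (fun x : 'rV[R]_d => x 0 i).
Proof.
move=> x A /nbhs_ballP[e e0 eA]; apply/nbhs_ballP; exists e => // y [_ xy].
exact/eA/xy.
Qed.

(** The pair of two row vectors is one longer row vector, on which continuous
functions are known to be measurable. *)
Lemma measurable_comp2 dsp (T : measurableType dsp) n m (F : 'rV[R]_n * 'rV[R]_m -> R)
  (g : T -> 'rV[R]_n) (h : T -> 'rV[R]_m) : continuous F ->
  measurable_fun setT g -> measurable_fun setT h ->
  measurable_fun setT (fun x => F (g x, h x)).
Proof.
move=> cF mg mh.
have -> : (fun x => F (g x, h x)) =
    (fun z : 'rV[R]_(n + m) => F (lsubmx z, rsubmx z)) \o (fun x => row_mx (g x) (h x)).
  by apply/funext => x /=; rewrite row_mxKl row_mxKr.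
apply: measurableT_comp.
  apply: measurable_continuous => z.
  apply: (@continuous_comp _ _ _ (fun z : 'rV[R]_(n + m) => (lsubmx z, rsubmx z)) F); last exact: cF.
  apply: cvg_pair2 => /=; apply: continuous_rV => i y.
    by under eq_fun do rewrite mxE; exact: continuous_coord.
  by under eq_fun do rewrite mxE; exact: continuous_coord.
apply: measurable_coordP => i; rewrite /comp /coord.
case: (split_ordP i) => j ->.
  under eq_fun do rewrite row_mxEl.
  exact: (measurableT_comp (@measurable_coord R n j) mg).
under eq_fun do rewrite row_mxEr.
exact: (measurableT_comp (@measurable_coord R m j) mh).
Qed.

Lemma measurable_comp2r dsp (T : measurableType dsp) n (F : 'rV[R]_n * R -> R)
  (g : T -> 'rV[R]_n) (h : T -> R) : continuous F ->
  measurable_fun setT g -> measurable_fun setT h ->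
  measurable_fun setT (fun x => F (g x, h x)).
Proof.
move=> cF mg mh.
have -> : (fun x => F (g x, h x)) =
    (fun x => (fun z : 'rV[R]_n * 'rV[R]_1 => F (z.1, z.2 0 0)) (g x, const_mx (h x))).
  by apply/funext => x /=; rewrite mxE.
apply: (@measurable_comp2 _ _ n 1 (fun z : 'rV[R]_n * 'rV[R]_1 => F (z.1, z.2 0 0))) => //.
  move=> z; apply: (@continuous_comp _ _ _ (fun z : 'rV[R]_n * 'rV[R]_1 => (z.1, z.2 0 0)) F); last exact: cF.
  apply: cvg_pair2 => /=; first exact: cvg_fst.
  apply: (@continuous_comp _ _ _ snd (fun x : 'rV[R]_1 => x 0 0)); first exact: cvg_snd.
  exact: continuous_coord.
apply: measurable_coordP => i; rewrite /comp /coord.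
by under eq_fun do rewrite mxE.
Qed.

End borel_row_vectors.

Section torus_integral.
Context (R : realType) (d : nat).
Local Notation X := 'rV[R]_d.
Local Notation mu := (torus_measure R d).

Lemma intg_shift (g : X -> R) (a : X) : Zd_periodic g -> intg mu g ->
  intg mu (fun x => g (x + a)).
Proof.
move=> pg /intgP[mg gi]; apply/intgP; split.
  exact: (measurableT_comp mg (measurable_shift a)).
rewrite (@integral_torus_shift _ _ (fun x => `|g x|%:E))//.
- by apply/measurable_EFinP; exact: measurableT_comp.
- by move=> i x; rewrite pg.
Qed.

Lemma Int_shift (g : X -> R) (a : X) : Zd_periodic g -> intg mu g ->
  \int[mu]_x g (x + a) = \int[mu]_x g x.
Proof.
move=> pg gi; have mg := intg_meas gi.
rewrite /Rintegral; congr fine; rewrite [LHS]integralE [RHS]integralE.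
have mE : measurable_fun setT (EFin \o g) by exact/measurable_EFinP.
congr (_ - _)%E.
- rewrite -[RHS](@integral_torus_shift _ _ (EFin \o g)^\+%E a)//.
  + by apply: eq_integral => x _; rewrite !funeposE.
  + exact: measurable_funepos.
  + by move=> i x; rewrite !funeposE/= pg.
- rewrite -[RHS](@integral_torus_shift _ _ (EFin \o g)^\-%E a)//.
  + by apply: eq_integral => x _; rewrite !funenegE.
  + exact: measurable_funeneg.
  + by move=> i x; rewrite !funenegE/= pg.
Qed.

End torus_integral.

(** * Trigonometric polynomials and approximation of indicator functions *)

Section trig.
Context (R : realType) (d : nat).
Local Notation X := 'rV[R]_d.
Local Notation mu := (torus_measure R d).

(** Real trigonometric polynomials. The phase in the cosine makes the class visibly
stable under translations and derivatives, and provides the sines. *)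
Inductive trig : (X -> R) -> Prop :=
| trig_cst c : trig (fun=> c)
| trig_cos i a : trig (fun x => cos (2 * pi * x 0 i + a))
| trig_add f g : trig f -> trig g -> trig (fun x => f x + g x)
| trig_mul f g : trig f -> trig g -> trig (fun x => f x * g x).

Lemma cos_period (t : R) : cos (t + 2 * pi) = cos t.
Proof. by rewrite mulr_natl cosD2pi. Qed.

Lemma trig_periodic g : trig g -> Zd_periodic g.
Proof.
elim=> [c|j a|f h _ IHf _ IHh|f h _ IHf _ IHh] i x //.
- rewrite !mxE eqxx/=; case: (j == i); last by rewrite addr0.
  by rewrite mulrDr mulr1 addrAC cos_period.
- by rewrite IHf IHh.
- by rewrite IHf IHh.
Qed.

Lemma trig_bounded g : trig g -> exists M, forall x, `|g x| <= M.
Proof.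
elim=> [c|j a|f h _ [M IHf] _ [N IHh]|f h _ [M IHf] _ [N IHh]].
- by exists `|c|.
- by exists 1 => x; exact: cos_max.
- by exists (M + N) => x; rewrite (le_trans (ler_normD _ _))// lerD.
- by exists (M * N) => x; rewrite normrM ler_pM.
Qed.

Lemma trig_shift a g : trig g -> trig (fun x => g (x + a)).
Proof.
elim=> [c|j b|f h _ IHf _ IHh|f h _ IHf _ IHh].
- exact: trig_cst.
- have := trig_cos j (2 * pi * a 0 j + b); congr trig.
  by apply/funext => x; congr cos; rewrite mxE; ring.
- exact: trig_add.
- exact: trig_mul.
Qed.

Lemma trig_opp f : trig f -> trig (fun x => - f x).
Proof.
move=> tf; have := trig_mul (trig_cst (-1)) tf; congr trig.
by apply/funext => x; rewrite mulN1r.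
Qed.

Lemma trig_sub f g : trig f -> trig g -> trig (fun x => f x - g x).
Proof. by move=> tf tg; apply: trig_add => //; exact: trig_opp. Qed.

Lemma trig_exp f n : trig f -> trig (fun x => f x ^+ n).
Proof.
move=> tf; elim: n => [|n IH]; first exact: (trig_cst 1).
by under eq_fun do rewrite exprS; exact: trig_mul.
Qed.

Lemma trig_sum (I : Type) (r : seq I) (F : I -> X -> R) : (forall i, trig (F i)) ->
  trig (fun x => \sum_(i <- r) F i x).
Proof.
move=> tF; elim: r => [|i r IH].
  by under eq_fun do rewrite big_nil; exact: trig_cst.
by under eq_fun do rewrite big_cons; exact: trig_add.
Qed.

Lemma line_quotient (V : normedModType R) (f : V -> R) (x v : V) (t : R) :
  (fun h : R => h^-1 *: ((f \o shift (x + t *: v)) (h *: v) - f (x + t *: v))) =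
  (fun h : R => h^-1 *: (((fun h : R => f (x + h *: v)) \o shift t) (h *: 1) - f (x + t *: v))).
Proof.
apply/funext => h /=; congr (_ *: (f _ - _)).
by rewrite [h%:A]mulr1 scalerDl addrCA addrC.
Qed.

(** Directional derivatives are one-dimensional derivatives along lines, for which
the chain rule and the mean value theorem are available. *)
Lemma derive_line (V : normedModType R) (f : V -> R) (x v : V) (t : R) :
  'D_v f (x + t *: v) = 'D_1 (fun h : R => f (x + h *: v)) t.
Proof. by rewrite /derive line_quotient. Qed.

Lemma derivable_line (V : normedModType R) (f : V -> R) (x v : V) (t : R) :
  derivable f (x + t *: v) v <-> derivable (fun h : R => f (x + h *: v)) t 1.
Proof. by rewrite /derivable line_quotient. Qed.

Lemma trig_differentiable g x : trig g -> differentiable g x.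
Proof.
elim=> [c|j a|f h _ IHf _ IHh|f h _ IHf _ IHh].
- exact: differentiable_cst.
- pose l (x : X) := 2 * pi * x 0 j + a.
  apply: (@differentiable_comp _ _ _ _ l cos); last first.
    by apply/derivable1_diffP; have [] := is_derive_cos (l x).
  apply: differentiableD; last exact: differentiable_cst.
  apply: differentiableM; first exact: differentiable_cst.
  exact: differentiable_coord.
- exact: differentiableD.
- exact: differentiableM.
Qed.

Lemma trig_continuous g : trig g -> continuous g.
Proof. by move=> tg x; apply/differentiable_continuous/trig_differentiable. Qed.

Lemma trig_measurable g : trig g -> measurable_fun setT g.
Proof. by move=> /trig_continuous; exact: measurable_continuous. Qed.

Lemma trig_intg g : trig g -> intg mu g.
Proof.
move=> tg; have [M gM] := trig_bounded tg.
by apply: intg_bounded (trig_measurable tg) _; exact: aeW.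
Qed.

Lemma trig_mul_intg g w : trig g -> intg mu w -> intg mu (fun x => w x * g x).
Proof.
move=> tg wi; have [M gM] := trig_bounded tg.
under eq_fun do rewrite mulrC.
apply: (intg_mull (trig_measurable tg) _ wi); apply: aeW; exact: gM.
Qed.

Lemma trig_partial g i : trig g -> trig (partial g i).
Proof.
elim=> [c|j a|f h tf IHf th IHh|f h tf IHf th IHh].
- rewrite (_ : partial _ i = fun=> 0); first exact: trig_cst.
  by apply/funext => x; rewrite /partial derive_cst.
- have -> : partial (fun x : X => cos (2 * pi * x 0 j + a)) i =
      (fun x => 2 * pi * (j == i)%:R * cos (2 * pi * x 0 j + (a + pi / 2))).
    apply/funext => x; rewrite /partial -{1}[x]addr0 -(scale0r (unit_vec R i)) derive_line.
    have -> : (fun h : R => cos (2 * pi * (x + h *: unit_vec R i) 0 j + a)) =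
        cos \o (fun h => (2 * pi * (j == i)%:R) * h + (2 * pi * x 0 j + a)).
      by apply/funext => h /=; congr cos; rewrite !mxE eqxx/=; ring.
    rewrite [LHS](@derive_val _ _ _ _ _ _ _ (is_derive1_comp (is_derive_cos _) _))//.
    rewrite mulr0 add0r [in RHS]addrA cosDpihalf addr0 /GRing.scale/= mulr1.
    by rewrite mulrC mulrN.
  by apply: trig_mul; [exact: trig_cst|exact: trig_cos].
- rewrite (_ : partial _ i = fun x => partial f i x + partial h i x); first exact: trig_add.
  by apply/funext => x; rewrite /partial deriveD//; apply/diff_derivable/trig_differentiable.
- rewrite (_ : partial _ i = fun x => f x * partial h i x + h x * partial f i x).
    by apply: trig_add; exact: trig_mul.
  by apply/funext => x; rewrite /partial deriveM//; apply/diff_derivable/trig_differentiable.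
Qed.

Lemma trig_test g : trig g -> test_function g.
Proof.
move=> tg; split; first exact: trig_periodic.
move=> ks; elim: ks g tg => [|k ks IH] g tg x /=.
  exact: trig_differentiable.
by apply: IH; exact: trig_partial.
Qed.

(** Kernels that integration in y turns into trigonometric polynomials in x. *)
Inductive separated : (X -> X -> R) -> Prop :=
| sep_mul f g : trig f -> trig g -> separated (fun y x => f y * g x)
| sep_add K L : separated K -> separated L -> separated (fun y x => K y x + L y x).

Lemma separated_mul K L : separated K -> separated L ->
  separated (fun y x => K y x * L y x).
Proof.
move=> sK sL; elim: sK => [f g tf tg|K1 K2 _ IH1 _ IH2]; last first.
  by under eq_fun do under eq_fun do rewrite mulrDl; exact: sep_add.
elim: sL => [f' g' tf' tg'|L1 L2 _ IH1 _ IH2]; last first.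
  by under eq_fun do under eq_fun do rewrite mulrDr; exact: sep_add.
under eq_fun do under eq_fun do rewrite mulrACA.
by apply: (sep_mul (f := fun y => f y * f' y) (g := fun y => g y * g' y)); exact: trig_mul.
Qed.

(** By the addition formula for the cosine, a translate T(y - x) is a finite sum of
products. Hence convolutions with T are again trigonometric polynomials. *)
Lemma trig_separated g : trig g -> separated (fun y x => g (y - x)).
Proof.
elim=> [c|j a|f h tf IHf th IHh|f h tf IHf th IHh].
- have := sep_mul (trig_cst c) (trig_cst 1); congr separated.
  by apply/funext => y; apply/funext => x; rewrite mulr1.
- have := sep_add (sep_mul (trig_cos j a) (trig_cos j 0))
    (sep_mul (trig_cos j (a - pi / 2)) (trig_cos j (- (pi / 2)))).
  congr separated; apply/funext => y; apply/funext => x.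
  rewrite !mxE addr0 addrA !cosBpihalf -cosB; congr cos; ring.
- exact: sep_add.
- exact: separated_mul.
Qed.

Lemma separated_int K w : separated K -> intg mu w ->
  trig (fun x => \int[mu]_y (w y * K y x)) /\ (forall x, intg mu (fun y => w y * K y x)).
Proof.
move=> sK wi; elim: sK => [f g tf tg|K1 K2 _ [IH1 J1] _ [IH2 J2]].
  have wf := trig_mul_intg tf wi.
  have E x : (fun y => w y * (f y * g x)) = (fun y => g x * (w y * f y)).
    by apply/funext => y; ring.
  split; last by move=> x; rewrite E; exact: intgZ.
  rewrite (_ : (fun x => _) = fun x => g x * (\int[mu]_y (w y * f y))).
    by apply: trig_mul => //; exact: trig_cst.
  by apply/funext => x; rewrite E IntZ.
have E x : (fun y => w y * (K1 y x + K2 y x)) = (fun y => w y * K1 y x + w y * K2 y x).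
  by apply/funext => y; ring.
split; last by move=> x; rewrite E; exact: intgD.
rewrite (_ : (fun x => _) = fun x => \int[mu]_y (w y * K1 y x) + \int[mu]_y (w y * K2 y x)).
  exact: trig_add.
by apply/funext => x; rewrite E IntD.
Qed.

End trig.

Section step_approximation.
Context (R : realType).

Lemma expr_gap_le (a : R) (N : nat) : 0 <= a <= 1 ->
  (1 - a) ^+ N * (1 + N%:R * a) <= 1.
Proof.
move=> /andP[a0 a1].
have h : 1 + N%:R * a <= (1 + a) ^+ N.
  elim: N => [|N IH]; first by rewrite mul0r addr0 expr0.
  rewrite exprS (le_trans _ (ler_wpM2l _ IH)) ?addr_ge0//.
  rewrite -natr1; have : 0 <= N%:R * a * a by rewrite !mulr_ge0.
  lra.
apply: (le_trans (ler_wpM2l _ h)); first by rewrite exprn_ge0// subr_ge0.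
rewrite -exprMn exprn_ile1//; nra.
Qed.

Lemma bernoulli_le (a : R) (N : nat) : 0 <= a <= 1 ->
  1 - N%:R * a <= (1 - a) ^+ N.
Proof.
move=> /andP[a0 a1]; elim: N => [|N IH]; first by rewrite mul0r subr0 expr0.
rewrite exprS (le_trans _ (ler_wpM2l _ IH)) ?subr_ge0//.
rewrite -natr1; have : 0 <= N%:R * a * a by rewrite !mulr_ge0.
lra.
Qed.

(** These polynomials in q tend to 1 for q < 1/2 and to 0 for q > 1/2: by
Bernoulli's inequality the exponent 2^n separates q^n << 2^-n from
q^n >> 2^-n. They produce indicator functions as limits. *)
Definition step (q : R) (n : nat) := (1 - q ^+ n) ^+ (2 ^ n).

Lemma step_itv q n : 0 <= q <= 1 -> 0 <= step q n <= 1.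
Proof.
move=> /andP[q0 q1].
have h : 0 <= 1 - q ^+ n <= 1 by rewrite subr_ge0 exprn_ile1//= gerBl exprn_ge0.
by move/andP: h => [h0 h1]; rewrite exprn_ge0//= exprn_ile1.
Qed.

Lemma step_cvg1 q : 0 <= q -> 2 * q < 1 -> step q n @[n --> \oo] --> (1 : R).
Proof.
move=> q0 q1.
apply: (@squeeze_cvgr _ _ _ _ (fun n => 1 - (2 * q) ^+ n) (fun=> 1)); last 2 first.
- rewrite -[X in _ --> X]subr0; apply: cvgB; first exact: cvg_cst.
  by apply: cvg_expr; rewrite ger0_norm// mulr_ge0.
- exact: cvg_cst.
apply: nearW => n; have q1' : 0 <= q <= 1 by rewrite q0/=; lra.
have /andP[_ ->] := step_itv n q1'; rewrite andbT.
rewrite exprMn -natrX; apply: bernoulli_le.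
by rewrite exprn_ge0//= exprn_ile1//; case/andP: q1'.
Qed.

Lemma step_cvg0 q : q <= 1 -> 1 < 2 * q -> step q n @[n --> \oo] --> (0 : R).
Proof.
move=> q1 q2.
have q0 : 0 < q by lra.
apply: (@squeeze_cvgr _ _ _ _ (fun=> 0) (fun n => (2 * q)^-1 ^+ n)); last 2 first.
- exact: cvg_cst.
- by apply: cvg_expr; rewrite ger0_norm ?invr_ge0 ?invf_lt1; lra.
apply: nearW => n; have q1' : 0 <= q <= 1 by rewrite (ltW q0).
have /andP[s0 s1] := step_itv n q1'; rewrite s0/=.
have a01 : 0 <= q ^+ n <= 1 by rewrite exprn_ge0 ?exprn_ile1// ltW.
have := expr_gap_le (2 ^ n) a01.
rewrite natrX -exprMn -/(step q n) => h.
rewrite exprVn -[leRHS]mul1r ler_pdivlMr ?exprn_gt0 ?mulr_gt0//.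
apply: le_trans h; apply: ler_wpM2l => //; lra.
Qed.

End step_approximation.

Section trig_density.
Context (R : realType) (d : nat).
Local Notation X := 'rV[R]_d.
Local Notation mu := (torus_measure R d).

(** The bounds 0 <= T <= 1 are what makes the class stable under intersections. *)
Definition trig_approx (A : set X) := measurable A /\
  forall e : R, 0 < e -> exists T, [/\ trig T, forall x, 0 <= T x <= 1 &
    \int[mu]_x `|\1_A x - T x| <= e].

Lemma indic_itv (T : Type) (A : set T) x : 0 <= (\1_A x : R) <= 1.
Proof. by rewrite indicE; case: (_ \in _); rewrite lexx ler01. Qed.

Lemma intg_indic_sub (A : set X) T : measurable A -> trig T ->
  intg mu (fun x => \1_A x - T x).
Proof. by move=> mA tT; apply: intgB; [exact: integrable_indic|exact: trig_intg]. Qed.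

Lemma trig_approxC A : trig_approx A -> trig_approx (~` A).
Proof.
move=> [mA hA]; split; first exact: measurableC.
move=> e /hA[T [tT T01 TA]]; exists (fun x => 1 - T x); split.
- by apply: trig_sub => //; exact: trig_cst.
- by move=> x; have /andP[? ?] := T01 x; apply/andP; split; lra.
- apply: le_trans TA; rewrite le_eqVlt; apply/orP; left; apply/eqP.
  apply: eq_Rintegral => x _; rewrite -normrN; congr (`|_|).
  by rewrite !indicE in_setC; case: (x \in A) => /=; ring.
Qed.

(** Take the product T S: since both factors lie in [0, 1], the errors add. *)
Lemma trig_approxI A B : trig_approx A -> trig_approx B -> trig_approx (A `&` B).
Proof.
move=> [mA hA] [mB hB]; split; first exact: measurableI.
move=> e e0; have e20 : 0 < e / 2 by rewrite divr_gt0.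
have [T [tT T01 TA]] := hA _ e20; have [S [tS S01 SB]] := hB _ e20.
exists (fun x => T x * S x); split; first exact: trig_mul.
- by move=> x; have /andP[? ?] := T01 x; have /andP[? ?] := S01 x; rewrite mulr_ge0//= mulr_ile1.
- rewrite (splitr e); apply: le_trans (lerD TA SB).
  have iT := intg_norm (intg_indic_sub mA tT); have iS := intg_norm (intg_indic_sub mB tS).
  rewrite -IntD//; apply: Int_le.
  + by apply/intg_norm/intg_indic_sub; [exact: measurableI|exact: trig_mul].
  + exact: intgD.
  + apply: aeW => x; rewrite indicI/=.
    have -> : \1_A x * \1_B x - T x * S x = \1_B x * (\1_A x - T x) + T x * (\1_B x - S x) by ring.
    rewrite (le_trans (ler_normD _ _))// !normrM.
    have /andP[? ?] := T01 x; have /andP[? ?] := indic_itv B x.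
    by apply: lerD; rewrite ler_piMl// ger0_norm.
Qed.

Lemma trig_approx0 : trig_approx set0.
Proof.
split=> // e e0; exists (fun=> 0); split; first exact: trig_cst.
- by move=> x; rewrite lexx ler01.
- by under eq_Rintegral do rewrite indic0 subrr normr0; rewrite Int_cst ltW.
Qed.

(** A countable union is an L1 limit of finite unions. *)
Lemma trig_approx_bigcup F : (forall n, trig_approx (F n)) ->
  trig_approx (\bigcup_(n : nat) F n).
Proof.
move=> hF; set A := \bigcup_n F n.
have mA : measurable A by apply: bigcup_measurable => n _; exact: (hF n).1.
split=> // e e0.
pose B n := \big[setU/set0]_(i < n) F i.
have hB n : trig_approx (B n).
  elim: n => [|n IH]; first by rewrite /B big_ord0; exact: trig_approx0.
  rewrite /B big_ord_recr/= -/(B n) -[B n]setCK -[F n]setCK -setCI.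
  by apply/trig_approxC/trig_approxI; exact: trig_approxC.
have [_ _ /cvgr0_norm_le/(_ _ (divr_gt0 e0 (ltr0Sn R 1)))] :
  [/\ intg mu (\1_A : X -> R), forall n, intg mu (\1_(B n) : X -> R) &
  \int[mu]_x `|(\1_(B n) x : R) - \1_A x| @[n --> \oo] --> 0].
  apply: (Int_dct (g := fun=> 1)).
  - by move=> n; apply: measurable_indic; exact: (hB n).1.
  - exact: measurable_indic.
  - apply: aeW => x; have [xA|xA] := pselect (A x).
      have [n _ Fx] := xA.
      apply: cvg_near_cst; exists n.+1 => // k /= nk.
      rewrite !indicE !mem_set//; apply: (bigsetU_sup (i := n)) => //.
    apply: cvg_near_cst; apply: nearW => n; rewrite !indicE !memNset//.
    by rewrite /B -bigcup_mkord => -[i _ Fi]; apply: xA; exists i.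
  - exact: intg_cst.
  - move=> n; apply: aeW => x; have /andP[? ?] := indic_itv (B n) x.
    by rewrite ger0_norm.
move=> [n _ /(_ n (leqnn n))] /=.
have iAB : intg mu (fun x => (\1_(B n) x : R) - \1_A x).
  by apply: intgB; apply: integrable_indic => //; exact: (hB n).1.
rewrite ger0_norm; last by apply: Int_ge0; [exact: intg_meas (intg_norm iAB)|exact: aeW].
move=> h; have [T [tT T01 TA]] := (hB n).2 _ (divr_gt0 e0 (ltr0Sn R 1)).
exists T; split => //; rewrite (splitr e); apply: le_trans (lerD h TA).
have iB := intg_norm (intg_indic_sub (hB n).1 tT).
rewrite -IntD//; last exact: intg_norm.
apply: Int_le; [by apply/intg_norm/intg_indic_sub|apply: intgD => //; exact: intg_norm|].
by apply: aeW => x; rewrite [X in _ <= X + _]distrC ler_distD.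
Qed.

(** The arc ]0, t[ of the circle is the set where the cosine of the distance to its
midpoint t/2 exceeds its value cos(pi t) at the end points. *)
Lemma cos_arc (t x : R) : 0 < t < 1 -> 0 < x < 1 -> x != t ->
  if x < t then cos (pi * t) < cos (2 * pi * x + (- (pi * t)))
  else cos (2 * pi * x + (- (pi * t))) < cos (pi * t).
Proof.
move=> /andP[t0 t1] /andP[x0 x1] xt.
have pi0 := pi_gt0 R.
have tI : pi * t \in `[0, pi : R] 
  by rewrite in_itv/=; apply/andP; split; [rewrite mulr_ge0// ltW|rewrite ger_pMr// ltW].
case: ifPn => xlt.
  have xp : 2 * pi * x < 2 * pi * t by rewrite ltr_pM2l// mulr_gt0.
  have [h|h] := leP 0 (2 * pi * x + (- (pi * t))).
    rewrite ltr_cos//; [lra|rewrite in_itv/= h/=].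
    have : pi * t <= pi * 1 by rewrite ler_pM2l// ltW.
    lra.
  have px : 0 < 2 * pi * x by rewrite !mulr_gt0.
  rewrite -[X in _ < X]cosN ltr_cos//; first lra.
  rewrite in_itv/=; apply/andP; split; first lra.
  have : pi * t <= pi * 1 by rewrite ler_pM2l// ltW.
  lra.
have {}xlt : t < x by rewrite lt_neqAle eq_sym xt leNgt.
have xp : 2 * pi * t < 2 * pi * x by rewrite ltr_pM2l// mulr_gt0.
have xq : 2 * pi * x < 2 * pi * 1 by rewrite ltr_pM2l// mulr_gt0.
have tp : 0 < pi * t by rewrite mulr_gt0.
have [h|h] := leP (2 * pi * x + (- (pi * t))) pi.
  rewrite ltr_cos//; first lra.
  by rewrite in_itv/= h andbT; lra.
have -> : cos (2 * pi * x - pi * t) = cos (2 * pi - (2 * pi * x - pi * t)).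
  by rewrite -[RHS]cosN opprB -[RHS]cos_period; congr cos; ring.
rewrite ltr_cos//; first lra.
by rewrite in_itv/=; apply/andP; split; lra.
Qed.

(** On the cube the half-space is an arc in one coordinate, thus the set where a
trigonometric polynomial exceeds a constant; compose an affine image of that
polynomial with the step polynomials. *)
Lemma trig_approx_halfspace i (t : R) : trig_approx [set x : X | x 0 i < t].
Proof.
set A := [set x | _].
have mA : measurable A.
  rewrite (_ : A = coord i @^-1` `]-oo, t[).
    by rewrite -[X in measurable X]setTI; apply: measurable_coord => //; exact: measurable_itv.
  by apply/seteqP; split => x /=; rewrite in_itv.
have oo := ae_torus_oo R d.
have mI : measurable_fun setT (\1_A : X -> R) by exact: measurable_indic.
split => // e e0; have [t0|t0] := leP t 0.
  exists (fun=> 0); split; [exact: trig_cst|by move=> x; rewrite lexx ler01|].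
  rewrite (@eq_ae_Int _ _ _ _ _ (fun=> 0)) ?Int_cst ?ltW//.
    by apply: measurableT_comp => //; exact: measurable_funB.
  apply: filterS oo => x /(_ i)/andP[x0 _]; rewrite indicE memNset ?subrr ?normr0//.
  by rewrite /A/=; apply/negP; rewrite -leNgt (le_trans t0)// ltW.
have [t1|t1] := leP 1 t.
  exists (fun=> 1); split; [exact: trig_cst|by move=> x; rewrite lexx ler01|].
  rewrite (@eq_ae_Int _ _ _ _ _ (fun=> 0)) ?Int_cst ?ltW//.
    by apply: measurableT_comp => //; exact: measurable_funB.
  apply: filterS oo => x /(_ i)/andP[_ x1]; rewrite indicE mem_set ?subrr ?normr0//.
  by rewrite /A/= (lt_le_trans x1).
have xt : {ae mu, forall x : X, x 0 i != t}.
  have := @ae_torus_box R d (~` [set t]) (measurableC (measurable_set1 _)).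
  rewrite setIC -[X in lebesgue_measure X]/(`[0%R, 1%R] `\` [set t]).
  rewrite measureD//=; last by rewrite lebesgue_measure_itv/= lte_fin ltr01 -EFinD ltry.
  rewrite (_ : _ `&` _ = [set t]); last first.
    by apply/setIidPr => _ -> /=; rewrite in_itv/= !ltW.
  rewrite lebesgue_measure_set1 sube0 lebesgue_measure_itv/= lte_fin ltr01 -EFinD subr0.
  by move=> /(_ erefl); apply: filterS => x /(_ i) /eqP.
(* scaled so that 0 <= q <= 1, with q > 1/2 exactly on the arc *)
pose q (x : X) := (4 + cos (2 * pi * x 0 i + (- (pi * t))) - cos (pi * t)) / 8.
have tq : trig q.
  apply: (@trig_mul _ _ (fun x : X => 4 + cos (2 * pi * x 0 i + (- (pi * t))) - cos (pi * t)) (fun=> 8^-1)); last exact: trig_cst.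
  apply: trig_sub; last exact: trig_cst.
  by apply: trig_add; [exact: trig_cst|exact: trig_cos].
have q01 x : 0 <= q x <= 1.
  rewrite /q; have := cos_max (2 * pi * x 0 i + (- (pi * t))); have := cos_max (pi * t).
  by rewrite !ler_norml => /andP[? ?] /andP[? ?]; apply/andP; split; lra.
pose T n x := 1 - step (q x) n.
have tT n : trig (T n).
  apply: trig_sub; first exact: trig_cst.
  by apply: trig_exp; apply: trig_sub; [exact: trig_cst|exact: trig_exp].
have T01 n x : 0 <= T n x <= 1.
  by have /andP[? ?] := step_itv n (q01 x); rewrite /T; apply/andP; split; lra.
have [_ _ /cvgr0_norm_le/(_ _ e0)] : [/\ intg mu (\1_A : X -> R), forall n, intg mu (T n) &
  \int[mu]_x `|T n x - \1_A x| @[n --> \oo] --> 0].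
  apply: (Int_dct (g := fun=> 1)) => //.
  - by move=> n; exact: trig_measurable.
  - apply: filterS2 oo xt => x /(_ i) x01 xt.
    have := cos_arc (t := t) _ x01 xt; rewrite t0 t1 => /(_ isT).
    have /andP[q0 q1] := q01 x.
    case: ifPn => xlt h.
      rewrite indicE mem_set//= -[X in _ --> X]subr0; apply: cvgB; first exact: cvg_cst.
      apply: step_cvg0 => //; rewrite /q; lra.
    rewrite indicE memNset//=; last exact/negP.
    rewrite -[X in _ --> X](subrr 1); apply: cvgB; first exact: cvg_cst.
    by apply: step_cvg1 => //; rewrite /q; lra.
  - exact: intg_cst.
  - by move=> n; apply: aeW => x; have /andP[? ?] := T01 n x; rewrite ger0_norm.
move=> [n _ /(_ n (leqnn n))] /=.
rewrite ger0_norm; last first.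
  apply: Int_ge0; last exact: aeW.
  by apply/measurableT_comp => //; apply: measurable_funB => //; exact: trig_measurable.
move=> h; exists (T n); split => //.
by under eq_Rintegral do rewrite distrC.
Qed.

(** The approximable sets form a sigma-algebra that contains the half-spaces. *)
Lemma trig_approx_measurable (A : set X) : measurable A -> trig_approx A.
Proof.
apply: smallest_sub; first split.
- exact: trig_approx0.
- by move=> B; rewrite setTD; exact: trig_approxC.
- exact: trig_approx_bigcup.
move=> _ [i _ [Y mY <-]]; rewrite setTI.
suff : (@RGenInftyO.G R).-sigma.-measurable `<=` [set Y | trig_approx (coord i @^-1` Y)].
  by apply; rewrite -RGenInftyO.measurableE.
apply: smallest_sub => /=.
- split.
  + by rewrite /= preimage_set0; exact: trig_approx0.
  + by move=> Z /=; rewrite setTD preimage_setC; exact: trig_approxC.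
  + by move=> F hF /=; rewrite preimage_bigcup; exact: trig_approx_bigcup.
- by move=> _ [t ->]; have := trig_approx_halfspace i t; congr trig_approx.
Qed.

End trig_density.

(** * Density in L1 and continuity of translations *)

Section tails.
Context dsp (T : measurableType dsp) (R : realType) (P : probability T R).

Lemma measurable_cut (phi f : T -> R) (M : R) : measurable_fun setT phi ->
  measurable_fun setT f -> measurable_fun setT (fun x => if M < phi x then f x else 0).
Proof.
move=> mp mf; apply: measurable_fun_if => //.
- by apply: measurable_fun_ltr.
- exact: measurable_funTS.
Qed.

Lemma measurable_gt (c : R) (f : T -> R) : measurable_fun setT f ->
  measurable [set x | c < f x].
Proof.
move=> mf; rewrite (_ : mkset _ = f @^-1` `]c, +oo[).
  by rewrite -[X in measurable X]setTI; apply: mf => //; exact: measurable_itv.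
by apply/seteqP; split => x /=; rewrite in_itv/= andbT.
Qed.

Lemma intg_cut (phi f : T -> R) (M : R) : measurable_fun setT phi -> intg P f ->
  intg P (fun x => if M < phi x then f x else 0).
Proof.
move=> mp fi; apply: (intg_le _ (intg_norm fi)).
  by apply: measurable_cut => //; exact: intg_meas fi.
by apply: aeW => x; case: ifP; rewrite ?normr0.
Qed.

Lemma Int_tail (phi f : T -> R) (e : R) : measurable_fun setT phi -> intg P f ->
  0 < e -> exists2 M, 0 < M & \int[P]_x `|if M < phi x then f x else 0| <= e.
Proof.
move=> mp fi e0.
have [_ _ /cvgr0_norm_le/(_ _ e0)] : [/\ intg P (fun=> 0), forall n, intg P (fun x => if n%:R < phi x then f x else 0) &
  \int[P]_x `|(if n%:R < phi x then f x else 0) - 0| @[n --> \oo] --> 0].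
  apply: (Int_dct (g := fun x => `|f x|)) => //.
  - by move=> n; apply: measurable_cut => //; exact: intg_meas fi.
  - apply: aeW => x; apply: cvg_near_cst; exists (Num.truncn `|phi x|).+1 => // n /= nx.
    rewrite ltNge (le_trans (ler_norm _))// (le_trans (ltW (truncnS_gt _)))//.
    by rewrite ler_nat.
  - exact: intg_norm.
  - by move=> n; apply: aeW => x; case: ifP; rewrite ?normr0.
move=> [n _ /(_ n.+1 (leqnSn n))] /= h; exists n.+1%:R => //.
apply: le_trans h; rewrite ger0_norm; last exact: Rintegral_ge0.
by under [leRHS]eq_Rintegral do rewrite subr0.
Qed.

End tails.

Section trig_consequences.
Context (R : realType) (d : nat).
Local Notation X := 'rV[R]_d.
Local Notation mu := (torus_measure R d).

Lemma separated_cvg (K : X -> X -> R) (e : R) : separated K -> 0 < e ->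
  \forall h \near (0 : X), forall y, `|K y h - K y 0| <= e.
Proof.
move=> sK; elim: sK e => [f g tf tg|K1 K2 _ IH1 _ IH2] e e0.
  have [M fM] := trig_bounded tf.
  have M1 : 0 < `|M| + 1 by rewrite ltr_wpDl.
  have /cvgrPdist_le/(_ (e / (`|M| + 1)) (divr_gt0 e0 M1)) := @trig_continuous _ _ _ tg (0 : X).
  apply: filterS => h gh y; rewrite -mulrBr normrM distrC.
  rewrite -(divfK (lt0r_neq0 M1) e) [leRHS]mulrC ler_pM//.
  by rewrite (le_trans (fM y))// (le_trans (ler_norm M))// lerDl.
have e2 : 0 < e / 2 by rewrite divr_gt0.
apply: filterS2 (IH1 _ e2) (IH2 _ e2) => h h1 h2 y.
rewrite (splitr e) (le_trans _ (lerD (h1 y) (h2 y)))// (le_trans _ (ler_normD _ _))//.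
by rewrite le_eqVlt; apply/orP; left; apply/eqP; congr (`|_|); ring.
Qed.

Lemma trig_unif_continuous T (e : R) : trig T -> 0 < e ->
  \forall h \near (0 : X), forall x, `|T (x - h) - T x| <= e.
Proof.
move=> tT e0; have := separated_cvg (trig_separated tT) e0.
by apply: filterS => h + x => /(_ x); rewrite subr0.
Qed.

Lemma trig_dense_indic_sum (I : Type) (r : seq I) (a : I -> R) (A : I -> set X) (e : R) :
  (forall i, measurable (A i)) -> 0 < e ->
  exists2 T, trig T & \int[mu]_x `|\sum_(i <- r) a i * \1_(A i) x - T x| <= e.
Proof.
move=> mA; elim: r e => [|i r IH] e e0.
  exists (fun=> 0); first exact: trig_cst.
  by under eq_Rintegral do rewrite big_nil subrr normr0; rewrite Int_cst ltW.
have a1 : 0 < `|a i| + 1 by rewrite ltr_wpDl.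
have [T tT hT] := IH _ (divr_gt0 e0 (ltr0Sn R 1)).
have [S [tS _ hS]] := (trig_approx_measurable (mA i)).2 _ (divr_gt0 (divr_gt0 e0 (ltr0Sn R 1)) a1).
exists (fun x => a i * S x + T x).
  by apply: trig_add => //; apply: trig_mul => //; exact: trig_cst.
have iS := intg_indic_sub (mA i) tS.
have iT : intg mu (fun x => \sum_(i <- r) a i * \1_(A i) x - T x).
  apply: intgB; last exact: trig_intg.
  by apply: intg_sum => j; apply: intgZ; exact: integrable_indic.
rewrite (splitr e); apply: (@le_trans _ _ (`|a i| * (\int[mu]_x `|\1_(A i) x - S x|) +
  \int[mu]_x `|\sum_(i <- r) a i * \1_(A i) x - T x|)); last first.
  rewrite lerD// -[leRHS](divfK (lt0r_neq0 a1)) [leRHS]mulrC ler_pM//.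
  - exact: Rintegral_ge0.
  - by rewrite lerDl.
rewrite -IntZ -?IntD; [|exact/intgZ/intg_norm|exact: intg_norm|exact: intg_norm].
apply: Int_le.
- apply: intg_norm; rewrite (_ : (fun x => _) = fun x => a i * (\1_(A i) x - S x) + (\sum_(i <- r) a i * \1_(A i) x - T x)).
    by apply: intgD => //; exact: intgZ.
  by apply/funext => x; rewrite big_cons; ring.
- by apply: intgD; [apply: intgZ|]; exact: intg_norm.
- apply: aeW => x; rewrite big_cons -normrM (le_trans _ (ler_normD _ _))//.
  by rewrite le_eqVlt; apply/orP; left; apply/eqP; congr (`|_|); ring.
Qed.

Import HBSimple.

(** Simple functions are dense in L1, and indicator functions are approximable. *)
Lemma trig_dense_L1 (g : X -> R) (e : R) : intg mu g -> 0 < e ->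
  exists2 T, trig T & \int[mu]_x `|g x - T x| <= e.
Proof.
move=> gi e0; have e2 : 0 < e / 2 by rewrite divr_gt0.
have [f_ [fi ff fcvg]] := approximation_sfun_integrable measurableT gi.
have fi' n : intg mu (fun x => g x - f_ n x) by apply: intgB => //; exact: fi.
have h1 : (fun n => \int[mu]_x `|g x - f_ n x|) @ \oo --> 0.
  by apply: fine_cvg fcvg.
have /cvgr0_norm_le/(_ _ e2)[n _ /(_ n (leqnn n))] := h1.
rewrite /= ger0_norm; last exact: Rintegral_ge0.
move=> hn.
have [T tT hT] := @trig_dense_indic_sum _ (finmap.enum_fset (fset_set (range (f_ n)))) id
  (fun y => f_ n @^-1` [set y]) _ (fun y => measurable_funPTI (f_ n) (measurable_set1 y)) e2.
exists T => //; rewrite (splitr e); apply: le_trans (lerD hn hT).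
have E x : f_ n x = \sum_(i <- finmap.enum_fset (fset_set (range (f_ n)))) i * \1_(f_ n @^-1` [set i]) x.
  by rewrite {1}fimfunE fsbig_finite//=.
under [X in _ <= _ + X]eq_Rintegral do rewrite -E.
have iT : intg mu (fun x => f_ n x - T x) by apply: intgB; [exact: fi|exact: trig_intg].
rewrite -IntD; [|exact: intg_norm|exact: intg_norm].
apply: Int_le; [|by apply: intgD; exact: intg_norm|by apply: aeW => x; exact: ler_distD].
by apply/intg_norm/intgB => //; exact: trig_intg.
Qed.

(** True for trigonometric polynomials, which are uniformly continuous; the general
case follows by density, translations being isometries of L1. *)
Lemma translation_cvg (g : X -> R) (e : R) : Zd_periodic g -> intg mu g -> 0 < e ->
  \forall h \near (0 : X), \int[mu]_x `|g (x + h) - g x| <= e.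
Proof.
move=> pg gi e0; have e3 : 0 < e / 3 by rewrite divr_gt0.
have [T tT hT] := trig_dense_L1 gi e3.
have opp0 : -%R @ (0 : X) --> (0 : X).
  by rewrite -[X in _ --> X]oppr0; exact: opp_continuous.
have near_h : \forall h \near (0 : X), forall x, `|T (x - - h) - T x| <= e / 3 :=
  opp0 _ (trig_unif_continuous tT e3).
move: near_h.
apply: filterS => h Th; have pT := trig_periodic tT.
have igT : intg mu (fun x => g x - T x) by apply: intgB => //; exact: trig_intg.
have igTh : intg mu (fun x => g (x + h) - T (x + h)).
  by apply: (@intg_shift _ _ (fun x => g x - T x)) => // i x; rewrite pg pT.
have iTh : intg mu (fun x => T (x + h) - T x).
  by apply: intgB; apply: trig_intg => //; exact: trig_shift.
apply: (@le_trans _ _ (\int[mu]_x (`|g (x + h) - T (x + h)| + `|T (x + h) - T x| + `|g x - T x|))).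
  apply: Int_le.
  - by apply/intg_norm/intgB => //; exact: intg_shift.
  - by do 2?[apply: intgD]; exact: intg_norm.
  - apply: aeW => x; rewrite [`|g x - T x|]distrC.
    apply: (le_trans (ler_distD (T x) _ _)); rewrite lerD2r; exact: ler_distD.
rewrite IntD; [|by apply: intgD; exact: intg_norm|exact: intg_norm].
rewrite IntD; [|exact: intg_norm|exact: intg_norm].
rewrite (@Int_shift _ _ (fun x => `|g x - T x|)); [|by move=> i x; rewrite pg pT|exact: intg_norm].
have : \int[mu]_x `|T (x + h) - T x| <= e / 3.
  rewrite -[leRHS](Int_cst mu); apply: Int_le; [exact: intg_norm|exact: intg_cst|].
  by apply: aeW => x; have := Th x; rewrite opprK.
lra.
Qed.

(** Replace the indicator of A by an approximating T with values in [0, 1]: where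
|g| <= M the error is at most M times an L1 error, and the rest is a tail of g. *)
Lemma trig_orthogonal_le (g : X -> R) : intg mu g ->
  (forall T, trig T -> \int[mu]_x (g x * T x) = 0) ->
  forall A, measurable A -> \int[mu]_x (g x * \1_A x) <= 0.
Proof.
move=> gi g0 A mA; apply/ler_addgt0Pr => e e0; rewrite add0r.
have e2 : 0 < e / 2 by rewrite divr_gt0.
have mng : measurable_fun setT (fun x => `|g x|) by exact: intg_meas (intg_norm gi).
have [M M0 hM] := Int_tail mng (intg_norm gi) e2.
have [T [tT T01 hT]] := (trig_approx_measurable mA).2 _ (divr_gt0 e2 M0).
have iA : intg mu (fun x => g x * \1_A x).
  under eq_fun do rewrite mulrC; apply: (intg_mull (M := 1)) => //.
  - by apply: aeW => x; have /andP[? ?] := indic_itv R A x; rewrite ger0_norm.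
have iT := trig_mul_intg tT gi.
have iAT := intg_norm (intg_indic_sub mA tT).
have iM := intg_norm (intg_cut M mng (intg_norm gi)).
rewrite -[leLHS]subr0 -(g0 _ tT) -IntB//.
rewrite (splitr e).
apply: (@le_trans _ _ (\int[mu]_x (M * `|\1_A x - T x| + `|if M < `|g x| then `|g x| else 0|))).
  apply: Int_le; [exact: intgB|by apply: intgD => //; exact: intgZ|].
  apply: aeW => x; rewrite -mulrBr; apply: (le_trans (ler_norm _)); rewrite normrM.
  have /andP[? ?] := T01 x; have /andP[? ?] := indic_itv R A x.
  have l1 : `|\1_A x - T x| <= 1 by rewrite ler_norml; apply/andP; split; lra.
  have l0 := normr_ge0 (\1_A x - T x); have g0' := normr_ge0 (g x).
  case: ltP => gM; last by rewrite normr0 addr0 ler_wpM2r.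
  rewrite normr_id; apply: (@le_trans _ _ (`|g x|)); first by rewrite ler_piMr.
  by rewrite lerDr mulr_ge0// ltW.
rewrite IntD//; last exact: intgZ.
rewrite IntZ// lerD// -[leRHS](divfK (lt0r_neq0 M0)) mulrC ler_wpM2r// ltW//.
Qed.

(** Test with the indicators of {g > 0} and {g < 0}. *)
Lemma trig_orthogonal_eq0 (g : X -> R) : intg mu g ->
  (forall T, trig T -> \int[mu]_x (g x * T x) = 0) ->
  {ae mu, forall x, g x = 0}.
Proof.
move=> gi g0; have mg := intg_meas gi.
pose A := [set x | 0 < g x]; pose B := [set x | 0 < - g x].
have mA : measurable A by exact: measurable_gt.
have mB : measurable B by apply: measurable_gt; exact: measurableT_comp.
have gN : intg mu (fun x => - g x) by exact: intgN.
have iA (h : X -> R) S : intg mu h -> measurable S -> intg mu (fun x => h x * \1_S x).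
  move=> hi mS; under eq_fun do rewrite mulrC; apply: (intg_mull (M := 1)) => //.
  by apply: aeW => x; have /andP[? ?] := indic_itv R S x; rewrite ger0_norm.
apply: Int_norm_eq0 => //.
have lA := trig_orthogonal_le gi g0 mA.
have lB : \int[mu]_x (- g x * \1_B x) <= 0.
  apply: trig_orthogonal_le => // T tT.
  under eq_Rintegral do rewrite mulNr; rewrite IntN; last exact: trig_mul_intg.
  by rewrite g0// oppr0.
have -> : \int[mu]_x `|g x| = \int[mu]_x (g x * \1_A x) + \int[mu]_x (- g x * \1_B x).
  rewrite -IntD; [|exact: iA|exact: iA]; apply: eq_Rintegral => x _.
  rewrite !indicE /A /B; case: (ltrgt0P (g x)) => gx.
  - rewrite mem_set// memNset ?mulr1 ?mulr0 ?addr0//=.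
    by apply/negP; rewrite -leNgt oppr_le0 ltW.
  - rewrite memNset ?mem_set ?mulr1 ?mulr0 ?add0r//= ?oppr_gt0//.
    by apply/negP; rewrite -leNgt ltW.
  - by rewrite gx !(oppr0,mul0r) addr0.
by rewrite -[0]addr0 lerD.
Qed.

End trig_consequences.

(** * Weak partial derivatives along rays *)

Section uniform_integral.
Context (R : realType).
Local Notation U := (uniform_prob (@ltr01 R)).
Local Notation leb := (@lebesgue_measure R).

Lemma integral_uniform01 (f : R -> \bar R) : measurable_fun setT f ->
  (\int[U]_t f t = \int[leb]_(t in `[0%R, 1%R]) f t)%E.
Proof.
move=> mf; rewrite [LHS]integralE [RHS]integralE; congr (_ - _)%E.
- by rewrite integral_uniform ?subr0 ?invr1 ?mul1e//; exact: measurable_funepos.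
- by rewrite integral_uniform ?subr0 ?invr1 ?mul1e//; exact: measurable_funeneg.
Qed.

Lemma ae_uniform01 : {ae (uniform_prob (@ltr01 R) : probability _ R), forall t, 0 <= t <= 1}.
Proof.
exists (~` `[0%R, 1%R]%classic); split; first by apply: measurableC; exact: measurable_itv.
  rewrite [LHS]/(uniform_prob _ _) integral_uniform_pdf setICl.
  exact: integral_set0.
by apply: subsetC => t /=; rewrite in_itv.
Qed.

End uniform_integral.

Section torus_rays.
Context (R : realType) (d : nat).
Local Notation X := 'rV[R]_d.
Local Notation mu := (torus_measure R d).
Local Notation U := (uniform_prob (@ltr01 R)).
Local Notation e_ := (unit_vec R).

(** The parameter is scaled to [0, 1], so that averaging along the segment is
integration against a probability measure, for every sign of h. *)
Lemma trig_ftc (phi : X -> R) (i : 'I_d) (x : X) (h : R) : trig phi ->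
  phi (x + h *: e_ i) - phi x =
  \int[U]_t (h * partial phi i (x + (t * h) *: e_ i)).
Proof.
move=> tp; pose F (t : R) := phi (x + (t * h) *: e_ i).
pose f (t : R) := h * partial phi i (x + (t * h) *: e_ i).
have cray : continuous (fun t : R => x + (t * h) *: e_ i).
  apply: continuous_rV => j t; under eq_fun do rewrite !mxE.
  apply: cvgD; first exact: cvg_cst.
  by apply: cvgM; [apply: cvgM; [exact: cvg_id|exact: cvg_cst]|exact: cvg_cst].
have dF (t : R) : is_derive t 1 F (f t).
  have d1 : is_derive (t * h) 1 (fun r => phi (x + r *: e_ i)) (partial phi i (x + (t * h) *: e_ i)).
    rewrite /partial derive_line; apply: derivableP; apply/derivable_line.
    exact/diff_derivable/trig_differentiable.
  have d2 : is_derive t 1 (fun r : R => r * h) h.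
    have -> : (fun r : R => r * h) = (fun r => h *: r).
      by apply/funext => r; rewrite mulrC.
    by apply: is_derive_eq; rewrite /GRing.scale/= mulr1.
  have := @is_derive1_comp R (fun r => phi (x + r *: e_ i)) (fun r => r * h) t _ _ d1 d2.
  by rewrite mulrC.
have cf : continuous f.
  move=> t; apply: cvgM; first exact: cvg_cst.
  apply: (@continuous_comp _ _ _ (fun t : R => x + (t * h) *: e_ i) (partial phi i)); first exact: cray.
  exact: (trig_continuous (trig_partial i tp)).
have mf : measurable_fun setT f by exact: continuous_measurable_fun.
rewrite /Rintegral integral_uniform01; last exact/measurable_EFinP.
rewrite (@continuous_FTC2 _ f F 0 1)//.
- by rewrite /F mul1r mul0r scale0r addr0.
- exact: continuous_subspaceT.
- split.
  + by move=> t _; have [] := dF t.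
  + apply: cvg_at_right_filter; apply: differentiable_continuous.
    by apply/derivable1_diffP; have [] := dF 0.
  + apply: cvg_at_left_filter; apply: differentiable_continuous.
    by apply/derivable1_diffP; have [] := dF 1.
- by move=> t _; rewrite derive1E; have [] := dF t.
Qed.

Lemma measurable_ray (c : R) (v : X) :
  measurable_fun setT (fun z : R * X => z.2 + (z.1 * c) *: v).
Proof.
apply: measurable_coordP => i; rewrite /comp /coord.
under eq_fun do rewrite !mxE.
apply: measurable_funD; first exact: (measurableT_comp (@measurable_coord R d i) measurable_snd).
apply: measurable_funM => //; apply: measurable_funM => //; exact: measurable_fst.
Qed.

Lemma ray_Fubini (g w : X -> R) (c M : R) (v : X) :
  Zd_periodic g -> intg mu g -> measurable_fun setT w -> (forall x, `|w x| <= M) ->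
  [/\ intg mu (fun x => \int[U]_t (g (x + (t * c) *: v) * w x)),
   \int[mu]_x \int[U]_t (g (x + (t * c) *: v) * w x) =
   \int[U]_t \int[mu]_x (g (x + (t * c) *: v) * w x),
   {ae mu, forall x, intg U (fun t => g (x + (t * c) *: v) * w x)} &
   intg U (fun t => \int[mu]_x (g (x + (t * c) *: v) * w x))].
Proof.
move=> pg gi mw wM.
have gi' t := intg_shift ((t * c) *: v) pg gi.
have i1 t : intg mu (fun x => g (x + (t * c) *: v) * w x).
  under eq_fun do rewrite mulrC.
  by apply: (intg_mull mw _ (gi' t)); apply: aeW; exact: wM.
apply: (@unif_Fubini _ _ _ _ _ U mu (fun z => g (z.2 + (z.1 * c) *: v) * w z.2) (`|M| * \int[mu]_x `|g x|)) => //.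
- apply: measurable_funM; last exact: (measurableT_comp mw measurable_snd).
  exact: (measurableT_comp (intg_meas gi) (measurable_ray c v)).
- move=> t /=; rewrite -(@Int_shift _ _ (fun x => `|g x|) ((t * c) *: v)); last 2 first.
  + by move=> j x; rewrite pg.
  + exact: intg_norm.
  rewrite -IntZ; last exact: (intg_norm (gi' t)).
  apply: Int_le; [exact: intg_norm|exact/intgZ/(intg_norm (gi' t))|].
  apply: aeW => x; rewrite normrM mulrC ler_wpM2r//.
  by rewrite (le_trans (wM x))// ler_norm.
Qed.

Lemma ray_Fubini_bounded (g w : X -> R) (c M : R) (v : X) :
  intg mu g -> measurable_fun setT w -> (forall x, `|w x| <= M) ->
  \int[mu]_x \int[U]_t (g x * w (x + (t * c) *: v)) =
  \int[U]_t \int[mu]_x (g x * w (x + (t * c) *: v)).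
Proof.
move=> gi mw wM.
have mwt t : measurable_fun setT (fun x : X => w (x + (t * c) *: v)).
  exact: (measurableT_comp mw (measurable_shift _)).
have i1 t : intg mu (fun x => g x * w (x + (t * c) *: v)).
  under eq_fun do rewrite mulrC.
  by apply: (intg_mull (M := M) (mwt t) _ gi); exact: aeW.
have [] := @unif_Fubini _ _ _ _ _ U mu (fun z => g z.2 * w (z.2 + (z.1 * c) *: v)) (`|M| * \int[mu]_x `|g x|) => //.
- apply: measurable_funM; first exact: (measurableT_comp (intg_meas gi) measurable_snd).
  exact: (measurableT_comp mw (measurable_ray c v)).
- move=> t /=; rewrite -IntZ; last exact: intg_norm.
  apply: Int_le; [exact: intg_norm|exact/intgZ/intg_norm|].
  apply: aeW => x; rewrite normrM mulrC ler_wpM2r//.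
  by rewrite (le_trans (wM _))// ler_norm.
Qed.

End torus_rays.

Section test_functions.
Context (R : realType) (d : nat).
Local Notation X := 'rV[R]_d.
Local Notation mu := (torus_measure R d).

Lemma test_partial (phi : X -> R) i : test_function phi -> test_function (partial phi i).
Proof.
move=> [pp sp]; split; last by move=> ks; exact: (sp (i :: ks)).
move=> j x; rewrite /partial /derive.
suff -> : (fun h : R => h^-1 *: ((phi \o shift (x + unit_vec R j)) (h *: unit_vec R i) - phi (x + unit_vec R j))) =
  (fun h : R => h^-1 *: ((phi \o shift x) (h *: unit_vec R i) - phi x)) by [].
by apply/funext => h /=; rewrite pp addrA pp.
Qed.

Lemma partial_shift (phi : X -> R) i a x :
  partial (fun y => phi (y + a)) i x = partial phi i (x + a).
Proof.
rewrite /partial /derive.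
suff -> : (fun h : R => h^-1 *: (((fun y => phi (y + a)) \o shift x) (h *: unit_vec R i) - phi (x + a))) =
  (fun h : R => h^-1 *: ((phi \o shift (x + a)) (h *: unit_vec R i) - phi (x + a))) by [].
by apply/funext => h /=; rewrite addrA.
Qed.

Lemma test_continuous (phi : X -> R) : test_function phi -> continuous phi.
Proof. by move=> [_ sp] x; apply: differentiable_continuous; exact: (sp [::] x). Qed.

Lemma test_measurable (phi : X -> R) : test_function phi -> measurable_fun setT phi.
Proof. by move=> /test_continuous; exact: measurable_continuous. Qed.

Lemma compact_unit_cube : compact [set x : X | forall i, 0 <= x 0 i <= 1].
Proof.
have := @rV_compact R d (fun=> `[0, 1]%classic) (fun=> @segment_compact _ _ _).
by congr compact; apply/seteqP; split => x h i; have := h i; rewrite in_itv.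
Qed.

Lemma continuous_periodic_bounded (phi : X -> R) : Zd_periodic phi -> continuous phi ->
  exists M, forall x, `|phi x| <= M.
Proof.
move=> pp cp.
have : compact (phi @` [set x : X | forall i, 0 <= x 0 i <= 1]).
  by apply: continuous_compact; [exact: continuous_subspaceT|exact: compact_unit_cube].
move=> /compact_bounded[M [_ /(_ (M + 1))]]; rewrite ltrDl => /(_ ltr01) h.
exists (M + 1) => x; rewrite -(periodic_frac x pp); apply: h; exists (frac x) => // i.
by rewrite mxE subr_ge0 floor_le/= lerBlDr ltW// -[1]/(1%:~R) -rmorphD addrC floorD1_gt.
Qed.

Lemma test_bounded (phi : X -> R) : test_function phi -> exists M, forall x, `|phi x| <= M.
Proof. by move=> tp; apply: continuous_periodic_bounded; [exact: tp.1|exact: test_continuous]. Qed.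

Lemma test_intg_mul (phi w : X -> R) : test_function phi -> intg mu w ->
  intg mu (fun x => w x * phi x).
Proof.
move=> tp wi; have [M pM] := test_bounded tp.
under eq_fun do rewrite mulrC.
by apply: (intg_mull (test_measurable tp) _ wi); apply: aeW; exact: pM.
Qed.

End test_functions.

Section weak_partial.
Context (R : realType) (d : nat) (i : 'I_d).
Local Notation X := 'rV[R]_d.
Local Notation mu := (torus_measure R d).
Local Notation U := (uniform_prob (@ltr01 R)).
Local Notation e := (unit_vec R i).

Definition pintg (g : X -> R) := Zd_periodic g /\ intg mu g.

Lemma Lp1P (g : X -> R) : Lp 1 g <-> pintg g.
Proof. by split=> -[pg /Lfun1_integrable gi]; split. Qed.

Lemma pintgD g h : pintg g -> pintg h -> pintg (fun x => g x + h x).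
Proof. by move=> [pg gi] [ph hi]; split; [move=> j x; rewrite pg ph|exact: intgD]. Qed.

Lemma pintgZ a g : pintg g -> pintg (fun x => a * g x).
Proof. by move=> [pg gi]; split; [move=> j x; rewrite pg|exact: intgZ]. Qed.

Definition weak_partial (u g : X -> R) := pintg g /\
  forall phi, test_function phi ->
    \int[mu]_x (u x * partial phi i x) = - \int[mu]_x (g x * phi x).

(** The difference of two derivatives is orthogonal to trigonometric polynomials. *)
Lemma weak_partial_unique u g h : weak_partial u g -> weak_partial u h ->
  {ae mu, forall x, g x = h x}.
Proof.
move=> [[pg gi] ug] [[ph hi] uh].
have /(trig_orthogonal_eq0 (intgB gi hi)) :
    forall T, trig T -> \int[mu]_x ((g x - h x) * T x) = 0.
  move=> T tT; under eq_Rintegral do rewrite mulrBl.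
  rewrite IntB; [|exact: trig_mul_intg|exact: trig_mul_intg].
  by apply/eqP; rewrite subr_eq0 -eqr_opp -ug -?uh//; exact: trig_test.
by apply: filterS => x /eqP; rewrite subr_eq0 => /eqP.
Qed.

Lemma weak_partial_lin a u v g h : pintg u -> pintg v ->
  weak_partial u g -> weak_partial v h ->
  weak_partial (fun x => a * u x + v x) (fun x => a * g x + h x).
Proof.
move=> [pu ui] [pv vi] [gP ug] [hP vh]; split.
  by apply: pintgD => //; exact: pintgZ.
move=> phi tp; have tq := test_partial i tp.
have iu := test_intg_mul tq ui; have iv := test_intg_mul tq vi.
have ig := test_intg_mul tp gP.2; have ih := test_intg_mul tp hP.2.
under eq_Rintegral do rewrite mulrDl -mulrA.
under [X in _ = - X]eq_Rintegral do rewrite mulrDl -mulrA.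
by rewrite !IntD ?IntZ//; [rewrite ug// vh//; ring|exact: intgZ|exact: intgZ].
Qed.

Lemma weak_partial_ae u v g : measurable_fun setT u -> measurable_fun setT v ->
  {ae mu, forall x, u x = v x} -> weak_partial u g -> weak_partial v g.
Proof.
move=> mmu mv uv [gP ug]; split => // phi tp; rewrite -ug//.
have mp := test_measurable (test_partial i tp).
apply: eq_ae_Int; [exact: measurable_funM|exact: measurable_funM|].
by apply: filterS uv => x ->.
Qed.

Lemma Int_shift_mul (g w : X -> R) a : pintg g -> Zd_periodic w ->
  measurable_fun setT w -> (exists M, forall x, `|w x| <= M) ->
  \int[mu]_x (g (x + a) * w x) = \int[mu]_x (g x * w (x - a)).
Proof.
move=> [pg gi] pw mw [M wM].
rewrite -(@Int_shift _ _ (fun x => g x * w (x - a)) a).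
- by apply: eq_Rintegral => x _; rewrite addrK.
- by move=> j x; rewrite pg addrAC pw.
- under eq_fun do rewrite mulrC.
  apply: (intg_mull (M := M) _ _ gi).
    exact: (measurableT_comp mw (measurable_shift (- a))).
  exact: aeW.
Qed.

(** The fundamental theorem of calculus for weak derivatives. Both sides have the
same integral against every trigonometric polynomial T: move the translation to
T, write the increment of T as an integral along the segment, and integrate by
parts under the integral sign. *)
Lemma weak_partial_ray u g (h : R) : pintg u -> weak_partial u g ->
  {ae mu, forall x, u (x + h *: e) - u x = h * \int[U]_t g (x + (t * h) *: e)} /\
  intg mu (fun x => h * \int[U]_t g (x + (t * h) *: e)).
Proof.
move=> [pu ui] [[pg gi] ug].
have one_le (x : X) : `|1 : R| <= 1 by rewrite normr1.
have [+ _ + _] := ray_Fubini h e pg gi (@measurable_cst _ _ X R setT 1) one_le.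
under eq_fun do under eq_Rintegral do rewrite mulr1.
move=> /(intgZ h) ir ag; split => //.
have iu : intg mu (fun x => u (x + h *: e) - u x).
  by apply: intgB => //; exact: intg_shift.
suff /(trig_orthogonal_eq0 (intgB iu ir)) : forall T, trig T ->
    \int[mu]_x ((u (x + h *: e) - u x - h * \int[U]_t g (x + (t * h) *: e)) * T x) = 0.
  by apply: filterS => x /eqP; rewrite subr_eq0 => /eqP.
move=> T tT; have [M TM] := trig_bounded tT.
have tD := trig_partial i tT; have [N DN] := trig_bounded tD.
have [iF FE _ _] := ray_Fubini h e pg gi (trig_measurable tT) TM.
under eq_Rintegral do rewrite mulrBl.
rewrite IntB; [|exact: trig_mul_intg|exact: trig_mul_intg].
under eq_Rintegral do rewrite mulrBl.
rewrite IntB; [|by apply: trig_mul_intg => //; exact: intg_shift|exact: trig_mul_intg].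
rewrite (Int_shift_mul (h *: e) (conj pu ui) (trig_periodic tT) (trig_measurable tT) (ex_intro _ M TM)).
rewrite -IntB; [|by apply: trig_mul_intg => //; exact: trig_shift|exact: trig_mul_intg].
have -> : \int[mu]_x (h * (\int[U]_t g (x + (t * h) *: e)) * T x) =
    h * \int[U]_t \int[mu]_x (g (x + (t * h) *: e) * T x).
  rewrite -FE -IntZ//; apply: eq_ae_Int.
  - exact: intg_meas (trig_mul_intg tT ir).
  - by apply: measurable_funM => //; exact: intg_meas iF.
  - apply: filterS ag => x; under eq_fun do rewrite mulr1.
    move=> ix; rewrite -mulrA; congr (_ * _).
    rewrite mulrC -IntZ//; apply: eq_Rintegral => t _; exact: mulrC.
have -> : \int[mu]_x (u x * T (x - h *: e) - u x * T x) =
    \int[U]_t \int[mu]_x (- h * u x * partial T i (x + (t * - h) *: e)).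
  rewrite -(ray_Fubini_bounded (- h) e (intgZ (- h) ui) (trig_measurable tD) DN).
  apply: eq_Rintegral => x _; rewrite -mulrBr -scaleNr (trig_ftc i x (- h) tT).
  rewrite -IntZ.
    by apply: eq_Rintegral => t _; ring.
  apply: (@intg_bounded _ _ _ _ _ (`|- h| * N)).
    apply: measurable_funM => //; apply: (measurableT_comp (trig_measurable tD)).
    exact: (measurableT_comp (measurable_ray (- h) e) (pair2_measurable x)).
  by apply: aeW => t; rewrite normrM ler_wpM2l.
have H t : \int[mu]_x (- h * u x * partial T i (x + (t * - h) *: e)) =
    h * \int[mu]_x (g (x + (t * h) *: e) * T x).
  have tTa := trig_shift ((t * - h) *: e) tT.
  transitivity (- h * \int[mu]_x (u x * partial (fun x => T (x + (t * - h) *: e)) i x)).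
    rewrite -IntZ; last by apply: trig_mul_intg => //; exact: trig_partial.
    by apply: eq_Rintegral => x _; rewrite partial_shift mulrA.
  rewrite ug; last exact: trig_test.
  rewrite mulrNN; congr (_ * _).
  rewrite (Int_shift_mul _ (conj pg gi) (trig_periodic tT) (trig_measurable tT) (ex_intro _ M TM)).
  by apply: eq_Rintegral => x _; rewrite mulrN scaleNr.
under eq_Rintegral do rewrite H.
rewrite IntZ ?subrr//.
by have [] := ray_Fubini h e pg gi (trig_measurable tT) TM.
Qed.

(** Difference quotients converge to the derivative in L1: by weak_partial_ray the
error is an average of translation errors of g. *)
Lemma weak_partial_diff u g (eps : R) : pintg u -> weak_partial u g -> 0 < eps ->
  \forall h \near (0 : R), \int[mu]_x `|u (x + h *: e) - u x - h * g x| <= eps * `|h|.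
Proof.
move=> pu wg eps0; have [pg gi] := wg.1.
have tc := translation_cvg pg gi eps0.
have [r /= r0 hr] : exists2 r : R, 0 < r & forall h : R, `|h| < r ->
    \int[mu]_x `|g (x + h *: e) - g x| <= eps.
  have ce : (fun h : R => h *: e) @ (0 : R) --> (0 : X).
    rewrite -[X in _ --> X](scale0r e); apply: scalel_continuous.
  have /nbhs_ballP[r r0 hr] : \forall h \near (0 : R), \int[mu]_x `|g (x + h *: e) - g x| <= eps := ce _ tc.
  by exists r => // h hh; apply: hr; rewrite /ball/= sub0r normrN.
apply/nbhs_ballP; exists r => // h; rewrite /ball/= sub0r normrN => hh.
have [ra ri] := weak_partial_ray h pu wg.
have it t : intg mu (fun x => g (x + (t * h) *: e) - g x) by apply: intgB => //; exact: intg_shift.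
have mF : measurable_fun setT (fun z : R * X => g (z.2 + (z.1 * h) *: e) - g z.2).
  apply: measurable_funB; first exact: (measurableT_comp (intg_meas gi) (measurable_ray _ _)).
  exact: (measurableT_comp (intg_meas gi) measurable_snd).
have bound t : \int[mu]_x `|g (x + (t * h) *: e) - g x| <= 2 * \int[mu]_x `|g x|.
  rewrite mulr2n mulrDl mul1r -{1}(@Int_shift _ _ (fun x => `|g x|) ((t * h) *: e)); last 2 first.
  - by move=> j x; rewrite pg.
  - exact: intg_norm.
  rewrite -IntD; [|by apply/intg_norm; exact: intg_shift|exact: intg_norm].
  apply: Int_le; [exact/intg_norm/it|by apply: intgD; apply/intg_norm => //; exact: intg_shift|].
  by apply: aeW => x; exact: ler_normB.
have bound' t : \int[mu]_x `| `|g (x + (t * h) *: e) - g x| | <= 2 * \int[mu]_x `|g x|.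
  by under eq_Rintegral do rewrite normr_id; exact: bound.
have [iF FE Fae iFt] := @unif_Fubini _ _ _ _ _ U mu (fun z => `|g (z.2 + (z.1 * h) *: e) - g z.2|)
  (2 * \int[mu]_x `|g x|) (measurableT_comp (@normr_measurable _ setT) mF)
  (fun t => intg_norm (it t)) bound'.
have -> : eps * `|h| = `|h| * eps by rewrite mulrC.
apply: (@le_trans _ _ (`|h| * \int[mu]_x \int[U]_t `|g (x + (t * h) *: e) - g x|)).
  rewrite -IntZ//; apply: Int_le.
  - apply/intg_norm/intgB; last exact: intgZ.
    by apply: intgB; [apply: intg_shift; [exact: pu.1|exact: pu.2]|exact: pu.2].
  - exact: intgZ.
  - apply: filterS2 ra Fae => x -> ix.
    have ix' : intg U (fun t => g (x + (t * h) *: e) - g x).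
      apply: (intg_le _ ix); last exact: aeW.
      exact: (measurableT_comp mF (pair2_measurable x)).
    have ix2 : intg U (fun t => g (x + (t * h) *: e)).
      have := intgD ix' (intg_cst U (g x)).
      by under eq_fun do rewrite subrK.
    have -> : h * (\int[U]_t g (x + (t * h) *: e)) - h * g x =
        h * \int[U]_t (g (x + (t * h) *: e) - g x).
      by rewrite IntB//; [rewrite Int_cst mulrBr|exact: intg_cst].
    by rewrite normrM ler_wpM2l//; exact: Int_norm_le.
rewrite ler_wpM2l// FE -[leRHS](Int_cst U); apply: Int_le => //; first exact: intg_cst.
have [N [mN N0 sN]] := ae_uniform01 R; exists N; split => //.
apply: subset_trans sN; apply: subsetC => t /= /andP[t0 t1]; apply: hr.
by rewrite normrM (le_lt_trans _ hh)// ler_piMl// ger0_norm.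
Qed.

(** Conversely, L1 convergence of difference quotients identifies the weak
derivative. This criterion only asks for increments, and so applies to
functions defined by cutting off, such as the bumps below. *)
Lemma diff_weak_partial u g : pintg u -> pintg g ->
  (forall eps : R, 0 < eps -> \forall n \near \oo,
    \int[mu]_x `|u (x + n.+1%:R^-1 *: e) - u x - n.+1%:R^-1 * g x| <= eps * n.+1%:R^-1) ->
  weak_partial u g.
Proof.
move=> [pu ui] [pg gi] ug; split => // phi tp.
have [M phiM] := test_bounded tp.
have tq := test_partial i tp; have [N phiN] := test_bounded tq.
pose h (n : nat) : R := n.+1%:R^-1.
have h0 n : 0 < h n by rewrite invr_gt0.
pose q n x := - (h n)^-1 * (phi (x - h n *: e) - phi x).
have mphi := test_measurable tp.
have mq n : measurable_fun setT (q n).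
  apply: measurable_funM => //; apply: measurable_funB => //.
  exact: (measurableT_comp mphi (measurable_shift _)).
have dphi x : derivable phi x e by apply: diff_derivable; exact: (tp.2 [::]).
have h_cvg : (fun n => - h n) @ \oo --> (0 : R).
  by rewrite -[X in _ --> X]oppr0; apply: cvgN; exact: cvg_harmonic.
have qx x : q n x @[n --> \oo] --> partial phi i x.
  have /cvgr_dnbhsP/(_ (fun n => - h n)) : (fun r : R => r^-1 *: ((phi \o shift x) (r *: e) - phi x)) @ 0^' --> partial phi i x.
    exact: dphi.
  move=> hq; have {hq} := hq (conj (fun n => _) h_cvg).
  have E n : q n x = (- h n)^-1 *: ((phi \o shift x) (- h n *: e) - phi x).
    by rewrite /q invrN; congr (_ * (phi _ - _)); rewrite /= scaleNr addrC.
  have -> : (fun n => q n x) = (fun n => (- h n)^-1 *: ((phi \o shift x) (- h n *: e) - phi x)).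
    exact/funext.
  apply.
  by move=> n; rewrite oppr_eq0 gt_eqF.
have qN n x : `|q n x| <= N.
  have dl r : is_derive (r : R) 1 (fun r => phi (x + r *: e)) (partial phi i (x + r *: e)).
    by rewrite /partial derive_line; apply: derivableP; apply/derivable_line; exact: dphi.
  have [||c _ hc] := @MVT R (fun r => phi (x + r *: e)) (fun r => partial phi i (x + r *: e)) (- h n) 0.
  - by rewrite oppr_lt0.
  - apply: derivable_within_continuous => r _; have [] := dl r; done.
  move: hc; rewrite scale0r addr0 opprK add0r scaleNr => hc.
  rewrite /q mulNr -mulrN opprB hc mulrC mulfK ?gt_eqF//.

have [i1 i2 c1] : [/\ intg mu (fun x => u x * partial phi i x), forall n, intg mu (fun x => u x * q n x) &
   \int[mu]_x `|u x * q n x - u x * partial phi i x| @[n --> \oo] --> 0].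
  apply: (Int_dct (g := fun x => `|u x| * N)).
  - by move=> n; apply: measurable_funM => //; exact: intg_meas ui.
  - by apply: measurable_funM; [exact: intg_meas ui|exact: test_measurable].
  - by apply: aeW => x; apply: cvgM; [exact: cvg_cst|exact: qx].
  - by under eq_fun do rewrite mulrC; apply: intgZ; exact: intg_norm.
  - by move=> n; apply: aeW => x; rewrite normrM ler_wpM2l.
have c2 := Int_cvg i1 i2 c1.
have iuh n : intg mu (fun x => u (x + h n *: e)) by exact: intg_shift.
have E n : \int[mu]_x (u x * q n x) = - ((h n)^-1 * \int[mu]_x ((u (x + h n *: e) - u x) * phi x)).
  under [in RHS]eq_Rintegral do rewrite mulrBl.
  rewrite IntB; [|exact: test_intg_mul|exact: test_intg_mul].
  rewrite (Int_shift_mul (h n *: e) (conj pu ui) tp.1 mphi (ex_intro _ M phiM)).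
  have ip : intg mu (fun x => u x * phi (x - h n *: e)).
    under eq_fun do rewrite mulrC; apply: (intg_mull (M := M) _ _ ui); last exact: aeW.
    exact: (measurableT_comp mphi (measurable_shift _)).
  rewrite -IntB//; last exact: test_intg_mul.
  rewrite -mulNr -IntZ; last by apply: intgB => //; exact: test_intg_mul.
  by apply: eq_Rintegral => x _; rewrite /q; ring.
apply: (@cvg_unique _ (@Rhausdorff R) _ _ _ _ c2).
apply/cvgrPdist_le => eps eps0.
have M1 : 0 < `|M| + 1 by rewrite ltr_wpDl.
have := ug _ (divr_gt0 eps0 M1); apply: filterS => n hn.
have hn0 : h n != 0 by rewrite gt_eqF.
have id : intg mu (fun x => u (x + h n *: e) - u x) by apply: intgB.
have ir : intg mu (fun x => u (x + h n *: e) - u x - h n * g x) by apply: intgB => //; exact: intgZ.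
have -> : - (\int[mu]_x (g x * phi x)) - \int[mu]_x (u x * q n x) =
    (h n)^-1 * \int[mu]_x ((u (x + h n *: e) - u x - h n * g x) * phi x).
  under [in RHS]eq_Rintegral do rewrite mulrBl -mulrA.
  rewrite IntB; [|exact: test_intg_mul|apply: intgZ; exact: test_intg_mul].
  rewrite IntZ; last exact: test_intg_mul.
  by rewrite E mulrBr mulKf//; ring.
rewrite normrM normfV (gtr0_norm (h0 n)) mulrC ler_pdivrMr//.
apply: (@le_trans _ _ ((`|M| + 1) * (eps / (`|M| + 1) / n.+1%:R))); last first.
  by rewrite mulrA [_ * (eps / _)]mulrC divfK ?gt_eqF.
apply: (le_trans (Int_norm_le (test_intg_mul tp ir))).
apply: (@le_trans _ _ ((`|M| + 1) * \int[mu]_x `|u (x + h n *: e) - u x - h n * g x|)); last first.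
  by rewrite ler_wpM2l// ltW.
rewrite -IntZ; last exact: intg_norm.
apply: Int_le; [exact/intg_norm/test_intg_mul|exact/intgZ/intg_norm|].
apply: aeW => x; rewrite normrM mulrC ler_wpM2r//.
by rewrite (le_trans (phiM x))// (le_trans (ler_norm M))// lerDl.
Qed.

End weak_partial.

(** * Testing a weak equation with Sobolev functions *)

Section conjugate_exponents.
Context dsp (T : measurableType dsp) (R : realType) (P : probability T R).

Lemma hoelder_conjugate_real (p : R) : 1 < p -> exists p' : R,
  [/\ hoelder_conjugate p%:E = p'%:E, 1 < p' & p^-1 + p'^-1 = 1].
Proof.
move=> p1; have p0 : 0 < p by apply: lt_trans p1.
exists (p / (p - 1)); split.
- rewrite /hoelder_conjugate /= eqe gt_eqF//= -EFinB inver gt_eqF ?subr_gt0//.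
- by rewrite ltr_pdivlMr ?subr_gt0// mul1r gtrBl.
- by rewrite invf_div; field; rewrite gt_eqF.
Qed.

(** The space L^p expressed by a real integral, for real exponents p. *)
Definition Lpow (p : R) (f : T -> R) :=
  measurable_fun setT f /\ intg P (fun x => `|f x| `^ p).

Lemma LpowP (p : R) (f : T -> R) : 1 <= p -> f \in Lfun P p%:E <-> Lpow p f.
Proof.
move=> p1; have p0 : 0 < p by apply: lt_le_trans p1.
split=> [fp|[mf fp]].
  split; last exact: Lfun_integrable fp.
  by move: fp; rewrite inE => /andP[/[!inE]].
rewrite inE; apply/andP; split; rewrite inE//=.
rewrite /finite_norm unlock /Lnorm poweR_lty//.
have /integrableP[_] := fp; apply: le_lt_trans.
by under [leRHS]eq_integral do rewrite /= ger0_norm ?powR_ge0//.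
Qed.

(** The weight c will be chosen small, to make the contribution of b small. *)
Lemma young_scaled (p q a b c : R) : 0 < p -> 0 < q -> p^-1 + q^-1 = 1 -> 0 < c ->
  `|a * b| <= (c^-1 `^ p) * (`|a| `^ p) + (c `^ q) * (`|b| `^ q).
Proof.
move=> p0 q0 pq c0; have c0' : c != 0 by rewrite gt_eqF.
have -> : `|a * b| = (c^-1 * `|a|) * (c * `|b|).
  by rewrite normrM mulrACA mulVf// mul1r.
have ci0 : 0 <= c^-1 by rewrite invr_ge0 ltW.
apply: (le_trans (conjugate_powR _ _ p0 q0 pq)).
- exact: mulr_ge0.
- by rewrite mulr_ge0// ltW.
rewrite (powRM _ ci0 (normr_ge0 a)) (powRM _ (ltW c0) (normr_ge0 b)).
have p1 : p^-1 <= 1 by rewrite -pq lerDl invr_ge0 ltW.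
have q1 : q^-1 <= 1 by rewrite -pq lerDr invr_ge0 ltW.
by apply: lerD; rewrite ler_piMr// mulr_ge0// powR_ge0.
Qed.

Lemma Lpow_mul (p q : R) (f g : T -> R) : 0 < p -> 0 < q -> p^-1 + q^-1 = 1 ->
  Lpow p f -> Lpow q g -> intg P (fun x => f x * g x).
Proof.
move=> p0 q0 pq [mf fp] [mg gq].
apply: (intg_le (g := fun x => (1^-1 `^ p) * (`|f x| `^ p) + (1 `^ q) * (`|g x| `^ q))).
- exact: measurable_funM.
- by apply: intgD; exact: intgZ.
- by apply: aeW => x; exact: young_scaled.
Qed.

Lemma Lpow_hoelder (p q : R) (f g : T -> R) : 1 <= p -> 1 <= q -> p^-1 + q^-1 = 1 ->
  f \in Lfun P p%:E -> g \in Lfun P q%:E ->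
  `|\int[P]_x (f x * g x)| <=
    fine ('N[P]_(p%:E)[EFin \o f])%E * fine ('N[P]_(q%:E)[EFin \o g])%E.
Proof.
move=> p1 q1 pq fp gq.
have p0 : 0 < p by apply: lt_le_trans p1.
have q0 : 0 < q by apply: lt_le_trans q1.
have [mf _] := (LpowP f p1).1 fp; have [mg _] := (LpowP g q1).1 gq.
have fg := Lpow_mul p0 q0 pq ((LpowP f p1).1 fp) ((LpowP g q1).1 gq).
have Nf : 'N[P]_(p%:E)[EFin \o f]%E \is a fin_num.
  rewrite fin_numElt (lt_le_trans ltNy0) ?Lnorm_ge0//=.
  by move: fp; rewrite inE => /andP[_]; rewrite inE.
have Ng : 'N[P]_(q%:E)[EFin \o g]%E \is a fin_num.
  rewrite fin_numElt (lt_le_trans ltNy0) ?Lnorm_ge0//=.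
  by move: gq; rewrite inE => /andP[_]; rewrite inE.
apply: (le_trans (Int_norm_le fg)).
have E : (\int[P]_x `|f x * g x|)%:E = (\int[P]_x `|f x * g x|%:E)%E.
  by rewrite Int_EFin//; exact: intg_norm.
have := hoelder P mf mg p0 q0 pq; rewrite Lnorm1 -[in leRHS](fineK Nf) -[in leRHS](fineK Ng).
rewrite -EFinM => h; rewrite -lee_fin; apply: le_trans h; rewrite E le_eqVlt; apply/orP; left.
by apply/eqP; apply: eq_integral.
Qed.

End conjugate_exponents.

Section correlation.
Context (R : realType) (d : nat).
Local Notation X := 'rV[R]_d.
Local Notation mu := (torus_measure R d).

Variables (p q : R) (p0 : 0 < p) (q0 : 0 < q) (pq : p^-1 + q^-1 = 1).
Variables (F G : X -> R).
Hypotheses (Fp : Lpow mu p F) (pG : Zd_periodic G) (Gq : Lpow mu q G) (Gi : intg mu G).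

Definition corr (h : X) := \int[mu]_x (F x * G (x + h)).

Lemma Lpow_shift h : Lpow mu q (fun x => G (x + h)).
Proof.
have [mG iG] := Gq; split; first exact: (measurableT_comp mG (measurable_shift h)).
by apply: (@intg_shift _ _ (fun x => `|G x| `^ q)) => // j x; rewrite pG.
Qed.

Lemma corr_intg h : intg mu (fun x => F x * G (x + h)).
Proof. exact: Lpow_mul p0 q0 pq Fp (Lpow_shift h). Qed.

(** Where |F| <= M the difference is controlled by the L1 modulus of translation of
G. Where |F| > M, Young's inequality bounds the product by a small multiple of
|G|^q and a large multiple of |F|^p, whose tail is small once M is large. *)
Lemma corr_continuous0 (e : R) : 0 < e -> \forall h \near (0 : X), `|corr h - corr 0| <= e.
Proof.
move=> e0; have [mF iF] := Fp; have [mG iG] := Gq.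
set S := \int[mu]_x (`|G x| `^ q).
have S0 : 0 <= S by apply: Rintegral_ge0 => x _; exact: powR_ge0.
(* a weight for which each term in |G|^q contributes at most e / 4 *)
pose c := (e / (4 * (S + 1))) `^ (q^-1).
have s1 : 0 < S + 1 by rewrite ltr_wpDl.
have es0 : 0 < e / (4 * (S + 1)) by rewrite divr_gt0// mulr_gt0.
have c0 : 0 < c by exact: powR_gt0.
have cq : c `^ q * S <= e / 4.
  rewrite -powRrM mulVf ?gt_eqF// (powRr1 (ltW es0)).
  have -> : e / (4 * (S + 1)) * S = e / 4 * (S / (S + 1)) by field; rewrite gt_eqF.
  by rewrite ler_piMr ?divr_ge0 ?(ltW e0)// ler_pdivrMr// mul1r lerDl.
pose K := 2 * (c^-1 `^ p) + 1.
have K0 : 0 < K by rewrite ltr_wpDl// mulr_ge0// powR_ge0.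
have mnF : measurable_fun setT (fun x => `|F x|) by exact: measurableT_comp.
have [M M0 hM] := Int_tail mnF iF (divr_gt0 (divr_gt0 e0 (ltr0Sn R 3)) K0).
have := translation_cvg pG Gi (divr_gt0 (divr_gt0 e0 (ltr0Sn R 3)) M0).
apply: filterS => h hG.
have ih := corr_intg h; have i0 := corr_intg 0.
have iGh := (Lpow_shift h).2.
have iD : intg mu (fun x => G (x + h) - G x) by apply: intgB => //; exact: intg_shift.
have icut : intg mu (fun x => if M < `|F x| then `|F x| `^ p else 0) by exact: intg_cut.
rewrite /corr -IntB//; under eq_Rintegral do rewrite addr0.
apply: (le_trans (Int_norm_le _)).
  by under eq_fun do rewrite -[X in _ - _ * G X]addr0; exact: intgB.
apply: (@le_trans _ _ (\int[mu]_x (M * `|G (x + h) - G x| +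
  (K * `|if M < `|F x| then `|F x| `^ p else 0| +
   (c `^ q * `|G (x + h)| `^ q + c `^ q * `|G x| `^ q))))).
  apply: Int_le.
  - by apply: intg_norm; under eq_fun do rewrite -[X in _ - _ * G X]addr0; exact: intgB.
  - apply: intgD; first exact/intgZ/intg_norm.
    apply: intgD; first exact/intgZ/intg_norm.
    by apply: intgD; exact: intgZ.
  - apply: aeW => x; rewrite -mulrBr normrM.
    have g1 : 0 <= c `^ q * `|G (x + h)| `^ q by rewrite mulr_ge0// powR_ge0.
    have g2 : 0 <= c `^ q * `|G x| `^ q by rewrite mulr_ge0// powR_ge0.
    case: ltP => FM; last first.
      by rewrite normr0 mulr0 add0r ler_wpDr// ?addr_ge0// ler_wpM2r.
    rewrite [`| _ `^ _|]ger0_norm ?powR_ge0//.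
    have y1 := young_scaled (F x) (G (x + h)) p0 q0 pq c0.
    have y2 := young_scaled (F x) (G x) p0 q0 pq c0.
    rewrite -normrM mulrBr; apply: (le_trans (ler_normB _ _)).
    have k0 : 0 <= M * `|G (x + h) - G x| by rewrite mulr_ge0// ltW.
    have f0 : 0 <= `|F x| `^ p by exact: powR_ge0.
    rewrite /K; lra.
rewrite IntD; last 2 first.
- exact/intgZ/intg_norm.
- by apply: intgD; [exact/intgZ/intg_norm|apply: intgD; exact: intgZ].
rewrite IntD; [|exact/intgZ/intg_norm|by apply: intgD; exact: intgZ].
rewrite IntD; [|exact: intgZ|exact: intgZ].
rewrite !IntZ//; [|exact: intg_norm|exact: intg_norm].
rewrite (@Int_shift _ _ (fun x => `|G x| `^ q) h)//; last by move=> j x; rewrite pG.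
rewrite -/S.
have t1 : M * \int[mu]_x `|G (x + h) - G x| <= e / 4.
  by rewrite -[leRHS](divfK (lt0r_neq0 M0)) mulrC ler_wpM2r// ltW.
have t2 : K * \int[mu]_x `|if M < `|F x| then `|F x| `^ p else 0| <= e / 4.
  by rewrite -[leRHS](divfK (lt0r_neq0 K0)) mulrC ler_wpM2r// ltW.
lra.
Qed.

(** Fubini's theorem and a change of variables let T act on G by convolution. *)
Lemma corr_trig (T : X -> R) : trig T ->
  [/\ intg mu (fun h => corr h * T h),
      trig (fun x => \int[mu]_y (G y * T (y - x))) &
  \int[mu]_h (corr h * T h) = \int[mu]_x (F x * \int[mu]_y (G y * T (y - x)))].
Proof.
move=> tT; have [M TM] := trig_bounded tT.
have [mF iF] := Fp; have [mG iG] := Gq.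
have [tP iP] := separated_int (trig_separated tT) Gi.
pose K (z : X * X) := F z.2 * G (z.2 + z.1) * T z.1.
have madd : measurable_fun setT (fun z : X * X => z.2 + z.1).
  apply: measurable_coordP => i; rewrite /comp /coord.
  under eq_fun do rewrite mxE.
  by apply: measurable_funD; [exact: (measurableT_comp (@measurable_coord R d i) measurable_snd)|
    exact: (measurableT_comp (@measurable_coord R d i) measurable_fst)].
have mK : measurable_fun setT K.
  apply: measurable_funM; last exact: (measurableT_comp (trig_measurable tT) measurable_fst).
  apply: measurable_funM; first exact: (measurableT_comp mF measurable_snd).
  exact: (measurableT_comp mG madd).
have iK h : intg mu (fun x => K (h, x)).
  by rewrite /K/=; under eq_fun do rewrite mulrC; apply: intgZ; exact: corr_intg.
pose B := `|M| * (\int[mu]_x (`|F x| `^ p) + \int[mu]_x (`|G x| `^ q)).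
have bK h : \int[mu]_x `|K (h, x)| <= B.
  rewrite /B -(@Int_shift _ _ (fun x => `|G x| `^ q) h)//; last by move=> j x; rewrite pG.
  have iGh := (Lpow_shift h).2.
  rewrite -IntD// -IntZ; last exact: intgD.
  apply: Int_le; [exact: intg_norm|by apply: intgZ; exact: intgD|].
  apply: aeW => x; rewrite /K/= normrM mulrC ler_pM// ?(le_trans (TM h) (ler_norm M))//.
  have := young_scaled (F x) (G (x + h)) p0 q0 pq (ltr01 : 0 < (1 : R)).
  by rewrite invr1 !powR1 !mul1r.
have [j1 j2 j3 j4] := unif_Fubini mu mK iK bK.
have E1 h : \int[mu]_x K (h, x) = corr h * T h.
  by rewrite /K/= /corr mulrC -IntZ; [apply: eq_Rintegral => x _; rewrite mulrC|exact: corr_intg].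
split => //.
  by move: j4; under eq_fun do rewrite E1.
under eq_Rintegral do rewrite -E1.
rewrite -j2; apply: eq_ae_Int.
- exact: intg_meas j1.
- by apply: measurable_funM => //; exact: trig_measurable.
- apply: aeW => x; rewrite /K/=.
  rewrite -(@Int_shift_mul _ _ (fun y => G y) T x)//; last 3 first.
  + exact: trig_periodic.
  + exact: trig_measurable.
  + by exists M.
  rewrite -IntZ.
    by apply: eq_Rintegral => h _; rewrite mulrA [h + x]addrC.
  under eq_fun do rewrite mulrC; apply: (intg_mull (M := M)).
  + exact: trig_measurable.
  + exact: aeW.
  + exact: intg_shift.
Qed.

End correlation.

Section weak_form.
Context (R : realType) (d : nat).
Local Notation X := 'rV[R]_d.
Local Notation mu := (torus_measure R d).

Lemma cube_gt0 (r : R) : 0 < r -> (0 < mu [set x : X | forall i, (x 0 i \in `]0, r[)%R])%E.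
Proof.
move=> r0; rewrite (@torus_measure_box _ _ (fun=> `]0, r[%classic))//.
elim/big_ind: _ => //[x y x0 y0|i _]; first exact: mule_gt0.
pose m := Num.min r 1.
have m0 : 0 < m by rewrite lt_min r0 ltr01.
apply: (@lt_le_trans _ _ (lebesgue_measure (`]0%R, m[%classic : set R))).
  by rewrite lebesgue_measure_itv/= lte_fin m0 -EFinD subr0 lte_fin.
apply: le_measure; rewrite ?inE.
- exact: measurable_itv.
- by apply: measurableI; exact: measurable_itv.
- move=> x /=; rewrite !in_itv/= lt_min => /andP[x0 /andP[xr x1]].
  by rewrite x0 xr (ltW x0) (ltW x1).
Qed.

(** Neighbourhoods of 0 have positive measure, hence meet every conull set. *)
Lemma near0_ae (S N : X -> Prop) : {ae mu, forall x, S x} ->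
  (\forall h \near (0 : X), N h) -> exists h, S h /\ N h.
Proof.
move=> [A [mA A0 SA]] /nbhs_ballP[r r0 hr]; apply: contrapT => no.
have := cube_gt0 r0; suff -> : mu [set x : X | forall i, (x 0 i \in `]0, r[)%R] = 0%E by rewrite ltxx.
apply/eqP; rewrite -measure_le0 -A0 le_measure ?inE//.
  rewrite (_ : mkset _ = \bigcap_i (coord i @^-1` `]0, r[)).
    apply: fin_bigcap_measurable => // i _.
    by rewrite -[X in measurable X]setTI; apply: measurable_coord => //; exact: measurable_itv.
  by apply/seteqP; split => x /= Ax i; [move=> _|]; apply: Ax.
move=> x xr; apply: SA => Sx; apply: no; exists x; split => //.
apply: hr; split => // i j; rewrite (ord1 i) mxE /ball/= sub0r normrN.
by have := xr j; rewrite in_itv/= => /andP[x0 xj]; rewrite gtr0_norm.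
Qed.

Lemma separated_trig (K : X -> X -> R) y : separated K -> trig (K y).
Proof.
elim=> [f g tf tg|K1 K2 _ IH1 _ IH2]; last exact: trig_add.
by apply: trig_mul => //; exact: trig_cst.
Qed.

(** For separated kernels, differentiation under the integral is linearity. *)
Lemma separated_partial (K : X -> X -> R) (w : X -> R) i x : separated K -> intg mu w ->
  [/\ partial (fun x => \int[mu]_y (w y * K y x)) i x = \int[mu]_y (w y * partial (K y) i x) &
  intg mu (fun y => w y * partial (K y) i x)].
Proof.
move=> sK wi; elim: sK => [f g tf tg|K1 K2 s1 [E1 I1] s2 [E2 I2]].
  have iwf := trig_mul_intg tf wi.
  have dg : derivable g x (unit_vec R i) by apply/diff_derivable/trig_differentiable.
  have E y : partial (fun x => f y * g x) i x = f y * partial g i x by rewrite /partial deriveZ.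
  have E' : (fun y => w y * partial (fun x => f y * g x) i x) =
      (fun y => partial g i x * (w y * f y)).
    by apply/funext => y; rewrite E; ring.
  rewrite E'; split; last exact: intgZ.
  rewrite IntZ//.
  have -> : (fun x => \int[mu]_y (w y * (f y * g x))) = (fun x => (\int[mu]_y (w y * f y)) * g x).
    apply/funext => z; rewrite mulrC -IntZ//; apply: eq_Rintegral => y _; ring.
  by rewrite /partial deriveZ// mulrC.
have dK y L : separated L -> derivable (L y) x (unit_vec R i).
  by move=> sL; apply/diff_derivable/trig_differentiable/separated_trig.
have E : (fun y => w y * partial (fun x => K1 y x + K2 y x) i x) =
    (fun y => w y * partial (K1 y) i x + w y * partial (K2 y) i x).
  by apply/funext => y; rewrite /partial deriveD; [exact: mulrDr|exact: dK|exact: dK].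
rewrite E; split; last exact: intgD.
rewrite IntD// -E1 -E2.
have [t1 j1] := separated_int s1 wi; have [t2 j2] := separated_int s2 wi.
have -> : (fun x => \int[mu]_y (w y * (K1 y x + K2 y x))) =
   (fun x => \int[mu]_y (w y * K1 y x) + \int[mu]_y (w y * K2 y x)).
  by apply/funext => z; rewrite -IntD//; apply: eq_Rintegral => y _; ring.
by rewrite /partial deriveD//; apply/diff_derivable/trig_differentiable.
Qed.

Lemma partial_reflect (T : X -> R) y i x : trig T ->
  partial (fun x => T (y - x)) i x = - partial T i (y - x).
Proof.
move=> tT; rewrite /partial.
rewrite -{1}[x]addr0 -(scale0r (unit_vec R i)) derive_line.
have d1 : is_derive (0 * -1 : R) 1 (fun r => T (y - x + r *: unit_vec R i)) (partial T i (y - x)).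
  rewrite mul0r /partial -[X in 'D__ _ X]addr0 -[X in 'D__ _ (_ + X)](scale0r (unit_vec R i)) derive_line.
  apply: derivableP; apply/derivable_line; exact/diff_derivable/trig_differentiable.
have d2 : is_derive (0 : R) 1 (fun r : R => r * -1) (-1).
  have -> : (fun r : R => r * -1) = (fun r => (-1) *: r) by apply/funext => r; rewrite mulrC.
  by apply: is_derive_eq; rewrite /GRing.scale/= mulr1.
have := @is_derive1_comp R (fun r => T (y - x + r *: unit_vec R i)) (fun r => r * -1) 0 _ _ d1 d2.
suff -> : (fun r : R => T (y - (x + r *: unit_vec R i))) =
    (fun r => T (y - x + r *: unit_vec R i)) \o (fun r => r * -1) by move=> [_]; rewrite mulrN1.
by apply/funext => r /=; congr T; rewrite mulrN1 scaleNr opprD addrA.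
Qed.

Variables (p p' q q' : R) (p0 : 0 < p) (p'0 : 0 < p') (q0 : 0 < q) (q'0 : 0 < q').
Hypotheses (pp' : p'^-1 + p^-1 = 1) (qq' : q^-1 + q'^-1 = 1).

(** The correlation c(h), that is the expression to be shown zero with w and G
translated by h, is orthogonal to every T: its integral against T is the weak
equation tested with the convolution of w and T, a trigonometric polynomial. So
c = 0 almost everywhere, and c(0) = 0 by continuity at 0. *)
Theorem weak_form_extend (F G : 'I_d -> X -> R) (k w : X -> R) :
  (forall i, Lpow mu p' (F i)) -> Lpow mu q k ->
  (forall phi, trig phi -> \sum_i \int[mu]_x (F i x * partial phi i x) +
     \int[mu]_x (k x * phi x) = 0) ->
  pintg w -> Lpow mu q' w ->
  (forall i, weak_partial i w (G i)) -> (forall i, Lpow mu p (G i)) ->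
  \sum_i \int[mu]_x (F i x * G i x) + \int[mu]_x (k x * w x) = 0.
Proof.
move=> LF Lk h0 [pw wi] Lw wG LG.
pose c h := \sum_i corr (F i) (G i) h + corr k w h.
have cor i T := @corr_trig R d _ _ p'0 p0 pp' (F i) (G i) (LF i) (wG i).1.1 (LG i) (wG i).1.2 T.
have cork T := @corr_trig R d _ _ q0 q'0 qq' k w Lk pw Lw wi T.
have ici i : intg mu (corr (F i) (G i)).
  by have [+ _ _] := cor i _ (trig_cst d (1 : R)); under eq_fun do rewrite mulr1.
have ick : intg mu (corr k w).
  by have [+ _ _] := cork _ (trig_cst d (1 : R)); under eq_fun do rewrite mulr1.
have ic : intg mu c by apply: intgD => //; exact: intg_sum.
have c0 : {ae mu, forall h, c h = 0}.
  apply: trig_orthogonal_eq0 => // T tT.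
  have sT := trig_separated tT.
  have [_ tP Ek] := cork _ tT.
  rewrite -(h0 _ tP) /c.
  under eq_Rintegral do rewrite mulrDl mulr_suml.
  rewrite IntD; [|by apply: intg_sum => i; exact: trig_mul_intg|exact: trig_mul_intg].
  rewrite Int_sum; last by move=> i; exact: trig_mul_intg.
  rewrite Ek; congr (_ + _); apply: eq_bigr => i _.
  have [_ _ ->] := cor i _ tT; apply: eq_Rintegral => x _; congr (_ * _).
  have [-> _] := separated_partial i x sT wi.
  under [RHS]eq_Rintegral do rewrite partial_reflect// mulrN.
  have tTx : trig (fun y => T (y - x)) by exact: trig_shift.
  rewrite IntN; last first.
    have := trig_mul_intg (trig_shift (- x) (trig_partial i tT)) wi; exact.
  have := (wG i).2 _ (trig_test tTx); under eq_Rintegral do rewrite partial_shift.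
  by move=> ->; rewrite opprK.
have -> : \sum_i \int[mu]_x (F i x * G i x) + \int[mu]_x (k x * w x) = c 0.
  rewrite /c /corr; congr (_ + _); last by apply: eq_Rintegral => x _; rewrite addr0.
  by apply: eq_bigr => i _; apply: eq_Rintegral => x _; rewrite addr0.
apply/eqP; rewrite -normr_le0; apply/ler_addgt0Pr => e e0; rewrite add0r.
have d1 : 0 < d.+1%:R :> R by [].
have near_i : \forall h \near (0 : X), forall i, `|corr (F i) (G i) h - corr (F i) (G i) 0| <= e / d.+1%:R.
  have near1 i : \forall h \near (0 : X), `|corr (F i) (G i) h - corr (F i) (G i) 0| <= e / d.+1%:R.
    exact: (@corr_continuous0 R d _ _ p'0 p0 pp' (F i) (G i) (LF i) (wG i).1.1 (LG i) (wG i).1.2 _ (divr_gt0 e0 d1)).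
  exact: (@filter_forall X 'I_d (fun i h => `|corr (F i) (G i) h - corr (F i) (G i) 0| <= e / d.+1%:R) (nbhs (0 : X)) (nbhs_filter _) near1).
have near_k := @corr_continuous0 R d _ _ q0 q'0 qq' k w Lk pw Lw wi _ (divr_gt0 e0 d1).
have [h [ch [hi hk]]] := near0_ae c0 (filterI near_i near_k).
rewrite -[c 0]opprK normrN -[X in `|X|]add0r -ch /c opprD addrACA -sumrB.
apply: (le_trans (ler_normD _ _)).
apply: (@le_trans _ _ (\sum_(i < d) e / d.+1%:R + e / d.+1%:R)).
  by apply: lerD => //; apply: (le_trans (ler_norm_sum _ _ _)); apply: ler_sum.
rewrite sumr_const card_ord -mulrSr -[(e / _) *+ _]mulr_natr divfK//.
Qed.

End weak_form.

(** * The Sobolev space W1 *)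

Section Lpow_closure.
Context dsp (T : measurableType dsp) (R : realType) (P : probability T R).

Lemma Lpow_le (p : R) (f g : T -> R) : 0 < p -> measurable_fun setT f ->
  {ae P, forall x, `|f x| <= `|g x|} -> Lpow P p g -> Lpow P p f.
Proof.
move=> p0 mf fg [mg gi]; split => //; apply: (intg_le _ gi).
  by apply: (measurableT_comp (measurable_powR p)); exact: measurableT_comp.
by apply: filterS fg => x fgx; rewrite ger0_norm ?powR_ge0// ge0_ler_powR ?nnegrE// ltW.
Qed.

Lemma Lpow_cst (p a : R) : Lpow P p (fun=> a).
Proof. by split; [exact: measurable_cst|exact: (intg_cst P (`|a| `^ p))]. Qed.

Lemma Lpow_bounded (p M : R) (f : T -> R) : 0 < p -> measurable_fun setT f ->
  {ae P, forall x, `|f x| <= M} -> Lpow P p f.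
Proof.
move=> p0 mf fM; apply: (Lpow_le (g := cst M)) => //.
  by apply: filterS fM => x fx; rewrite (le_trans fx)// ler_norm.
exact: Lpow_cst.
Qed.

Lemma Lpow_ae (p : R) (f g : T -> R) : 0 < p -> measurable_fun setT g ->
  {ae P, forall x, f x = g x} -> Lpow P p f -> Lpow P p g.
Proof.
move=> p0 mg fg; apply: Lpow_le => //; by apply: filterS fg => x ->.
Qed.

Lemma Lpow_intg (p : R) (f : T -> R) : 1 <= p -> Lpow P p f -> intg P f.
Proof.
move=> p1 [mf fi]; apply: (intg_le (g := fun x => 1 + `|f x| `^ p)) => //.
  by apply: intgD => //; exact: intg_cst.
apply: aeW => x; have [f1|f1] := ltP `|f x| 1.
  by rewrite (le_trans (ltW f1))// lerDl powR_ge0.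
by rewrite ler_wpDl// -[leLHS]powRr1// ler_powR.
Qed.

Lemma Lpow_lin (p a : R) (f g : T -> R) : 0 < p -> Lpow P p f -> Lpow P p g ->
  Lpow P p (fun x => a * f x + g x).
Proof.
move=> p0 [mf fi] [mg gi].
have mh : measurable_fun setT (fun x => a * f x + g x).
  by apply: measurable_funD => //; exact: measurable_funM.
split => //; apply: (intg_le (g := fun x => (2 `^ p * `|a| `^ p) * (`|f x| `^ p) + 2 `^ p * (`|g x| `^ p))).
- by apply: (measurableT_comp (measurable_powR p)); exact: measurableT_comp.
- by apply: intgD; exact: intgZ.
apply: aeW => x; rewrite ger0_norm ?powR_ge0//.
have t2 : 0 <= 2 * `|a * f x| by rewrite mulr_ge0.
have t3 : 0 <= 2 * `|g x| by rewrite mulr_ge0.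
have E1 : 2 `^ p * `|a| `^ p * `|f x| `^ p = (2 * `|a * f x|) `^ p.
  by rewrite normrM !powRM// ?mulr_ge0// mulrA.
have E2 : 2 `^ p * `|g x| `^ p = (2 * `|g x|) `^ p by rewrite powRM.
rewrite E1 E2; have [le_fg|/ltW le_fg] := leP `|a * f x| `|g x|.
  apply: (@le_trans _ _ ((2 * `|g x|) `^ p)); last by rewrite lerDr powR_ge0.
  apply: ge0_ler_powR; rewrite ?nnegrE//; first exact: ltW.
  by rewrite (le_trans (ler_normD _ _))// mulr2n mulrDl mul1r lerD2r.
apply: (@le_trans _ _ ((2 * `|a * f x|) `^ p)); last by rewrite lerDl powR_ge0.
apply: ge0_ler_powR; rewrite ?nnegrE//; first exact: ltW.
by rewrite (le_trans (ler_normD _ _))// mulr2n mulrDl mul1r lerD2l.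
Qed.

Lemma norm_Lpow_ae0 (p : R) (f : T -> R) : 0 < p -> measurable_fun setT f ->
  {ae P, forall x, f x = 0} -> ('N[P]_(p%:E)[EFin \o f] = 0)%E.
Proof.
move=> p0 mf f0; rewrite unlock /Lnorm.
have -> : (\int[P]_x (`|(EFin \o f) x| `^ p) = 0)%E.
  rewrite -(integral0 P setT); apply: ae_eq_integral => //.

    apply/measurable_EFinP; apply: (measurableT_comp (measurable_powR p)).
    exact: measurableT_comp.
  by apply: filterS f0 => x fx _; rewrite /= fx normr0 powR0// gt_eqF.
by rewrite poweR0r// invr_eq0 gt_eqF.
Qed.

End Lpow_closure.

Section weak_gradients.
Context (R : realType) (d : nat).
Local Notation X := 'rV[R]_d.
Local Notation mu := (torus_measure R d).

Lemma LpP (p : R) (g : X -> R) : 1 <= p -> Lp p%:E g <-> Zd_periodic g /\ Lpow mu p g.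
Proof. by move=> p1; split=> -[pg /(LpowP mu g p1)]. Qed.

Lemma weak_gradientP (u : X -> R) (G : X -> X) :
  weak_gradient u G <-> forall i, weak_partial i u (coord i \o G).
Proof.
split=> [[LG uG] i|uG]; first by split; [exact/Lp1P|move=> phi; exact: uG].
by split=> [i|phi i]; [exact/Lp1P/(uG i).1|exact: (uG i).2].
Qed.

Lemma DwP (u : X -> R) (G : 'I_d -> X -> R) : (forall i, weak_partial i u (G i)) ->
  (forall i, weak_partial i u (coord i \o Dw u)) /\
  {ae mu, forall x, forall i, Dw u x 0 i = G i x}.
Proof.
move=> uG; have /weak_gradientP wD : weak_gradient u (Dw u).
  rewrite /Dw; apply: (@xgetPex _ _ [set G | weak_gradient u G]).
  exists (fun x => \row_i G i x); apply/weak_gradientP => i.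
  rewrite (_ : _ \o _ = G i)//; by apply/funext => x; rewrite /coord /= mxE.
split=> //; apply: filter_forall => i.
exact: weak_partial_unique (wD i) (uG i).
Qed.

Section sobolev.
Variables (s : R) (s1 : 1 < s).
Let s0 : 0 < s. Proof. exact: lt_trans s1. Qed.

Lemma W1P (u : X -> R) : W1 s u <-> [/\ Zd_periodic u, Lpow mu s u,
  forall i, weak_partial i u (coord i \o Dw u) &
  forall i, Zd_periodic (coord i \o Dw u) /\ Lpow mu s (coord i \o Dw u)].
Proof.
split=> [[/(LpP _ (ltW s1))[pu su] [G /weak_gradientP uG sG]]|[pu su uD sD]]; last first.
  split; first by apply/LpP => //; exact: ltW.
  by exists (Dw u); [exact/weak_gradientP|move=> i; apply/LpP => //; exact: ltW].
have [wD DG] := DwP uG; split => // i.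
split; first exact: (wD i).1.1.
apply: (Lpow_ae (f := coord i \o G)) => //.
- exact: intg_meas (wD i).1.2.
- by apply: filterS DG => x DGx; rewrite [RHS]/= /coord/= DGx.
- by have /LpP[|] := sG i; [exact: ltW|].
Qed.

(** Membership in W1 is proved by exhibiting the partial derivatives one by one. *)
Lemma W1_intro (u : X -> R) (G : 'I_d -> X -> R) : Zd_periodic u -> Lpow mu s u ->
  (forall i, weak_partial i u (G i)) -> (forall i, Lpow mu s (G i)) ->
  W1 s u /\ {ae mu, forall x, forall i, Dw u x 0 i = G i x}.
Proof.
move=> pu su uG sG; have [wD DG] := DwP uG; split => //; apply/W1P; split => // i.
split; first exact: (wD i).1.1.
apply: (Lpow_ae (f := G i)) => //.
- exact: intg_meas (wD i).1.2.
- by apply: filterS DG => x DGx; rewrite /coord/= DGx.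
Qed.

Lemma W1_pintg (u : X -> R) : W1 s u -> pintg u.
Proof. by move=> /W1P[pu su _ _]; split => //; exact: Lpow_intg (ltW s1) su. Qed.

Lemma W1_Dw_meas (u : X -> R) : W1 s u -> measurable_fun setT (Dw u).
Proof. by move=> /W1P[_ _ _ sD]; apply: measurable_coordP => i; have [_ []] := sD i. Qed.

Lemma W1_Dw_periodic (u : X -> R) : W1 s u -> Zd_periodic (Dw u).
Proof.
move=> /W1P[_ _ _ sD] j x; apply/matrixP => k i; rewrite (ord1 k).
exact: (sD i).1.
Qed.

Lemma W1_lin a u v : W1 s u -> W1 s v -> W1 s (fun x => a * u x + v x) /\
  {ae mu, forall x, Dw (fun x => a * u x + v x) x = a *: Dw u x + Dw v x}.
Proof.
move=> Wu Wv; have /W1P[pu su uD sDu] := Wu; have /W1P[pv sv vD sDv] := Wv.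
have [|||i|W DE] := @W1_intro (fun x => a * u x + v x)
  (fun i x => a * (coord i \o Dw u) x + (coord i \o Dw v) x).
- by move=> j x; rewrite pu pv.
- exact: Lpow_lin.
- by move=> i; apply: weak_partial_lin => //; exact: W1_pintg.
- by apply: Lpow_lin => //; [exact: (sDu i).2|exact: (sDv i).2].
split=> //; apply: filterS DE => x E; apply/matrixP => k i.
by rewrite (ord1 k) E !mxE.
Qed.

Lemma W1_ae u v : W1 s u -> Zd_periodic v -> measurable_fun setT v ->
  {ae mu, forall x, u x = v x} ->
  W1 s v /\ {ae mu, forall x, Dw v x = Dw u x}.
Proof.
move=> Wu pv mv uv; have /W1P[pu su uD sD] := Wu.
have [||i|i|W DE] := @W1_intro v (fun i => coord i \o Dw u) => //.
- exact: Lpow_ae su.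
- apply: weak_partial_ae (uD i) => //; exact: su.1.
- exact: (sD i).2.
split=> //; apply: filterS DE => x E; apply/matrixP => k i.
by rewrite (ord1 k) E.
Qed.

Lemma weak_partial_cst (c : R) i : weak_partial i (fun _ : X => c) (fun=> 0).
Proof.
have p0 a : pintg (fun _ : X => a) by split => //; exact: intg_cst.
apply: diff_weak_partial => // eps eps0; apply: nearW => n.
under eq_Rintegral do rewrite mulr0 !subrr normr0.
by rewrite Int_cst mulr_ge0// ltW.
Qed.

Lemma W1_cst (c : R) : W1 s (fun _ : X => c) /\ {ae mu, forall x, Dw (fun _ : X => c) x = 0}.
Proof.
have L := Lpow_cst mu s.
have [|||i|W DE] := @W1_intro (fun _ : X => c) (fun _ _ => 0) => //.
  by move=> i; exact: weak_partial_cst.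
split=> //; apply: filterS DE => x E; apply/matrixP => k i.
by rewrite (ord1 k) E mxE.
Qed.

(** Continuous functionals on W1 therefore do not distinguish almost everywhere
equal functions. *)
Lemma norm_W1_ae0 u : W1 s u -> {ae mu, forall x, u x = 0} -> norm_W1 s u = 0.
Proof.
move=> Wu u0; have /W1P[pu su uD sD] := Wu.
have [W0 D0] := W1_cst 0.
have [_ DE] := W1_ae W0 pu su.1 (filterS (fun x => @esym _ _ _) u0).
rewrite /norm_W1 /norm_Lp norm_Lpow_ae0//; last exact: su.1.
rewrite big1 ?addr0// => i _; rewrite norm_Lpow_ae0//; first exact: (sD i).2.1.
by apply: filterS2 DE D0 => x; rewrite /coord/= => -> ->; rewrite mxE.
Qed.

End sobolev.
End weak_gradients.

(** * Lipschitz bounds from gradient bounds *)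

Section trig_regularity.
Context (R : realType) (d : nat).
Local Notation X := 'rV[R]_d.
Local Notation mu := (torus_measure R d).
Local Notation U := (uniform_prob (@ltr01 R)).
Local Notation e_ i := (unit_vec R i).

Lemma ray_bounded (g : X -> R) (M h : R) v x : measurable_fun setT g ->
  (forall t, 0 <= t <= 1 -> `|g (x + (t * h) *: v)| <= M) ->
  intg U (fun t => g (x + (t * h) *: v)) /\ `|\int[U]_t g (x + (t * h) *: v)| <= M.
Proof.
move=> mg gM.
have mr : measurable_fun setT (fun t : R => g (x + (t * h) *: v)).
  exact: (measurableT_comp (measurableT_comp mg (measurable_ray h v)) (pair2_measurable x)).
have [N [mN N0 sN]] := ae_uniform01 R.
have sN' : ~` [set t | `|g (x + (t * h) *: v)| <= M] `<=` N.
  by apply: subset_trans sN; apply: subsetC => t; exact: gM.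
have gi : intg U (fun t => g (x + (t * h) *: v)).
  by apply: (@intg_bounded _ _ _ _ _ M); [exact: mr|exists N].
split => //; apply: (le_trans (Int_norm_le gi)); rewrite -[leRHS](Int_cst U).
by apply: Int_le => //; [exact: intg_norm|exact: intg_cst|exists N].
Qed.

Lemma trig_lip (T : X -> R) i : trig T ->
  exists2 M, 0 <= M & forall x (h : R), `|T (x + h *: e_ i) - T x| <= M * `|h|.
Proof.
move=> tT; have tD := trig_partial i tT; have [M DM] := trig_bounded tD.
have M0 : 0 <= M by exact: le_trans (DM 0).
exists M => // x h; rewrite (trig_ftc i x h tT).
have [gi gM] := @ray_bounded _ M h (e_ i) x (trig_measurable tD) (fun t _ => DM _).
by rewrite IntZ// normrM mulrC ler_wpM2r.
Qed.

(** Second-order Taylor bound; only the order of magnitude in h matters. *)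
Lemma trig_taylor (T : X -> R) i : trig T ->
  exists2 M, 0 <= M &
    forall x (h : R), `|T (x + h *: e_ i) - T x - h * partial T i x| <= M * h ^+ 2.
Proof.
move=> tT; have tD := trig_partial i tT; have [M M0 DM] := trig_lip i tD.
exists M => // x h; rewrite (trig_ftc i x h tT).
have mD : measurable_fun setT (fun y => partial T i y - partial T i x).
  by apply: measurable_funB => //; exact: trig_measurable.
have [|gi gM] := @ray_bounded _ (M * `|h|) h (e_ i) x mD.
  move=> t /andP[t0 t1]; apply: (le_trans (DM x (t * h))); rewrite ler_wpM2l// normrM.
  by rewrite ler_piMl// ger0_norm.
have gi' : intg U (fun t => partial T i (x + (t * h) *: e_ i)).
  have := intgD gi (intg_cst U (partial T i x)).
  by under eq_fun do rewrite subrK.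
rewrite IntZ// -[X in _ - h * X](Int_cst U) -mulrBr -IntB//; last exact: intg_cst.
rewrite normrM mulrC -real_normK ?num_real// expr2 mulrA.
by rewrite ler_wpM2r.
Qed.

Lemma trig_weak_partial (T : X -> R) i : trig T -> weak_partial i T (partial T i).
Proof.
move=> tT; have tD := trig_partial i tT.
have pT S : trig S -> pintg S by move=> tS; split; [exact: trig_periodic|exact: trig_intg].
apply: diff_weak_partial; [exact: pT|exact: pT|move=> eps eps0].
have [M M0 TM] := trig_taylor i tT.
have M1 : 0 < M + 1 by rewrite ltr_wpDl.
have h0 := @cvg_harmonic R.
have : \forall n \near \oo, `|harmonic n : R| <= eps / (M + 1).
  have /cvgrPdist_le/(_ _ (divr_gt0 eps0 M1)) := h0.
  by apply: filterS => n; rewrite sub0r normrN.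
apply: filterS => n; rewrite /harmonic/= => hn.
rewrite -[leRHS](Int_cst mu); apply: Int_le.
- apply/intg_norm/intgB; last by apply: intgZ; exact: trig_intg.
  by apply: intgB; [exact/trig_intg/trig_shift|exact: trig_intg].
- exact: intg_cst.
- apply: aeW => x; apply: (le_trans (TM _ _)); rewrite expr2 mulrA ler_wpM2r//.
  move: hn; rewrite ger0_norm// ler_pdivlMr// mulrDr mulr1 => hn.
  by rewrite mulrC (le_trans _ hn)// lerDl.
Qed.

End trig_regularity.

Lemma indic_periodic (R : realType) d (S : set 'rV[R]_d) : Zd_periodic S ->
  Zd_periodic (\1_S : 'rV[R]_d -> R).
Proof.
move=> pS j x; rewrite !indicE; congr (_%:R).
by congr (nat_of_bool _); apply/idP/idP; rewrite !inE pS.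
Qed.

Section lipschitz.
Context (R : realType) (d : nat).
Local Notation X := 'rV[R]_d.
Local Notation mu := (torus_measure R d).
Local Notation U := (uniform_prob (@ltr01 R)).
Local Notation e_ i := (unit_vec R i).
Variables (v : X -> R) (G : 'I_d -> X -> R).
Hypotheses (pv : pintg v) (vG : forall i, weak_partial i v (G i)).

Section local.
Variables (S : set X) (L : R).
Hypotheses (mS : measurable S) (pS : Zd_periodic S) (L0 : 0 <= L)
  (SL : forall i, {ae mu, forall x, S x -> `|G i x| <= L}).

(** By weak_partial_ray the increment is an average of the derivative over a segment
that stays in S. Almost every segment meets the exceptional set of the bound in
a null set of parameters, by ae_swap; the function k measures the violation. *)
Lemma weak_partial_lip i (B : set X) (a : X) (h : R) :
  (forall x t, B x -> 0 <= t <= 1 -> S (x + a + (t * h) *: e_ i)) ->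
  {ae mu, forall x, B x -> `|v (x + a + h *: e_ i) - v (x + a)| <= L * `|h|}.
Proof.
move=> BS; have [[pg gi] _] := vG i.
have [ray0 _] := weak_partial_ray h pv (vG i).
have ray : {ae mu, forall x, v (x + a + h *: e_ i) - v (x + a) =
    h * \int[U]_t G i (x + a + (t * h) *: e_ i)}.
  apply: (ae_shift (S := fun x => v (x + h *: e_ i) - v x =
    h * \int[U]_t G i (x + (t * h) *: e_ i))) ray0 => j x.
  rewrite addrAC !pv.1; under eq_Rintegral do rewrite addrAC pg.
  by [].
pose k x : R := \1_S x * Num.max (`|G i x| - L) 0.
have mk : measurable_fun setT k.
  apply: measurable_funM; first exact: measurable_indic.
  apply: measurable_maxr => //; apply: measurable_funB => //.
  by apply: measurableT_comp => //; exact: intg_meas gi.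
have k0 x : 0 <= k x by rewrite mulr_ge0// ?le_max ?lexx ?orbT// indicE.
have kP x : k x = 0 <-> (S x -> `|G i x| <= L).
  rewrite /k indicE; have [/set_mem Sx|/negP nSx] := boolP (x \in S); last first.
    by rewrite mul0r; split => // _ Sx; case: nSx; rewrite inE.
  rewrite mul1r; split=> [/eqP|/(_ Sx) h0]; last by rewrite max_r// subr_le0.
  by rewrite eq_maxr ?subr_le0.
have k_ae t : {ae mu, forall x, k (x + a + (t * h) *: e_ i) = 0}.
  suff : {ae mu, forall x, k (x + (a + (t * h) *: e_ i)) = 0} by apply: filterS => x; rewrite addrA.
  apply: (ae_shift (S := fun x => k x = 0)); last by apply: filterS (SL i) => x /kP.
  by move=> j x; rewrite /k indic_periodic// pg.
have mr (g : X -> R) : measurable_fun setT g -> measurable_fun setT (fun z : X * R => g (z.1 + a + (z.2 * h) *: e_ i)).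
  move=> mg; have m1 : measurable_fun setT (fun z : X * R => g (z.1 + (z.2 * h) *: e_ i + a)).
    exact: (measurableT_comp (measurableT_comp mg (measurable_shift a))
      (measurableT_comp (measurable_ray h (e_ i)) (@measurable_swap _ _ X R))).
  by under eq_fun do rewrite addrAC.
have mz := mr _ mk.
have sw := @ae_swap _ _ _ _ _ mu U (fun z : X * R => k (z.1 + a + (z.2 * h) *: e_ i)) mz
  (fun z => k0 _) (ex_intro _ set0 (And3 measurable0 (measure0 U) (fun t ht => ht (k_ae t)))).
have [N [mN N0 sN]] := ae_uniform01 R.
apply: filterS2 ray sw => x -> [N' [mN' N'0 sN']] Bx.
(* cut at the level L, the integrand is bounded on the whole segment *)
have E : \int[U]_t (G i (x + a + (t * h) *: e_ i)) =
    \int[U]_t (Num.min L (Num.max (- L) (G i (x + a + (t * h) *: e_ i)))).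
  apply: eq_ae_Int.
  - exact: (measurableT_comp (mr _ (intg_meas gi)) (pair1_measurable x)).
  - apply: measurable_minr => //; apply: measurable_maxr => //.
    exact: (measurableT_comp (mr _ (intg_meas gi)) (pair1_measurable x)).
  - exists (N `|` N'); split; [exact: measurableU|exact: etrans (measureU0 mN mN' N'0) N0|].
    move=> t /= ht; apply: contrapT => /not_orP[Nt N't]; apply: ht.
    have t01 : 0 <= t <= 1 by apply: contrapT => ?; exact/Nt/sN.
    have /kP/(_ (BS x t Bx t01)) : k (x + a + (t * h) *: e_ i) = 0.
      by apply: contrapT => ?; exact/N't/sN'.
    by rewrite ler_norml => /andP[g1 g2]; rewrite max_r// min_r.
rewrite E normrM mulrC ler_wpM2r//.
have mm : measurable_fun setT (fun y => Num.min L (Num.max (- L) (G i y))).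
  by apply: measurable_minr => //; apply: measurable_maxr => //; exact: intg_meas gi.
have [|_] := @ray_bounded _ _ _ L h (e_ i) (x + a) mm; last by [].
by move=> t _; rewrite ler_norml le_min le_max lexx/= ge_min lexx/= andbT ge0_cp.
Qed.

Lemma norm_unit_vec (i : 'I_d) : `|e_ i| <= 1.
Proof.
rewrite [leLHS]mx_normrE; apply/bigmax_leP; split => //= -[a b] _ /=.
by rewrite mxE; case: (_ && _); rewrite ?normr1 ?normr0.
Qed.

Lemma row_sum_unit (y : X) : \sum_i y 0 i *: e_ i = y.
Proof. by rewrite [RHS]row_sum_delta. Qed.

Lemma norm_coord (y : X) i : `|y 0 i| <= `|y|.
Proof. by rewrite [leRHS]mx_normrE; apply: (le_bigmax _ (fun k => `|y k.1 k.2|) (0, i)). Qed.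

Lemma norm_partial_sum (y : X) (r : seq 'I_d) :
  `|\sum_(i <- r) y 0 i *: e_ i| <= (size r)%:R * `|y|.
Proof.
apply: (le_trans (ler_norm_sum _ _ _)).
apply: (@le_trans _ _ (\sum_(i <- r) `|y|)).
  apply: ler_sum => i _; rewrite normrZ -[leRHS]mulr1.
  by apply: ler_pM => //; [exact: norm_coord|exact: norm_unit_vec].
by rewrite big_const_seq count_predT iter_addr_0 mulr_natl.
Qed.

(** Go from x to x + y one coordinate after the other; the partial sums stay within
distance d |y| of x. *)
Lemma weak_lipschitz (B : set X) (y : X) :
  (forall x z, B x -> `|z| <= d%:R * `|y| -> S (x + z)) ->
  {ae mu, forall x, B x -> `|v (x + y) - v x| <= d%:R * `|y| * L}.
Proof.
move=> BS.
suff H r : (size r <= d)%N ->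
    {ae mu, forall x, B x -> `|v (x + \sum_(i <- r) y 0 i *: e_ i) - v x| <= (size r)%:R * `|y| * L}.
  by have := H (index_enum 'I_d); rewrite row_sum_unit /index_enum -enumT size_enum_ord => /(_ (leqnn _)).
elim: r => [_|i r IH rd].
  by apply: aeW => x _; rewrite big_nil addr0 subrr normr0 !mul0r.
pose a := \sum_(i <- r) y 0 i *: e_ i.
have y0 : 0 <= `|y| by [].
have lip : {ae mu, forall x, B x -> `|v (x + a + y 0 i *: e_ i) - v (x + a)| <= L * `|y 0 i|}.
  apply: weak_partial_lip => x t Bx /andP[t0 t1]; rewrite -addrA; apply: BS => //.
  have na := norm_partial_sum y r.
  apply: (le_trans (ler_normD _ _)).
  apply: (@le_trans _ _ ((size r)%:R * `|y| + `|y|)).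
    apply: lerD => //; rewrite normrZ -[leRHS]mulr1.
    apply: ler_pM => //; last exact: norm_unit_vec.
    by rewrite normrM -[leRHS]mul1r ler_pM// ?norm_coord// ger0_norm.
  by rewrite -[X in _ + X]mul1r -mulrDl ler_wpM2r// -(natrD _ _ 1) ler_nat addn1.
apply: filterS2 lip (IH (ltnW rd)) => x h1 h2 Bx.
rewrite big_cons [_ + a]addrC addrA.
rewrite -[X in `|X|](subrKA (v (x + a))); apply: (le_trans (ler_normD _ _)).
have -> : (size (i :: r))%:R * `|y| * L = `|y| * L + (size r)%:R * `|y| * L.
  by rewrite /= mulrSr; ring.
apply: lerD; last exact: h2.
by apply: (le_trans (h1 Bx)); rewrite mulrC ler_wpM2r// norm_coord.
Qed.

End local.
End lipschitz.

(** * Difference quotients along vectors and local bumps *)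

Section difference_quotients.
Context (R : realType) (d : nat).
Local Notation X := 'rV[R]_d.
Local Notation mu := (torus_measure R d).
Local Notation e_ i := (unit_vec R i).
Variables (v : X -> R) (G : 'I_d -> X -> R).
Hypotheses (pv : pintg v) (vG : forall i, weak_partial i v (G i)).

Lemma scale_cvg0 (c : X) (P : X -> Prop) : (\forall h \near (0 : X), P h) ->
  \forall h \near (0 : R), P (h *: c).
Proof.
have ce : (fun h : R => h *: c) @ (0 : R) --> (0 : X).
  by rewrite -[X in _ --> X](scale0r c); apply: scalel_continuous.
exact: ce.
Qed.

Lemma mulr_cvg0 (c : R) (P : R -> Prop) : (\forall h \near (0 : R), P h) ->
  \forall h \near (0 : R), P (h * c).
Proof.
have ce : (fun h : R => h * c) @ (0 : R) --> (0 : R).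
  by rewrite -[X in _ --> X](mul0r c); apply: cvgM; [exact: cvg_id|exact: cvg_cst].
exact: ce.
Qed.

(** Telescope over the coordinates: each step is a one-dimensional difference
quotient at a translated point, and translations are continuous in L1. *)
Lemma weak_diff_vec (c : X) (eps : R) : 0 < eps ->
  \forall h \near (0 : R),
    \int[mu]_x `|v (x + h *: c) - v x - h * \sum_i c 0 i * G i x| <= eps * `|h|.
Proof.
move=> eps0.
have ish a : intg mu (fun x => v (x + a)) by apply: intg_shift; [exact: pv.1|exact: pv.2].
have iG i : intg mu (G i) by exact: (vG i).1.2.
have iGs i a : intg mu (fun x => G i (x + a)) by apply: intg_shift => //; exact: (vG i).1.1.
suff H (r : seq 'I_d) (ep : R) : 0 < ep -> \forall h \near (0 : R),
    \int[mu]_x `|v (x + h *: \sum_(i <- r) c 0 i *: e_ i) - v x -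
       h * \sum_(i <- r) c 0 i * G i x| <= ep * `|h|.
  by have := H (index_enum 'I_d) _ eps0; rewrite row_sum_unit.
elim: r ep => [|i r IH] ep ep0.
  apply/nbhs_ballP; exists 1 => //= h _; under eq_Rintegral do rewrite !big_nil scaler0 addr0 subrr mulr0 subr0 normr0.
  by rewrite Int_cst mulr_ge0// ltW.
pose a := \sum_(j <- r) c 0 j *: e_ j.
pose D x := \sum_(j <- r) c 0 j * G j x.
have iD : intg mu D by apply: intg_sum => j; exact: intgZ.
have k0 : 0 < 3 * (`|c 0 i| + 1) by rewrite mulr_gt0// ltr_wpDl.
have e1 : 0 < ep / (3 * (`|c 0 i| + 1)) by rewrite divr_gt0.
have e3 : 0 < ep / 3 by rewrite divr_gt0.
have e1c : ep / (3 * (`|c 0 i| + 1)) * `|c 0 i| <= ep / 3.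
  have -> : ep / (3 * (`|c 0 i| + 1)) * `|c 0 i| = ep / 3 * (`|c 0 i| / (`|c 0 i| + 1)).
    by field; rewrite gt_eqF// ltr_wpDl.
  by rewrite ler_piMr ?(ltW e3)// ler_pdivrMr ?mul1r ?lerDl// ltr_wpDl.
have := scale_cvg0 a (translation_cvg (vG i).1.1 (iG i) e1).
have := mulr_cvg0 (c 0 i) (weak_partial_diff pv (vG i) e1).
apply: filterS3 (IH _ e3) => h h1 h2 h3.
have i1 : intg mu (fun x => v (x + (h * c 0 i) *: e_ i) - v x - h * c 0 i * G i x).
  by apply: intgB; [apply: intgB => //; exact: pv.2|exact: intgZ].
have i1s : intg mu (fun x => v (x + h *: a + (h * c 0 i) *: e_ i) - v (x + h *: a) - h * c 0 i * G i (x + h *: a)).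
  apply: (@intg_shift _ _ (fun x => v (x + (h * c 0 i) *: e_ i) - v x - h * c 0 i * G i x)) => //.
  by move=> j x; rewrite [x + _ + _]addrAC !pv.1 (vG i).1.1.
have i2 : intg mu (fun x => h * c 0 i * (G i (x + h *: a) - G i x)) by apply/intgZ/intgB.
have i3 : intg mu (fun x => v (x + h *: a) - v x - h * D x).
  by apply: intgB; [apply: intgB => //; exact: pv.2|exact: intgZ].
apply: (@le_trans _ _ (\int[mu]_x (`|v (x + h *: a + (h * c 0 i) *: e_ i) - v (x + h *: a) - h * c 0 i * G i (x + h *: a)| +
  (`|h * c 0 i * (G i (x + h *: a) - G i x)| + `|v (x + h *: a) - v x - h * D x|)))).
  apply: Int_le.
  - apply/intg_norm/intgB; last by apply: intgZ; apply: intg_sum => j; exact: intgZ.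
    by apply: intgB => //; exact: pv.2.
  - by apply: intgD; [exact: intg_norm|apply: intgD; exact: intg_norm].
  - apply: aeW => x; rewrite !big_cons -/a -/(D x).
    have -> : x + h *: (c 0 i *: e_ i + a) = x + h *: a + (h * c 0 i) *: e_ i.
      by rewrite scalerDr scalerA [_ + h *: a]addrC addrA.
    have -> : v (x + h *: a + (h * c 0 i) *: e_ i) - v x - h * (c 0 i * G i x + D x) =
      (v (x + h *: a + (h * c 0 i) *: e_ i) - v (x + h *: a) - h * c 0 i * G i (x + h *: a)) +
      (h * c 0 i * (G i (x + h *: a) - G i x) + (v (x + h *: a) - v x - h * D x)) by ring.
    apply: (le_trans (ler_normD _ _)); apply: lerD => //; exact: ler_normD.
rewrite IntD; [|exact: intg_norm|by apply: intgD; exact: intg_norm].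
rewrite IntD; [|exact: intg_norm|exact: intg_norm].
have -> : ep * `|h| = ep / 3 * `|h| + (ep / 3 * `|h| + ep / 3 * `|h|) by field.
apply: lerD; [|apply: lerD; last exact: h1].
  rewrite (@Int_shift _ _ (fun x => `|v (x + (h * c 0 i) *: e_ i) - v x - h * c 0 i * G i x|) (h *: a)).
  - by apply: (le_trans h2); rewrite normrM mulrCA [leRHS]mulrC ler_wpM2l.
  - by move=> j x; rewrite [x + _ + _]addrAC !pv.1 (vG i).1.1.
  - exact: intg_norm.
under eq_Rintegral do rewrite normrM; rewrite IntZ; last by apply/intg_norm/intgB.
set I := \int[mu]_x _ in h3 *.
have -> : `|h * c 0 i| * I = `|h| * (I * `|c 0 i|) by rewrite normrM; ring.
rewrite [leRHS]mulrC; apply: ler_wpM2l => //; apply: le_trans e1c; exact: ler_wpM2r.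
Qed.

End difference_quotients.

Section good_point.
Context dsp (T : measurableType dsp) (R : realType) (P : probability T R).

Lemma intg_indic (A : set T) : measurable A ->
  intg P (\1_A) /\ \int[P]_x \1_A x = fine (P A).
Proof.
move=> mA; split; last by rewrite /Rintegral integral_indic// setIT.
apply: (@intg_bounded _ _ _ _ _ 1); first exact: measurable_indic.
by apply: aeW => x; rewrite indicE; case: (_ \in _); rewrite ?normr1 ?normr0.
Qed.

(** Markov's inequality: E cannot be at least tau on almost all of A. *)
Lemma good_point (A : set T) (S : T -> Prop) (E : T -> R) (tau : R) :
  measurable A -> intg P E -> (forall x, 0 <= E x) ->
  \int[P]_x E x < tau * fine (P A) -> {ae P, forall x, S x} ->
  exists x, [/\ A x, S x & E x < tau].
Proof.
move=> mA iE E0 Es aS; apply: contrapT => no.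
have [iA IA] := intg_indic mA.
move: Es; rewrite ltNge => /negP; apply; rewrite -IA -IntZ//.
apply: Int_le => //; first exact: intgZ.
apply: filterS aS => x Sx; rewrite indicE; have [/set_mem Ax|_] := boolP (x \in A); last by rewrite mulr0.
by rewrite mulr1 leNgt; apply/negP => Ex; apply: no; exists x.
Qed.

End good_point.

Section bump.
Context (R : realType) (d : nat).
Local Notation X := 'rV[R]_d.
Local Notation mu := (torus_measure R d).
Local Notation e_ i := (unit_vec R i).

(** The positive part squared is C1 with a 2-Lipschitz derivative. *)
Lemma sqr_pos_taylor (a b : R) :
  `|Num.max b 0 ^+ 2 - Num.max a 0 ^+ 2 - 2 * Num.max a 0 * (b - a)| <= (b - a) ^+ 2.
Proof.
have [a0|/ltW a0] := leP a 0; have [b0|/ltW b0] := leP b 0; rewrite ler_norml; apply/andP; split.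
all: rewrite ?expr0n/= ?(mul0r, mulr0, subr0, sub0r, oppr0).
- by rewrite oppr_le0 sqr_ge0.
- exact: sqr_ge0.
- by rewrite (le_trans _ (sqr_ge0 b))// oppr_le0 sqr_ge0.
- nra.
- nra.
- nra.
- have -> : b ^+ 2 - a ^+ 2 - 2 * a * (b - a) = (b - a) ^+ 2 by ring.
  by rewrite (le_trans _ (sqr_ge0 _))// oppr_le0 sqr_ge0.
- by have -> : b ^+ 2 - a ^+ 2 - 2 * a * (b - a) = (b - a) ^+ 2 by ring.
Qed.

Variables (z : X -> R) (i : 'I_d) (g : X -> R) (c L h0 : R) (B : set X).
Hypotheses (pz : pintg z) (zg : weak_partial i z g) (c0 : 0 < c) (h00 : 0 < h0)
  (mB : measurable B) (pB : Zd_periodic B) (L0 : 0 <= L).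
Hypothesis zlip : forall h, 0 < h -> h < h0 ->
  {ae mu, forall x, B x -> `|z (x + h *: e_ i) - z x| <= L * h}.
Hypothesis zout : forall h, 0 < h -> h < h0 ->
  {ae mu, forall x, (B x -> ~ B (x + h *: e_ i) -> z x <= 0) /\
    (~ B x -> B (x + h *: e_ i) -> z (x + h *: e_ i) <= 0)}.
Hypothesis zc : {ae mu, forall x, B x -> z x <= c}.

(** The function gamma(z) restricted to B, where gamma(t) = (t^+)^2 / (2 c) has slope
at most 1 on z <= c and vanishes to second order at 0. *)
Definition bump x := \1_B x * (Num.max (z x) 0 ^+ 2 / (2 * c)).
(** The slope of gamma at z. *)
Definition bump_rate x := \1_B x * (Num.max (z x) 0 / c).

Lemma bump_meas : measurable_fun setT bump /\ measurable_fun setT bump_rate.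
Proof.
have mz := intg_meas pz.2.
have mm : measurable_fun setT (fun x => Num.max (z x) 0) by exact: measurable_maxr.
split; apply: measurable_funM; try exact: measurable_indic; apply: measurable_funM => //.
exact: measurable_funX.
Qed.

Lemma bump_bound : {ae mu, forall x, 0 <= bump x <= c} /\
  {ae mu, forall x, 0 <= bump_rate x <= 1}.
Proof.
have c2 : 0 < 2 * c by rewrite mulr_gt0.
have m0 x : 0 <= Num.max (z x) 0 by rewrite le_max lexx orbT.
split; apply: filterS zc => x; rewrite /bump /bump_rate indicE;
    have [/set_mem Bx|_] := boolP (x \in B) => zx; rewrite ?mul0r ?lexx ?ler01 ?(ltW c0)//= mul1r.
- have m1 : Num.max (z x) 0 <= c by rewrite ge_max zx//= ltW.
  rewrite divr_ge0 ?exprn_ge0 ?(ltW c2)//= ler_pdivrMr//.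
  have := m0 x; nra.
- have m1 : Num.max (z x) 0 <= c by rewrite ge_max zx//= ltW.
  by rewrite divr_ge0 ?(ltW c0)//= ler_pdivrMr// mul1r.
Qed.

Lemma bump_pintg : pintg bump.
Proof.
split; first by move=> j x; rewrite /bump indic_periodic// pz.1.
apply: (@intg_bounded _ _ _ _ _ c); first exact: bump_meas.1.
by apply: filterS bump_bound.1 => x /andP[b0 b1]; rewrite ger0_norm.
Qed.

(** Difference quotients of the bump converge in L1 to the slope times the
derivative of z. In B this is Taylor's formula for gamma, with an error
quadratic in the increments of z, which are O(h) there. A step across the
boundary of B only meets points with z <= 0, where the bump vanishes anyway, so
that the cut creates no jump. *)
Lemma bump_weak_partial : weak_partial i bump (fun x => bump_rate x * g x).
Proof.
have [pg gi] := zg.1.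
have ir : intg mu (fun x => bump_rate x * g x).
  apply: (intg_mull (M := 1)) => //; first exact: bump_meas.2.
  by apply: filterS bump_bound.2 => x /andP[b0 b1]; rewrite ger0_norm.
have prg : pintg (fun x => bump_rate x * g x).
  by split => // j x; rewrite /bump_rate indic_periodic// pz.1 pg.
apply: diff_weak_partial => //; first exact: bump_pintg.
move=> eps eps0; have c2 : 0 < 2 * c by rewrite mulr_gt0.
have e2 : 0 < eps / 2 by rewrite divr_gt0.
have M1 : 0 < L ^+ 2 / (2 * c) + 1 by rewrite ltr_wpDl// divr_ge0 ?sqr_ge0// ltW.
have hcvg : (fun n : nat => n.+1%:R^-1 : R) @ \oo --> (0 : R) by exact: cvg_harmonic.
have n1 : \forall n \near \oo,
    \int[mu]_x `|z (x + n.+1%:R^-1 *: e_ i) - z x - n.+1%:R^-1 * g x| <= eps / 2 * `|n.+1%:R^-1|.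
  exact: hcvg _ (weak_partial_diff pz zg e2).
have n2 : \forall n \near \oo, `|0 - n.+1%:R^-1 : R| < h0.
  by move: hcvg => /cvgrPdist_lt; apply.
have n3 : \forall n \near \oo, `|0 - n.+1%:R^-1 : R| <= eps / 2 / (L ^+ 2 / (2 * c) + 1).
  by move: hcvg => /cvgrPdist_le; apply; exact: divr_gt0.
apply: filterS3 n1 n2 n3 => n; rewrite !sub0r !normrN.
have : 0 < n.+1%:R^-1 :> R by rewrite invr_gt0.
move: (n.+1%:R^-1 : R) => h hp; rewrite (gtr0_norm hp) => h1 h2 h3.
have iz : intg mu (fun x => z (x + h *: e_ i) - z x - h * g x).
  apply: intgB; last exact: intgZ.
  by apply: intgB; [apply: intg_shift; [exact: pz.1|exact: pz.2]|exact: pz.2].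
apply: (@le_trans _ _ (\int[mu]_x (L ^+ 2 / (2 * c) * h ^+ 2 + `|z (x + h *: e_ i) - z x - h * g x|))).
  apply: Int_le.
  - apply/intg_norm/intgB; last exact: intgZ.
    have [pb ib] := bump_pintg.
    by apply: intgB => //; exact: intg_shift.
  - by apply: intgD; [exact: intg_cst|exact: intg_norm].
  - apply: filterS3 (zlip hp h2) (zout hp h2) bump_bound.2 => x zl [zo1 zo2] /andP[br0 br1].
    have K0 : 0 <= L ^+ 2 / (2 * c) * h ^+ 2.
      by rewrite mulr_ge0 ?sqr_ge0// divr_ge0 ?sqr_ge0// ltW.
    have T0 : 0 <= L ^+ 2 / (2 * c) * h ^+ 2 + `|z (x + h *: e_ i) - z x - h * g x|.
      by rewrite addr_ge0.
    have [Bx|nBx] := pselect (B x); have [Bh|nBh] := pselect (B (x + h *: e_ i)); last first.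
    + by rewrite /bump /bump_rate !indicE !memNset// !mul0r mulr0 !subr0 normr0.
    + by rewrite /bump /bump_rate !indicE (memNset nBx) (mem_set Bh) max_r ?zo2// expr0n/= !(mul0r,mulr0) !subr0 normr0.
    + by rewrite /bump /bump_rate !indicE (memNset nBh) (mem_set Bx) (max_r (zo1 Bx nBh)) expr0n/= !(mul0r,mulr0) !subr0 normr0.
    move: br0 br1; rewrite /bump /bump_rate !indicE (mem_set Bx) (mem_set Bh) !mul1r.
    set a := z x; set b := z (x + h *: e_ i); set p := Num.max a 0; set q := Num.max b 0 => br0 br1.
    have -> : q ^+ 2 / (2 * c) - p ^+ 2 / (2 * c) - h * (p / c * g x) =
      (q ^+ 2 - p ^+ 2 - 2 * p * (b - a)) / (2 * c) + p / c * (b - a - h * g x).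
      by field; rewrite gt_eqF.
    apply: (le_trans (ler_normD _ _)); apply: lerD; last first.
      by rewrite normrM (ger0_norm br0) ler_piMl.
    rewrite normrM normfV (gtr0_norm c2) ler_pdivrMr//.
    have -> : L ^+ 2 / (2 * c) * h ^+ 2 * (2 * c) = (L * h) ^+ 2 by field; rewrite gt_eqF.
    apply: (le_trans (sqr_pos_taylor a b)); rewrite -real_normK ?num_real//.
    by rewrite lerXn2r ?nnegrE ?mulr_ge0 ?(ltW hp)//; exact: zl.
rewrite IntD; [|exact: intg_cst|exact: intg_norm].
rewrite Int_cst [leRHS](splitr (eps * h)); apply: lerD; last by rewrite mulrAC.
rewrite expr2 mulrA -mulrA [leRHS]mulrAC mulrA ler_wpM2r ?(ltW hp)//.
move: h3; rewrite ler_pdivlMr// mulrDr mulr1 mulrC => h3.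
by apply: le_trans h3; rewrite lerDl ltW.
Qed.

End bump.

(** * Periodic substitutes for affine functions and paraboloids *)

Section trig_estimates.
Context (R : realType).
Implicit Types t : R.

Lemma sin_MVT (x : R) : 0 <= x -> exists2 c, 0 <= c <= x & sin x = x * cos c.
Proof.
rewrite le_eqVlt => /predU1P[<-|x0].
  by exists 0; rewrite ?lexx// sin0 mul0r.
have [|c c0x] := @MVT R sin cos 0 x x0.
  by apply: continuous_subspaceT; exact: continuous_sin.
rewrite sin0 !subr0 mulrC => E; exists c => //.
by move: c0x; rewrite in_itv/= => /andP[c0 cx]; rewrite !ltW.
Qed.

Lemma sin_norm_le (x : R) : `|sin x| <= `|x|.
Proof.
wlog x0 : x / 0 <= x.
  move=> H; have [/H//|/ltW x0] := leP 0 x.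
  by rewrite -normrN -sinN -[leRHS]normrN H// oppr_ge0.
have [c _ ->] := sin_MVT x0.
by rewrite normrM ler_piMr// cos_max.
Qed.

Lemma pi_lt4 : pi < 4 :> R.
Proof. by have := pihalf_lt2 R; rewrite ltr_pdivrMr// -natrM. Qed.

(** Comparable to the square of the distance of t to the integers. *)
Definition well t : R := 1 - cos (2 * pi * t).

Lemma wellE t : well t = 2 * sin (pi * t) ^+ 2.
Proof.
rewrite /well -mulrA [X in cos X]mulr_natl cos_mulr2n cos2sin2.
by rewrite mulr2n; ring.
Qed.

Lemma well_ge0 t : 0 <= well t.
Proof. by rewrite subr_ge0 cos_le1. Qed.

Lemma pit_sqr_le t : (pi * t) ^+ 2 <= 16 * t ^+ 2.
Proof.
rewrite exprMn ler_wpM2r ?sqr_ge0// (_ : 16 = 4 ^+ 2 :> R); last by ring.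
by rewrite lerXn2r ?nnegrE ?pi_ge0// ltW// pi_lt4.
Qed.

Lemma well_le t : well t <= 32 * t ^+ 2.
Proof.
rewrite wellE; have h := sin_norm_le (pi * t).
have : `|sin (pi * t)| ^+ 2 <= `|pi * t| ^+ 2 by rewrite lerXn2r ?nnegrE.
rewrite !real_normK ?num_real//.
have := pit_sqr_le t; lra.
Qed.

(** The bound well t < 1 keeps 2 pi t in the first quadrant, where the sine is at
least a fixed multiple of its argument. *)
Lemma well_ge t : `|t| <= 2^-1 -> well t < 1 -> 4 * t ^+ 2 <= well t.
Proof.
wlog t0 : t / 0 <= t.
  move=> H; have [/H//|/ltW t0] := leP 0 t.
  have -> : well t = well (- t) by rewrite /well mulrN cosN.
  by rewrite -normrN -sqrrN; apply: H; rewrite oppr_ge0.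
rewrite ger0_norm// => t2; rewrite ltrBlDr ltrDl => c0.
have p0 := pi_gt0 R.
have t4 : 2 * pi * t < pi / 2.
  rewrite ltNge; apply/negP => h.
  have : cos (2 * pi * t) <= cos (pi / 2).
    move: h; rewrite le_eqVlt => /predU1P[<-//|h].
    rewrite ltW// ltr_cos// in_itv/=.
      by rewrite divr_ge0 ?(ltW p0)//= ler_pdivrMr// ler_peMr ?(ltW p0)// ler1n.
    rewrite !mulr_ge0 ?(ltW p0)//=; nra.
  by rewrite cos_pihalf leNgt c0.
have pt0 : 0 <= pi * t by rewrite mulr_ge0// ltW.
have [c /andP[c0' cx] E] := sin_MVT pt0.
have cc : 1 <= 2 * cos c ^+ 2.
  have : 0 <= cos (c *+ 2).
    apply: cos_ge0_pihalf; rewrite -mulr_natl; apply/andP; split; nra.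
  by rewrite cos_mulr2n mulr2n; lra.
rewrite wellE E !exprMn.
have pp : 4 <= pi ^+ 2 :> R.
  by rewrite (_ : 4 = 2 ^+ 2 :> R); [rewrite lerXn2r ?nnegrE ?pi_ge0// pi_ge2|ring].
have a1 : 4 * t ^+ 2 <= pi ^+ 2 * t ^+ 2 by rewrite ler_wpM2r ?sqr_ge0.
have a2 : pi ^+ 2 * t ^+ 2 <= pi ^+ 2 * t ^+ 2 * (2 * cos c ^+ 2).
  by rewrite ler_peMr// mulr_ge0 ?sqr_ge0.
lra.
Qed.

(** A periodic function tangent to the identity at 0. *)
Definition tooth t : R := sin (2 * pi * t) / (2 * pi).

Lemma tooth_near t : `|tooth t - t| <= 32 * `|t| ^+ 3.
Proof.
wlog t0 : t / 0 <= t.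
  move=> H; have [/H//|/ltW t0] := leP 0 t.
  have -> : tooth t - t = - (tooth (- t) - - t) by rewrite /tooth mulrN sinN; ring.
  by rewrite normrN -[`|t|]normrN; apply: H; rewrite oppr_ge0.
have pp := pi_gt0 R; have p0 : 0 < 2 * pi :> R by rewrite mulr_gt0.
have pn : pi != 0 :> R by rewrite gt_eqF.
have pt0 : 0 <= 2 * pi * t by rewrite mulr_ge0// ltW.
have [c /andP[c0 cx] E] := sin_MVT pt0.
have -> : tooth t - t = - (t * (1 - cos c)) by rewrite /tooth E; move: (@pi R) pn => q qn; field.
rewrite normrN normrM exprS mulrCA; apply: ler_wpM2l => //.
have -> : 1 - cos c = well (c / (2 * pi)) by rewrite /well; congr (1 - cos _); move: (@pi R) pn => q qn; field.
rewrite ger0_norm ?well_ge0//; apply: (le_trans (well_le _)); rewrite ler_wpM2l//.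
rewrite ger0_norm// lerXn2r ?nnegrE ?divr_ge0 ?(ltW p0)//.
by rewrite ler_pdivrMr// mulrC.
Qed.

Lemma well_slope t : `|2 * pi * sin (2 * pi * t)| <= 64 * `|t|.
Proof.
have p0 := pi_gt0 R; rewrite normrM (gtr0_norm (mulr_gt0 (ltr0Sn R 1) p0)).
apply: (@le_trans _ _ (2 * pi * `|2 * pi * t|)).
  by rewrite ler_wpM2l ?mulr_ge0 ?(ltW p0)// sin_norm_le.
rewrite normrM (gtr0_norm (mulr_gt0 (ltr0Sn R 1) p0)) mulrA ler_wpM2r//.
have := pi_lt4; nra.
Qed.

End trig_estimates.

Section charts.
Context (R : realType) (d : nat).
Local Notation X := 'rV[R]_d.
Variables (x0 : X).

(** A periodic paraboloid with its minima at the translates of x0. *)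
Definition pit (x : X) : R := \sum_i well (x 0 i - x0 0 i).
(** A periodic function tangent to the linear form p at x0. *)
Definition tilt (p x : X) : R := \sum_i p 0 i * tooth (x 0 i - x0 0 i).

Lemma cos_trig i : trig (fun x : X => cos (2 * pi * (x 0 i - x0 0 i))).
Proof.
have := trig_cos i (- (2 * pi * x0 0 i)); congr trig; apply/funext => x.
by congr cos; ring.
Qed.

Lemma sin_trig i : trig (fun x : X => sin (2 * pi * (x 0 i - x0 0 i))).
Proof.
have := trig_cos i (- (2 * pi * x0 0 i) - pi / 2); congr trig; apply/funext => x.
by rewrite -cosBpihalf; congr cos; ring.
Qed.

Lemma pit_trig : trig pit.
Proof. by apply: trig_sum => i; apply: trig_sub; [exact: trig_cst|exact: cos_trig]. Qed.

Lemma tilt_trig p : trig (tilt p).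
Proof.
apply: trig_sum => i; apply: trig_mul; first exact: trig_cst.
by rewrite /tooth; apply: trig_mul; [exact: sin_trig|exact: trig_cst].
Qed.

Lemma partial_coord (F F' : R -> R) i j x :
  (forall t : R, is_derive t 1 F (F' t)) ->
  is_derive x (unit_vec R i) (fun x : X => F (x 0 j - x0 0 j)) ((j == i)%:R * F' (x 0 j - x0 0 j)).
Proof.
move=> dF; pose k : R := (j == i)%:R.
have E : (fun h : R => F ((x + h *: unit_vec R i) 0 j - x0 0 j)) = F \o (fun h => k * h + (x 0 j - x0 0 j)).
  by apply/funext => h /=; congr F; rewrite !mxE eqxx/= -/k; ring.
have d1 : is_derive (0 : R) 1 (fun h => F ((x + h *: unit_vec R i) 0 j - x0 0 j)) (k * F' (x 0 j - x0 0 j)).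
  rewrite E; have d2 : is_derive (0 : R) 1 (fun h => k * h + (x 0 j - x0 0 j)) k.
    by apply: is_derive_eq; rewrite addr0 /GRing.scale/= mulr1.
  have := @is_derive1_comp R F (fun h => k * h + (x 0 j - x0 0 j)) 0 _ _ (dF _) d2.
  by rewrite mulr0 add0r mulrC.
have [d11 d12] := d1; split.
  by rewrite -[x]addr0 -(scale0r (unit_vec R i)) derivable_line.
by rewrite -{1}[x]addr0 -(scale0r (unit_vec R i)) derive_line.
Qed.

Lemma pit_partial i x : partial pit i x = 2 * pi * sin (2 * pi * (x 0 i - x0 0 i)).
Proof.
have dw (t : R) : is_derive t 1 (@well R) (2 * pi * sin (2 * pi * t)).
  have d2 : is_derive t 1 (fun t : R => 2 * pi * t) (2 * pi).
    by apply: is_derive_eq; rewrite /GRing.scale/= mulr1.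
  have d3 := @is_derive1_comp R cos (fun t => 2 * pi * t) t _ _ (is_derive_cos _) d2.
  have -> : @well R = cst 1 - (cos \o (fun t => 2 * pi * t)) by exact/funext.
  by apply: is_derive_eq; rewrite sub0r mulNr opprK mulrC.
have [_] := is_derive_sum (fun j => partial_coord i j x dw).
rewrite /partial fct_sumE => ->; rewrite (bigD1 i)//= eqxx mul1r big1 ?addr0// => j /negbTE ->.
by rewrite mul0r.
Qed.

Lemma tilt_partial p i x : partial (tilt p) i x = p 0 i * cos (2 * pi * (x 0 i - x0 0 i)).
Proof.
have dw (j : 'I_d) (t : R) : is_derive t 1 (fun t => p 0 j * tooth t) (p 0 j * cos (2 * pi * t)).
  have d2 : is_derive t 1 (fun t : R => 2 * pi * t) (2 * pi).
    by apply: is_derive_eq; rewrite /GRing.scale/= mulr1.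
  have d3 := @is_derive1_comp R sin (fun t => 2 * pi * t) t _ _ (is_derive_sin _) d2.
  have -> : (fun t => p 0 j * tooth t) = (p 0 j / (2 * pi)) \*: (sin \o (fun t => 2 * pi * t)).
    by apply/funext => r; rewrite /tooth /= /GRing.scale/=; ring.
  have pn : pi != 0 :> R by rewrite gt_eqF// pi_gt0.
  suff <- : (p 0 j / (2 * pi)) *: (cos (2 * pi * t) * (2 * pi)) = p 0 j * cos (2 * pi * t).
    exact: is_deriveZ.
  by rewrite /GRing.scale/=; move: (cos _) => co; move: (@pi R) pn => q qn; field.
have [_] := is_derive_sum (fun j => partial_coord i j x (dw j)).
rewrite /partial fct_sumE => ->; rewrite (bigD1 i)//= eqxx mul1r big1 ?addr0// => j /negbTE ->.
by rewrite mul0r.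
Qed.

End charts.

(** * Uniform differentiability at one point and one scale *)

Section cells.
Context (R : realType) (d : nat).
Local Notation X := 'rV[R]_d.
Local Notation mu := (torus_measure R d).

(** A small value of pit forces every coordinate to be near an integer; subtracting
these integers reduces periodic assertions to points near x0. *)
Lemma pit_close (x0 x : X) (r : R) : 0 <= r -> r <= 1 -> pit x0 x < r ^+ 2 ->
  exists w : X, (forall i, 2 * `|w 0 i| <= r) /\
    forall (T : Type) (g : X -> T), Zd_periodic g -> g x = g (x0 + w).
Proof.
move=> r0 r1 px; pose k i : int := Num.floor (x 0 i - x0 0 i + 2^-1).
pose w : X := \row_i (x 0 i - x0 0 i - (k i)%:~R).
have gw (T : Type) (g : X -> T) : Zd_periodic g -> g x = g (x0 + w).
  move=> pg; rewrite -[RHS](periodic_int k _ pg); congr g.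
  by apply/rowP => i; rewrite !mxE; ring.
exists w; split => // i.
have pw := gw _ _ (trig_periodic (pit_trig x0)).
have wi : well (w 0 i) < r ^+ 2.
  apply: le_lt_trans px; rewrite pw /pit (bigD1 i)//= [(x0 + w) 0 i]mxE [_ + w 0 i]addrC addrK lerDl.
  by apply: sumr_ge0 => j _; exact: well_ge0.

have w2 : `|w 0 i| <= 2^-1.
  rewrite mxE; have /andP[f1 f2] := real_floor_itv (num_real (x 0 i - x0 0 i + 2^-1)).
  move: f2; rewrite intrD -/(k i) => f2; move: f1; rewrite -/(k i) => f1.
  by rewrite ler_norml; apply/andP; split; lra.
have w1 : well (w 0 i) < 1 by apply: (lt_le_trans wi); rewrite expr_le1.
have := le_lt_trans (well_ge w2 w1) wi.
rewrite -(@ler_pXn2r _ 2) ?nnegrE ?mulr_ge0// exprMn real_normK ?num_real//.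
by move=> /ltW; congr (_ <= _); congr (_ * _); rewrite -natrX.
Qed.

Variables (v : X -> R) (G : 'I_d -> X -> R).
Hypotheses (pv : pintg v) (vG : forall i, weak_partial i v (G i)).
Variables (O : set X) (L : R) (oO : open O) (pO : Zd_periodic O) (L0 : 0 <= L)
  (OL : forall i, {ae mu, forall x, O x -> `|G i x| <= L}).
Variables (A : set X) (eta : R) (mA : measurable A) (eta0 : 0 < eta)
  (AO : forall x y, A x -> `|y| < eta -> O (x + y)).

(** The Lipschitz bound holds, for each y, for almost every x; by ae_swap it holds,
for almost every x, for almost every y, the base point x being then fixed. *)
Lemma lip_box (c : X) (kap : R) : 2 * `|c| < eta -> 0 <= kap -> 2 * (d%:R * kap) < eta ->
  {ae mu, forall x, A x -> {ae mu, forall y : X, (forall i, 0 <= y 0 i <= kap) ->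
    `|v (x + c + y) - v (x + c)| <= d%:R * kap * L}}.
Proof.
move=> c_eta k0 k_eta; set K := d%:R * kap * L.
pose box : set X := [set y | forall i, 0 <= y 0 i <= kap].
have mbox : measurable box.
  rewrite (_ : box = \bigcap_i (coord i @^-1` `[0, kap])).
    apply: fin_bigcap_measurable => // i _.
    by rewrite -[X in measurable X]setTI; apply: measurable_coord => //; exact: measurable_itv.
  apply/seteqP; split => y /= h i; first by move=> _; rewrite /= in_itv/=; exact: h.
  by have := h i I; rewrite /= in_itv.
pose F (z : X * X) : R := \1_A z.1 * (\1_box z.2 * Num.max (`|v (z.1 + c + z.2) - v (z.1 + c)| - K) 0).
have mv := intg_meas pv.2.
have madd : measurable_fun setT (fun z : X * X => z.1 + c + z.2).
  apply: measurable_coordP => i; rewrite /comp /coord.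
  under eq_fun do rewrite !mxE.
  apply: measurable_funD; last exact: (measurableT_comp (@measurable_coord R d i) measurable_snd).
  by apply: measurable_funD => //; exact: (measurableT_comp (@measurable_coord R d i) measurable_fst).
have mF : measurable_fun setT F.
  apply: measurable_funM; first exact: (measurableT_comp (@measurable_indic _ _ _ _ _ mA) measurable_fst).
  apply: measurable_funM; first exact: (measurableT_comp (@measurable_indic _ _ _ _ _ mbox) measurable_snd).
  apply: measurable_maxr => //; apply: measurable_funB => //; apply: measurableT_comp => //.
  apply: measurable_funB; first exact: (measurableT_comp mv madd).
  exact: (measurableT_comp (measurableT_comp mv (measurable_shift c)) measurable_fst).
have F0 z : 0 <= F z.
  by rewrite /F !mulr_ge0// ?indicE// le_max lexx orbT.
have sw : {ae mu, forall x, {ae mu, forall y, F (x, y) = 0}}.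
  apply: (ae_swap mF F0); apply: aeW => y.
  have [By|nBy] := pselect (box y); last first.
    by apply: aeW => x; rewrite /F/= [X in _ * (X * _)]indicE memNset// mul0r mulr0.
  pose B : set X := [set z | forall u : X, 2 * `|u| < eta -> O (z + u)].
  have yk : `|y| <= kap.
    rewrite [leLHS]mx_normrE; apply/bigmax_leP; split => //= -[a b] _ /=.
    by rewrite (ord1 a); have /andP[y0 y1] := By b; rewrite ger0_norm.
  have lipB : {ae mu, forall x, B x -> `|v (x + y) - v x| <= d%:R * `|y| * L}.
    apply: (weak_lipschitz pv vG (measurable_open oO) pO L0 OL) => x z Bx zy; apply: Bx.
    apply: le_lt_trans k_eta; rewrite ler_pM2l//; apply: (le_trans zy).
    by rewrite ler_wpM2l.
  have pB : Zd_periodic (fun x => B x -> `|v (x + y) - v x| <= d%:R * `|y| * L).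
    move=> j x; rewrite [x + _ + y]addrAC !pv.1; congr (_ -> _).
    apply/propext; split=> h u /h; first by rewrite addrAC pO.
    by rewrite addrAC pO.
  have := ae_shift c pB lipB; apply: filterS => x lipx.
  rewrite /F/= !indicE (mem_set By) mul1r.
  have [/set_mem Ax|_] := boolP (x \in A); last by rewrite mul0r.
  rewrite mul1r max_r// subr_le0; apply: (@le_trans _ _ (d%:R * `|y| * L)).
    apply: lipx => u hu; rewrite -addrA; apply: AO => //.
    apply: (le_lt_trans (ler_normD _ _)); lra.
  by rewrite ler_wpM2r// ler_wpM2l.
apply: filterS sw => x hx Ax; apply: filterS hx => y; rewrite /F/= !indicE (mem_set Ax) mul1r => + By.
rewrite (mem_set (By : box y)) mul1r => /eqP.
by rewrite eq_maxr ?subr_le0.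
Qed.

(** At scale r, put a grid of finitely many directions h_j of mesh 1/n on the unit
cube. By weak_diff_vec the increments of v in these directions are affine up to
a small error in the mean, so for small r some point x0 of A is good for all of
them at once. Between the nodes the Lipschitz bound takes over, with an error
d L r / n. A finite grid replaces the countable dense set of directions of
Rademacher's theorem, because one scale is enough here. *)
Lemma rademacher_point (sigma rmax : R) : 0 < sigma -> 0 < rmax -> (0 < mu A)%E ->
  exists x0 r, [/\ A x0, 0 < r < rmax, r <= 1, forall i, `|G i x0| <= L &
    {ae mu, forall x, pit x0 x < r ^+ 2 ->
      `|v x - v x0 - tilt x0 (\row_i G i x0) x| <= sigma * r}].
Proof.
move=> s0 rm0 muA.
have a0 : 0 < fine (mu A).
  by rewrite fine_gt0// muA/= (le_lt_trans (probability_le1 _ mA))// ltry.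
(* with mesh 1 / n the Lipschitz error between nodes is at most sigma r / 4 *)
pose n := (Num.truncn (4 * (d%:R * L) / sigma)).+1.
have n0 : 0 < n%:R :> R by [].
have nL : d%:R * L / n%:R <= sigma / 4.
  rewrite ler_pdivrMr//.
  have q0 : 0 <= 4 * (d%:R * L) / sigma by rewrite divr_ge0 ?(ltW s0)// !mulr_ge0.
  have /andP[_ /ltW] := truncn_itv q0; rewrite -/n ler_pdivrMr// => h; lra.
pose I := {ffun 'I_d -> 'I_n.+1}.
pose h (j : I) : X := \row_i ((j i)%:R / n%:R - 2^-1).
have hn j : `|h j| <= 2^-1.
  rewrite [leLHS]mx_normrE; apply/bigmax_leP; split => [|[a b] _ /=]; first by rewrite invr_ge0.
  rewrite mxE ler_norml; have jn : (j b)%:R / n%:R <= 1 :> R.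
    by rewrite ler_pdivrMr// mul1r ler_nat -ltnS.
  have j0 : 0 <= (j b)%:R / n%:R :> R by rewrite divr_ge0.
  by apply/andP; split; lra.
(* small enough for the errors to be summed over the grid and compared with mu A *)
pose eps := sigma / 4 * fine (mu A) / (#|I|.+1)%:R.
have eps0 : 0 < eps by rewrite !mulr_gt0// invr_gt0.
have near_j (j : I) := weak_diff_vec pv vG (h j) eps0.
have near0 : \forall t \near (0 : R), forall j : I,
    \int[mu]_x `|v (x + t *: h j) - v x - t * \sum_i h j 0 i * G i x| <= eps * `|t|.
  exact: (@filter_forall R I (fun j t =>
    \int[mu]_x `|v (x + t *: h j) - v x - t * \sum_i h j 0 i * G i x| <= eps * `|t|)
    (nbhs (0 : R)) (nbhs_filter _) near_j).
have /nbhs_ballP[rho /= rho0 hrho] := near0.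
have dp : 0 < 2 * (d%:R + 1) :> R by rewrite mulr_gt0// ltr_wpDl.
have Lp : 0 < 128 * (d%:R * L + 1) by rewrite mulr_gt0// ltr_wpDl// mulr_ge0.
(* the last bound on r absorbs the cubic error of tooth *)
have [r [/andP[r0 rrho] rrm r1 reta rL]] : exists r, [/\ 0 < r < rho, r < rmax, 2 * r <= 1, 2 * (d%:R + 1) * r < eta &
    128 * (d%:R * L + 1) * r <= sigma].
  pose m := Num.min rho (Num.min rmax (Num.min 1 (Num.min (eta / (2 * (d%:R + 1))) (sigma / (128 * (d%:R * L + 1)))))).
  have m0 : 0 < m by rewrite !lt_min rho0 rm0 ltr01 !divr_gt0.
  have lem x : m <= x -> m / 2 < x.
    by move=> mx; rewrite (lt_le_trans _ mx)// ltr_pdivrMr// mulr2n mulrDr mulr1 ltrDl.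
  have m5 : m <= sigma / (128 * (d%:R * L + 1)) by rewrite !ge_min lexx !orbT.
  have m4 : m <= eta / (2 * (d%:R + 1)) by rewrite !ge_min lexx !orbT.
  exists (m / 2); split.
  - by rewrite divr_gt0//=; apply: lem; rewrite ge_min lexx.
  - by apply: lem; rewrite !ge_min lexx !orbT.
  - by rewrite mulrC divfK// !ge_min lexx !orbT.
  - by have := lem _ m4; rewrite ltr_pdivlMr// mulrC.
  - by have := ltW (lem _ m5); rewrite ler_pdivlMr// mulrC.
pose E x := \sum_(j : I) `|v (x + r *: h j) - v x - r * \sum_i h j 0 i * G i x|.
have iE j : intg mu (fun x => `|v (x + r *: h j) - v x - r * \sum_i h j 0 i * G i x|).
  apply/intg_norm/intgB; last by apply/intgZ/intg_sum => i; exact/intgZ/(vG i).1.2.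
  by apply: intgB; [apply: intg_shift; [exact: pv.1|exact: pv.2]|exact: pv.2].
have ltE : \int[mu]_x E x < sigma / 4 * r * fine (mu A).
  rewrite /E Int_sum//; apply: (@le_lt_trans _ _ (\sum_(j : I) eps * r)).
    apply: ler_sum => j _; have := hrho r _ j; rewrite (gtr0_norm r0); apply.
    by rewrite /ball/= sub0r normrN gtr0_norm.
  rewrite sumr_const -[ltLHS]mulr_natr /eps.
  set K := (X in _ * X%:R < _); have -> : sigma / 4 * fine (mu A) / (#|I|.+1)%:R * r * K%:R =
     (sigma / 4 * r * fine (mu A)) * (K%:R / (#|I|.+1)%:R).
    by ring.
  rewrite gtr_pMr ?mulr_gt0 ?divr_gt0// ltr_pdivrMr// mul1r ltr_nat ltnS.
  by rewrite /K.
pose kap := r / n%:R.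
have k0 : 0 <= kap by rewrite divr_ge0// ltW.
have kr : kap <= r by rewrite ler_pdivrMr// ler_peMr ?(ltW r0)// ler1n.
have d0 : 0 <= d%:R :> R by [].

have alip : {ae mu, forall x, forall j : I, A x -> {ae mu, forall y : X, (forall i, 0 <= y 0 i <= kap) ->
    `|v (x + r *: h j + y) - v (x + r *: h j)| <= d%:R * kap * L}}.
  apply: filter_forall => j; apply: lip_box => //; last by nra.
  rewrite normrZ (gtr0_norm r0); have := hn j; nra.
have aG : {ae mu, forall x, forall i, O x -> `|G i x| <= L} by exact: filter_forall.
have [x0 [Ax0 [lipx Gx0] Ex0]] := good_point mA (intg_sum _ iE : intg mu E)
  (fun x => sumr_ge0 _ (fun j _ => normr_ge0 _)) ltE (filterI alip aG).
exists x0, r.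
have Ox0 : O x0 by rewrite -[x0]addr0; apply: AO; rewrite ?normr0.
have GL i : `|G i x0| <= L by exact: Gx0.
split => //; [by rewrite r0|lra|].

pose P j (y : X) := (forall i, 0 <= y 0 i <= kap) ->
    `|v (x0 + r *: h j + y) - v (x0 + r *: h j)| <= d%:R * kap * L.
have aS : {ae mu, forall x, forall j : I, P j (frac (x - (x0 + r *: h j)))}.
  apply: filter_forall => j.
  apply: (ae_shift (S := fun x => P j (frac x)) (- (x0 + r *: h j))).
    by move=> i x; rewrite frac_periodic.
  by apply: filterS2 (lipx j Ax0) (ae_frac R d) => y Py ->.
apply: filterS aS => x Sx px.
clear near_j near0 hrho iE ltE lipx Gx0 alip aG eps0 Lp dp muA a0 hn rrho rrm reta.
have [w [wr gw]] := pit_close (ltW r0) (ltac:(lra) : r <= 1) px.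
(* j is the node below w / r, coordinate by coordinate *)
pose t i := (w 0 i / r + 2^-1) * n%:R.
have wb i : - (r / 2) <= w 0 i <= r / 2.
  have := wr i; have := ler_norm (w 0 i); have := ler_normr (- w 0 i) (w 0 i).
  have := ler_norm (- w 0 i); rewrite normrN => ? _ ? ?; apply/andP; split; lra.
have rn : r != 0 by rewrite gt_eqF.
have t0 i : 0 <= t i.
  have /andP[b1 b2] := wb i; rewrite mulr_ge0// -(@pmulr_lge0 _ r)// mulrDl divfK//; lra.
have tn i : t i <= n%:R.
  have /andP[b1 b2] := wb i; rewrite ler_piMl// -(@ler_pM2r _ r)// mulrDl divfK//; lra.
pose j : I := [ffun i => inord (Num.truncn (t i))].
have jt i : (j i)%:R <= t i < (j i)%:R + 1.
  have := truncn_itv (t0 i); rewrite ffunE inordK ?natr1//.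
  have /andP[h1 _] := truncn_itv (t0 i).
  by rewrite ltnS -(ler_nat R) (le_trans h1).
have yE i : (w - r *: h j) 0 i = kap * (t i - (j i)%:R).
  by rewrite /kap /t !mxE; field; rewrite rn gt_eqF.
have yb i : 0 <= (w - r *: h j) 0 i <= kap.
  have /andP[j1 j2] := jt i; rewrite yE mulr_ge0 ?subr_ge0//= ler_piMr//; lra.
have fy : frac (w - r *: h j) = w - r *: h j.
  apply/rowP => i; rewrite mxE; have -> : Num.floor ((w - r *: h j) 0 i) = 0.
    have /andP[y1 y2] := yb i; apply/floor_def; rewrite y1 add0r; lra.
  by rewrite subr0.
have := gw _ (fun x => P j (frac (x - (x0 + r *: h j)))) _.
have -> : x0 + w - (x0 + r *: h j) = w - r *: h j by rewrite opprD addrACA subrr add0r.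
rewrite fy => gP.
have Py : P j (w - r *: h j).
  by rewrite -gP; [exact: Sx|move=> i z; rewrite addrAC frac_periodic].
have {Py} h1 := Py yb.
have Exj : x0 + r *: h j + (w - r *: h j) = x0 + w by rewrite addrAC addrA subrK.
rewrite Exj in h1.
have h2 : `|v (x0 + r *: h j) - v x0 - r * \sum_i h j 0 i * G i x0| <= sigma / 4 * r.
  apply: le_trans (ltW Ex0); rewrite /E (bigD1 j)//= lerDl.
  by apply: sumr_ge0 => ? _.
have h3 : `|\sum_i G i x0 * (r * h j 0 i - w 0 i)| <= d%:R * kap * L.
  apply: (le_trans (ler_norm_sum _ _ _)); apply: (@le_trans _ _ (\sum_(i < d) L * kap)).
    apply: ler_sum => i _; rewrite normrM; apply: ler_pM => //.
    have /andP[y1 y2] := yb i; rewrite distrC ger0_norm; move: y1 y2; rewrite !mxE //.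
  by rewrite sumr_const card_ord -mulr_natl; lra.
have h4 : `|\sum_i G i x0 * (w 0 i - tooth (w 0 i))| <= sigma / 4 * r.
  apply: (le_trans (ler_norm_sum _ _ _)); apply: (@le_trans _ _ (\sum_(i < d) L * (32 * r ^+ 2))).
    apply: ler_sum => i _; rewrite normrM; apply: ler_pM => //.
    rewrite distrC; apply: (le_trans (tooth_near _)); rewrite ler_wpM2l//.
    have wi := wr i; have w0 := normr_ge0 (w 0 i); rewrite exprS.
    have wi2 : `|w 0 i| <= r by lra.
    apply: (@le_trans _ _ (1 * `|w 0 i| ^+ 2)); first by rewrite ler_wpM2r ?sqr_ge0//; lra.
    by rewrite mul1r lerXn2r ?nnegrE// ltW.
  rewrite sumr_const card_ord -mulr_natl.
  have dL : 0 <= d%:R * L by rewrite mulr_ge0.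
  have := mulr_ge0 dL (ltW r0); nra.
have kL : d%:R * kap * L <= sigma / 4 * r.
  by have := ler_wpM2r (ltW r0) nL; rewrite /kap; congr (_ <= _); ring.
rewrite (gw _ v pv.1) (gw _ _ (trig_periodic (tilt_trig x0 _))).
have -> : v (x0 + w) - v x0 - tilt x0 (\row_i G i x0) (x0 + w) =
   (v (x0 + w) - v (x0 + r *: h j)) + ((v (x0 + r *: h j) - v x0 - r * \sum_i h j 0 i * G i x0) +
   (\sum_i G i x0 * (r * h j 0 i - w 0 i) + \sum_i G i x0 * (w 0 i - tooth (w 0 i)))).
  have -> : \sum_i G i x0 * (r * h j 0 i - w 0 i) + \sum_i G i x0 * (w 0 i - tooth (w 0 i)) =
      r * (\sum_i h j 0 i * G i x0) - tilt x0 (\row_i G i x0) (x0 + w).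
    rewrite -big_split mulr_sumr /tilt -sumrB; apply: eq_bigr => i _ /=.
    by rewrite [(\row_i G i x0) 0 i]mxE [(x0 + w) 0 i]mxE [x0 0 i + _]addrC addrK; ring.
  ring.
apply: (le_trans (ler_normD _ _)).
have -> : sigma * r = sigma / 4 * r + (sigma / 4 * r + (sigma / 4 * r + sigma / 4 * r)) by field.
apply: lerD; first exact: le_trans kL.
apply: (le_trans (ler_normD _ _)); apply: lerD => //.
by apply: (le_trans (ler_normD _ _)); apply: lerD => //; exact: le_trans kL.
Qed.

End cells.

(** * Raising a strict subsolution *)

Section improvement.
Context (R : realType) (d : nat).
Local Notation X := 'rV[R]_d.
Local Notation mu := (torus_measure R d).
Local Notation e_ i := (unit_vec R i).
Variables (v : X -> R) (G : 'I_d -> X -> R).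
Hypotheses (pv : pintg v) (vG : forall i, weak_partial i v (G i)).
Variables (O : set X) (L : R) (oO : open O) (pO : Zd_periodic O) (L0 : 0 <= L)
  (OL : forall i, {ae mu, forall x, O x -> `|G i x| <= L}).
Variables (A : set X) (eta : R) (mA : measurable A) (eta0 : 0 < eta)
  (AO : forall x y, A x -> `|y| < eta -> O (x + y)) (muA : (0 < mu A)%E).
Variables (W : X -> set X) (pW : Zd_periodic W).
Hypothesis AW : forall x y (p : X), A x -> `|y| < eta ->
  (forall i, `|p 0 i - G i x| < eta) -> W (x + y) p.

(** The raised function is v + w. The data are: the set W x of admissible gradients
at x, an open set O where v has bounded gradient, and a non-null set A on which
the gradient of v lies in W with a margin eta, uniformly. Then w is the bump of
z = phi - v, and the gradient of v + w is the convex combination of that of v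
and P, the gradient of phi, with weight theta. *)
Lemma local_improvement : exists (w theta : X -> R) (P : X -> X),
  [/\ pintg w, exists M : R, {ae mu, forall x, 0 <= w x <= M}, 0 < \int[mu]_x w x,
    forall i, weak_partial i w (fun x => theta x * (P x 0 i - G i x)) /\
      exists M : R, {ae mu, forall x, `|theta x * (P x 0 i - G i x)| <= M} &
    {ae mu, forall x, [/\ 0 <= theta x <= 1, theta x != 0 -> W x (P x) &
      ~ O x -> w x = 0 /\ theta x = 0]}].
Proof.
(* on B the slope of K pit is at most 32 K r = 512 delta = eta / 8 *)
pose delta := eta / 64 / 64.
have de0 : 0 < delta by rewrite !divr_gt0.
have s0 : 0 < delta / 2 by rewrite divr_gt0.
pose rmax := eta / (64 * (L + 1)).
have L1 : 0 < 64 * (L + 1) by rewrite mulr_gt0// ltr_wpDl.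
have rm0 : 0 < rmax by rewrite divr_gt0.
have [x0 [r [Ax0 /andP[r0 rrm] r1 GL hv]]] := rademacher_point pv vG oO pO L0 OL mA eta0 AO s0 rm0 muA.
have rL : 64 * (L + 1) * r < eta by move: rrm; rewrite ltr_pdivlMr// mulrC.
have r64 : 64 * r < eta.
  by apply: le_lt_trans rL; rewrite ler_wpM2r ?(ltW r0)// ler_peMr// lerDr.
pose p0 : X := \row_i G i x0.
(* K r^2 / 4 = 4 delta r, so phi is below v as soon as pit >= r^2 / 4 *)
pose K := 16 * delta / r.
have K0 : 0 < K by rewrite divr_gt0// mulr_gt0.
have Kr : K * r = 16 * delta by rewrite divfK// gt_eqF.
pose c0 := v x0 + delta * r.
pose phi (x : X) : R := - K * pit x0 x + (1 * tilt x0 p0 x + c0).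
pose P x : X := \row_i (- K * partial (pit x0) i x + (1 * partial (tilt x0 p0) i x + 0)).
have tphi : trig phi.
  apply: trig_add; first by apply: trig_mul; [exact: trig_cst|exact: pit_trig].
  by apply: trig_add; [apply: trig_mul; [exact: trig_cst|exact: tilt_trig]|exact: trig_cst].
have ptr (T : X -> R) : trig T -> pintg T by move=> tT; split; [exact: trig_periodic|exact: trig_intg].
have phiP i : weak_partial i phi (fun x => P x 0 i).
  have := weak_partial_lin (- K) (ptr _ (pit_trig x0)) _ (trig_weak_partial i (pit_trig x0))
    (weak_partial_lin 1 (ptr _ (tilt_trig x0 p0)) (ptr _ (trig_cst d c0)) (trig_weak_partial i (tilt_trig x0 p0)) (weak_partial_cst c0 i)).
  have -> : (fun x => P x 0 i) = (fun x => - K * partial (pit x0) i x + (1 * partial (tilt x0 p0) i x + 0)).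
    by apply/funext => x; rewrite mxE.
  apply; apply: ptr; apply: trig_add; [apply: trig_mul; [exact: trig_cst|exact: tilt_trig]|exact: trig_cst].
have tP i : trig (fun x => P x 0 i).
  have -> : (fun x => P x 0 i) = (fun x => - K * partial (pit x0) i x + (1 * partial (tilt x0 p0) i x + 0)).
    by apply/funext => x; rewrite mxE.
  apply: trig_add; first by apply: trig_mul; [exact: trig_cst|exact/trig_partial/pit_trig].
  by apply: trig_add; [apply: trig_mul; [exact: trig_cst|exact/trig_partial/tilt_trig]|exact: trig_cst].
have pP : Zd_periodic P.
  by move=> j x; apply/rowP => i; exact: (trig_periodic (tP i) j x).
pose z (x : X) : R := -1 * v x + phi x.
have pz : pintg z by apply: pintgD; [exact: pintgZ|exact: ptr].
have zG i : weak_partial i z (fun x => P x 0 i - G i x).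
  have := weak_partial_lin (-1) pv (ptr _ tphi) (vG i) (phiP i).
  by congr (weak_partial i _ _); apply/funext => x; ring.
pose B : set X := [set x | pit x0 x < r ^+ 2].
have mB : measurable B.
  rewrite (_ : B = pit x0 @^-1` `]-oo, r ^+ 2[).
    rewrite -[X in measurable X]setTI; apply: (trig_measurable (pit_trig x0)) => //.
  by apply/seteqP; split => x; rewrite /= in_itv.
have pB : Zd_periodic B by move=> j x; rewrite /B/= (trig_periodic (pit_trig x0)).
have BO (w : X) : (forall i, 2 * `|w 0 i| <= r) -> forall (u : X), 2 * `|u| < eta -> O (x0 + w + u).
  move=> hw u hu; rewrite -addrA; apply: AO => //.
  have nw : `|w| <= r / 2.
    rewrite [leLHS]mx_normrE; apply/bigmax_leP; split => [|[a b] _ /=]; first by rewrite divr_ge0// ltW.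
    by rewrite (ord1 a); have := hw b; lra.
  apply: (le_lt_trans (ler_normD _ _)); lra.
have Bu x (u : X) : B x -> 2 * `|u| < eta -> O (x + u).
  move=> Bx hu; have [w [hw gw]] := pit_close (ltW r0) r1 Bx.
  have -> : O (x + u) = O (x0 + w + u).
    by apply: (gw _ (fun x => O (x + u))) => j y; rewrite addrAC pO.
  exact: BO hw u hu.
have BOx x : B x -> O x by move=> Bx; rewrite -[x]addr0; apply: Bu => //; rewrite normr0 mulr0.
have BW x : B x -> W x (P x).
  move=> Bx; have [w [hw gw]] := pit_close (ltW r0) r1 Bx.
  have -> : W x (P x) = W (x0 + w) (P (x0 + w)).
    by apply: (gw _ (fun x => W x (P x))) => j y; rewrite pW pP.
  apply: AW => // [|i].
    have nw : `|w| <= r / 2.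
      rewrite [leLHS]mx_normrE; apply/bigmax_leP; split => [|[a b] _ /=]; first by rewrite divr_ge0// ltW.
      by rewrite (ord1 a); have := hw b; lra.
    lra.
  rewrite mxE pit_partial tilt_partial [(x0 + w) 0 i]mxE [x0 0 i + _]addrC addrK mul1r addr0.
  rewrite [p0 0 i]mxE.
  have -> : - K * (2 * pi * sin (2 * pi * w 0 i)) + G i x0 * cos (2 * pi * w 0 i) - G i x0 =
     - (K * (2 * pi * sin (2 * pi * w 0 i)) + G i x0 * well (w 0 i)) by rewrite /well; ring.
  rewrite normrN; apply: (le_lt_trans (ler_normD _ _)).
  rewrite (normrM K) (gtr0_norm K0) (normrM (G i x0)) (ger0_norm (well_ge0 _)).
  have e1 : K * `|2 * pi * sin (2 * pi * w 0 i)| <= eta / 8.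
    apply: (@le_trans _ _ (K * (64 * `|w 0 i|))).
      by rewrite ler_wpM2l ?(ltW K0)//; exact: well_slope.
    apply: (@le_trans _ _ (K * (32 * r))).
      by rewrite ler_wpM2l ?(ltW K0)//; have := hw i; lra.
    by rewrite mulrCA Kr /delta; lra.
  have e2 : `|G i x0| * well (w 0 i) <= eta / 8.
    apply: (@le_trans _ _ (L * (8 * r))).
      apply: ler_pM => //; first exact: well_ge0.
      apply: (le_trans (well_le _)).
      have w0 := normr_ge0 (w 0 i); have hwi := hw i; rewrite -real_normK ?num_real//.
      apply: (@le_trans _ _ (32 * (r / 2 * (1 / 2)))); last lra.
      by rewrite ler_wpM2l// expr2; apply: ler_pM => //; lra.
    nra.
  lra.
have zB : {ae mu, forall x, B x -> [/\ z x <= 2 * delta * r, r ^+ 2 / 4 <= pit x0 x -> z x <= 0 &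
    pit x0 x < r ^+ 2 / 64 -> 0 < z x]}.
  apply: filterS hv => x hx Bx; have := hx Bx; rewrite ler_norml -/p0 => /andP[h1 h2].
  have zE : z x = delta * r - (v x - v x0 - tilt x0 p0 x) - K * pit x0 x by rewrite /z /phi /c0; ring.
  have pt0 : 0 <= pit x0 x by apply: sumr_ge0 => i _; exact: well_ge0.
  have Kp := mulr_ge0 (ltW K0) pt0.
  have dr := mulr_gt0 de0 r0.
  have Kr2 : K * r ^+ 2 = 16 * (delta * r) by rewrite expr2 [K * _]mulrA Kr -mulrA.
  split; rewrite zE; [lra| |] => hp.
    have : K * (r ^+ 2 / 4) <= K * pit x0 x by rewrite ler_wpM2l// ltW.
    rewrite [K * (_ / _)]mulrA Kr2; lra.
  have : K * pit x0 x < K * (r ^+ 2 / 64) by rewrite ltr_pM2l.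
  rewrite [K * (_ / _)]mulrA Kr2; lra.
pose c := 2 * delta * r.
have c00 : 0 < c by rewrite !mulr_gt0.
have zc : {ae mu, forall x, B x -> z x <= c} by apply: filterS zB => x h /h[].
pose w := bump z c B; pose theta := bump_rate z c B.
have [bw bt] := bump_bound c00 zc.
exists w, theta, P; split.
- exact: bump_pintg.
- by exists c.
- rewrite ltNge; apply/negP => Iw.
  have [pw iw] := bump_pintg pz c00 mB pB zc.
  have w0 : {ae mu, forall x, w x = 0}.
    by apply: Int_eq0 => //; apply: filterS bw => x /andP[].
  have out : {ae mu, forall x, ~ pit x0 x < r ^+ 2 / 64}.
    apply: filterS2 w0 zB => x wx zx px.
    have Bx : B x by apply: (lt_trans px); rewrite ltr_pdivrMr// ltr_pMr ?exprn_gt0// ltr1n.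
    have [_ _ /(_ px) zp] := zx Bx.
    move: wx; rewrite /w /bump indicE (mem_set Bx) mul1r (max_l (ltW zp)) => /eqP.
    by rewrite mulf_eq0 invr_eq0 sqrf_eq0 !gt_eqF// mulr_gt0.
  have out0 : {ae mu, forall x, ~ pit x0 (x + x0) < r ^+ 2 / 64}.
    by apply: (ae_shift x0 _ out) => j x; rewrite (trig_periodic (pit_trig x0)).
  have near_pit : \forall x \near (0 : X), pit x0 (x + x0) < r ^+ 2 / 64.
    have ct : (fun x => pit x0 (x + x0)) @ (0 : X) --> (pit x0 (0 + x0)).
      exact: (trig_continuous (trig_shift x0 (pit_trig x0))).
    have : pit x0 (0 + x0) < r ^+ 2 / 64.
      rewrite add0r /pit big1 ?divr_gt0 ?exprn_gt0// => i _.
      by rewrite subrr /well mulr0 cos0 subrr.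
    by move=> h; apply: (cvgr_lt _ ct _ h).
  by have [x [h1 h2]] := near0_ae out0 near_pit.
- move=> i.
  have [Mp Mp0 pl] := trig_lip i (pit_trig x0).
  have [Mf Mf0 fl] := trig_lip i tphi.
  (* a step shorter than h0 changes pit by at most r^2 / 2: if it crosses the
     boundary of B, both ends have pit >= r^2 / 4, where z <= 0 *)
  pose h0 := Num.min (r ^+ 2 / (2 * (Mp + 1))) (eta / 2).
  have Mp1 : 0 < 2 * (Mp + 1) by rewrite mulr_gt0// ltr_wpDl.
  have h00 : 0 < h0 by rewrite lt_min !divr_gt0// exprn_gt0.
  have hs h : 0 < h -> h < h0 -> 2 * h < eta /\ Mp * h <= r ^+ 2 / 2.
    rewrite lt_min ltr_pdivlMr// => hp /andP[h1 h2]; split; first lra.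
    have : Mp * h <= (Mp + 1) * h by rewrite ler_wpM2r ?(ltW hp)// lerDl.
    lra.
  have zlip h : 0 < h -> h < h0 -> {ae mu, forall x, B x -> `|z (x + h *: e_ i) - z x| <= (L + Mf) * h}.
    move=> hp hh; have [h1 h2] := hs h hp hh.
    have : {ae mu, forall x, B x -> `|v (x + 0 + h *: e_ i) - v (x + 0)| <= L * `|h|}.
      apply: (weak_partial_lip pv vG (measurable_open oO) pO L0 OL) => x t Bx /andP[t0 t1].
      rewrite addr0; apply: Bu => //; apply: le_lt_trans h1; rewrite ler_wpM2l// normrZ.
      rewrite normrM (ger0_norm t0) (gtr0_norm hp) -[leRHS]mulr1.
      by apply: ler_pM => //; [rewrite mulr_ge0// ltW|rewrite ler_piMl// ltW|exact: norm_unit_vec].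
    apply: filterS => x hx Bx; have := hx Bx; rewrite addr0 (gtr0_norm hp) => vx.
    have -> : z (x + h *: e_ i) - z x = - (v (x + h *: e_ i) - v x) + (phi (x + h *: e_ i) - phi x).
      by rewrite /z; ring.
    apply: (le_trans (ler_normD _ _)); rewrite normrN mulrDl; apply: lerD => //.
    by have := fl x h; rewrite (gtr0_norm hp).
  have zout h : 0 < h -> h < h0 -> {ae mu, forall x, (B x -> ~ B (x + h *: e_ i) -> z x <= 0) /\
      (~ B x -> B (x + h *: e_ i) -> z (x + h *: e_ i) <= 0)}.
    move=> hp hh; have [h1 h2] := hs h hp hh.
    have zs : {ae mu, forall x, B (x + h *: e_ i) -> r ^+ 2 / 4 <= pit x0 (x + h *: e_ i) -> z (x + h *: e_ i) <= 0}.
      apply: (ae_shift (S := fun x => B x -> r ^+ 2 / 4 <= pit x0 x -> z x <= 0)).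
        by move=> j x; rewrite pB pz.1 (trig_periodic (pit_trig x0)).
      by apply: filterS zB => x hx Bx; have [] := hx Bx.
    have r2 : 0 < r ^+ 2 by rewrite exprn_gt0.
    apply: filterS2 zs zB => x zx1 zx2; split=> [Bx /negP|/negP nBx Bh].
      rewrite -leNgt => nBh; have [_ + _] := zx2 Bx; apply.
      by have := pl x h; rewrite (gtr0_norm hp) ler_norml => /andP[_]; lra.
    apply: zx1 => //; move: nBx; rewrite -leNgt => nBx.
    by have := pl x h; rewrite (gtr0_norm hp) ler_norml => /andP[]; lra.
  split.
    have LM : 0 <= L + Mf by rewrite addr_ge0.
    exact: (bump_weak_partial pz (zG i) c00 h00 mB pB LM zlip zout zc).
  have [MP PM] := trig_bounded (tP i).
  exists (MP + L); apply: filterS2 bt (OL i) => x /andP[t0 t1] GLx.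
  have MP0 : 0 <= MP by exact: le_trans (PM 0).
  rewrite normrM (ger0_norm t0); have [Bx|nBx] := pselect (B x); last first.
    by rewrite /bump_rate indicE memNset// mul0r mul0r addr_ge0.
  apply: (@le_trans _ _ (1 * `|P x 0 i - G i x|)); first by rewrite ler_wpM2r.
  rewrite mul1r; apply: (le_trans (ler_normB _ _)); apply: lerD => //.
  exact/GLx/BOx.
- apply: filterS bt => x t01; split => //.
    move=> tn; apply: BW; apply: contrapT => nBx; move: tn.
    by rewrite /theta /bump_rate indicE memNset// mul0r eqxx.
  move=> nO; have nB : ~ B x by move=> /BOx.
  by rewrite /w /theta /bump /bump_rate indicE memNset// !mul0r.
Qed.

End improvement.

(** * Strictly convex Hamiltonians and couplings *)

Lemma dotZ (R : realType) d (u w : 'rV[R]_d) a : dot u (a *: w) = a * dot u w.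
Proof. by rewrite /dot mulr_sumr; apply: eq_bigr => i _; rewrite mxE mulrCA. Qed.

Section hamiltonian.
Context (R : realType) (d : nat).
Local Notation X := 'rV[R]_d.
Local Notation e_ i := (unit_vec R i).
Variable H : X -> X -> R.
Hypothesis H_C1 : C1 (fun z : X * X => H z.1 z.2).
Hypothesis H_strictly_convex : forall x p0 p1 (t : R), p0 != p1 -> 0 < t -> t < 1 ->
    H x (t *: p0 + (1 - t) *: p1) < t * H x p0 + (1 - t) * H x p1.

Local Notation F := (fun z : X * X => H z.1 z.2).

Lemma H_continuous : continuous F.
Proof. by move=> z; apply: differentiable_continuous; exact: H_C1.1. Qed.

Lemma derive_pair x p v : 'D_((0, v) : X * X) F (x, p) = 'D_v (H x) p.
Proof.
rewrite /derive; suff -> : (fun h : R => h^-1 *: ((F \o shift (x, p)) (h *: ((0, v) : X * X)) - F (x, p))) =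
  (fun h : R => h^-1 *: ((H x \o shift p) (h *: v) - H x p)) by [].
by apply/funext => h /=; rewrite scaler0 add0r.
Qed.

Lemma DpH_coordE x p i : DpH H x p 0 i = 'd F (x, p) ((0, e_ i) : X * X).
Proof. by rewrite /DpH /gradient mxE /partial -derive_pair deriveE//; exact: H_C1.1. Qed.

Lemma DpH_coord_continuous i : continuous (fun z : X * X => DpH H z.1 z.2 0 i).
Proof.
have -> : (fun z : X * X => DpH H z.1 z.2 0 i) = (fun z => 'd F z ((0, e_ i) : X * X)).
  by apply/funext => -[x p]; rewrite DpH_coordE.
exact: H_C1.2.
Qed.

Lemma dot_DpH x p v : dot (DpH H x p) v = 'D_((0, v) : X * X) F (x, p).
Proof.
rewrite deriveE; last exact: H_C1.1.
have -> : ((0, v) : X * X) = \sum_i v 0 i *: ((0, e_ i) : X * X).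
  rewrite -[in LHS](row_sum_unit v); elim/big_ind2: _ => //.
    by move=> ? a ? b <- <-; congr (_, _); rewrite addr0.
  by move=> i _; congr (_, _); rewrite scaler0.
rewrite linear_sum /dot; apply: eq_bigr => i _.
by rewrite linearZ DpH_coordE mulrC.
Qed.

(** Difference quotients of a convex function decrease to the derivative. *)
Lemma convex_tangent_le x p v : dot (DpH H x p) v <= H x (p + v) - H x p.
Proof.
have [->|v0] := eqVneq v 0.
  by rewrite addr0 subrr /dot big1// => i _; rewrite [X in _ * X]mxE mulr0.
rewrite dot_DpH.
have dF : derivable F (x, p) ((0, v) : X * X) by apply: diff_derivable; exact: H_C1.1.
have /cvgr_dnbhsP/(_ (fun n => n.+1%:R^-1)) :
    (fun h : R => h^-1 *: ((F \o shift (x, p)) (h *: ((0, v) : X * X)) - F (x, p))) @ 0^' -->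
     'D_((0, v) : X * X) F (x, p) by exact: dF.
move=> hc; have {hc} := hc (conj (fun n => _) (@cvg_harmonic R)).
have hn n : n.+1%:R^-1 != 0 :> R by rewrite invr_eq0.
move=> /(_ hn) hc.
apply: (ler_cvg_to hc (cvg_cst (H x (p + v) - H x p))).
apply: nearW => n /=; rewrite scaler0 add0r.
set h : R := n.+1%:R^-1.
have h0 : 0 < h by rewrite invr_gt0.
have [n0|n0] := eqVneq n 0%N; first by rewrite /h n0 invr1 invr1 !scale1r [v + p]addrC.
have h1 : h < 1 by rewrite invf_lt1// ltr1n ltnS lt0n.
rewrite /GRing.scale/= mulrC ler_pdivrMr//.
have npv : p + v != p by rewrite -subr_eq0 addrC addKr.
have := H_strictly_convex x npv h0 h1.
have -> : h *: (p + v) + (1 - h) *: p = h *: v + p.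
  by rewrite scalerDr scalerBl scale1r addrC addrA subrK addrC.
move=> /ltW; lra.
Qed.

(** Apply convex_tangent_le at the midpoint, where convexity is strict. *)
Lemma strict_tangent x p q : p != q ->
  dot (DpH H x p) (q - p) < H x q - H x p.
Proof.
move=> pq; have h2 : 0 < 2^-1 :> R by [].
have h1 : (2^-1 : R) < 1 by rewrite invf_lt1// ltr1n.
have := H_strictly_convex x pq h2 h1.
have -> : 2^-1 *: p + (1 - 2^-1) *: q = p + 2^-1 *: (q - p).
  by apply/rowP => i; rewrite !mxE; lra.
have := convex_tangent_le x p (2^-1 *: (q - p)).
rewrite dotZ; lra.
Qed.

Lemma tangent_le x p q : dot (DpH H x p) (q - p) <= H x q - H x p.
Proof. by have := convex_tangent_le x p (q - p); rewrite addrCA subrr addr0. Qed.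

Lemma convex_le x p q (t : R) : 0 <= t <= 1 ->
  H x (p + t *: (q - p)) <= (1 - t) * H x p + t * H x q.
Proof.
move=> /andP[t0 t1]; have [<-|pq] := eqVneq p q.
  by rewrite subrr scaler0 addr0; lra.
move: t0; rewrite le_eqVlt => /predU1P[<-|t0]; first by rewrite scale0r addr0; lra.
move: t1; rewrite le_eqVlt => /predU1P[->|t1]; first by rewrite scale1r addrCA subrr addr0; lra.
have qp : q != p by rewrite eq_sym.
have -> : p + t *: (q - p) = t *: q + (1 - t) *: p by apply/rowP => i; rewrite !mxE; ring.
by have := ltW (H_strictly_convex x qp t0 t1); rewrite [leRHS]addrC.
Qed.

Hypothesis H_coercive : forall A : R, exists B : R, forall p : 'rV[R]_d, B < `|p| ->
    (A%:E < ereal_inf [set (H x p)%:E | x in [set: 'rV[R]_d]])%E.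

Lemma coercive_bound (A : R) : exists2 L : R, 0 <= L & forall x p, H x p <= A -> `|p| <= L.
Proof.
have [B HB] := H_coercive A; exists (Num.max B 0); first by rewrite le_max lexx orbT.
move=> x p Hp; rewrite le_max; apply/orP; left; rewrite leNgt; apply/negP => /HB.
apply/negP; rewrite -leNgt; apply: (@le_trans _ _ (H x p)%:E); last by rewrite lee_fin.
by apply: ereal_inf_lbound; exists x.
Qed.

(** The infimum is over a set bounded below: a convex function lies above its
tangent at 0, and its nonpositive values are taken in a bounded set. *)
Lemma Hmin_le x p : Hmin H x <= H x p.
Proof.
have [L L0 HL] := coercive_bound 0.
apply: inf_lbound; last by exists p.
exists (Num.min 0 (H x 0 - L * \sum_i `|DpH H x 0 0 i|)) => _ [q _ <-].
have [q0|/ltW q0] := leP (H x q) 0; last by rewrite ge_min q0.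
rewrite ge_min; apply/orP; right.
have := tangent_le x 0 q; rewrite subr0 => h; rewrite lerBlDr -lerBlDl.
have : - dot (DpH H x 0) q <= L * \sum_i `|DpH H x 0 0 i|.
  apply: (le_trans (ler_norm _)); rewrite normrN; apply: (le_trans (ler_norm_sum _ _ _)).
  rewrite mulr_sumr; apply: ler_sum => i _; rewrite normrM mulrC ler_wpM2r//.
  exact: le_trans (norm_coord _ _) (HL _ _ q0).
lra.
Qed.

(** The midpoint of two distinct minimisers would have a smaller value. *)
Lemma minimizer_unique x p q (a : R) : a <= Hmin H x -> H x p <= a -> H x q <= a -> p = q.
Proof.
move=> aH Hp Hq; apply: contrapT => /eqP pq.
have h2 : 0 < 2^-1 :> R by [].
have h1 : (2^-1 : R) < 1 by rewrite invf_lt1// ltr1n.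
have := H_strictly_convex x pq h2 h1.
have := Hmin_le x (2^-1 *: p + (1 - 2^-1) *: q); lra.
Qed.

End hamiltonian.

Section coupling.
Context (R : realType) (d : nat).
Local Notation X := 'rV[R]_d.
Local Notation mu := (torus_measure R d).
Variables (f : X -> R -> R) (q : R).
Hypotheses (q1 : 1 < q)
  (f_continuous : {within [set z : 'rV[R]_d * R | 0 <= z.2], continuous (fun z => f z.1 z.2)}).

(** Densities are nonnegative only almost everywhere; composing with the positive
part gives a function that is continuous on the whole space, thus measurable
along any measurable density. *)
Lemma f_max_continuous : continuous (fun z : X * R => f z.1 (Num.max z.2 0)).
Proof.
move=> z; pose g (z : X * R) : X * R := (z.1, Num.max z.2 0).
have cg : continuous g.
  move=> y; apply: cvg_pair2; first exact: cvg_fst.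
  apply: (@continuous_max _ _ snd (cst 0) y); [exact: cvg_snd|exact: cvg_cst].
have gz y : 0 <= (g y).2 by rewrite /g/= le_max lexx orbT.
have /subspace_continuousP/(_ (g z) (gz z)) fz := f_continuous.
apply: (@cvg_comp _ _ _ g (fun z => f z.1 z.2) _ (within [set z | 0 <= z.2] (nbhs (g z))) _ _ fz).
move=> P; rewrite /within/= => gP.
have hz : nbhs z [set y | [set z | 0 <= z.2] (g y) -> P (g y)] := cg z _ gP.
have sz : [set y | [set z | 0 <= z.2] (g y) -> P (g y)] `<=` g @^-1` P by move=> y; apply; exact: gz.
exact: (filterS sz hz).
Qed.

Variable q' : R.
Hypotheses (q'0 : 0 < q') (qq' : q^-1 + q'^-1 = 1) (f_growth : exists2 C : R, 0 < C &
    forall x r, 0 <= r -> `|f x r| <= C * (1 + r `^ (q - 1))).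

Lemma coupling_meas (m : X -> R) : measurable_fun setT m ->
  measurable_fun setT (fun x => f x (Num.max (m x) 0)).
Proof.
move=> mm; have mid : measurable_fun setT (fun x : X => x) by exact: measurable_id.
exact: (measurable_comp2r f_max_continuous mid mm).
Qed.

(** The growth exponent satisfies (q - 1) q' = q. *)
Lemma coupling_Lpow (m : X -> R) : Lpow mu q m ->
  Lpow mu q' (fun x => f x (Num.max (m x) 0)).
Proof.
move=> [mm mi]; have [C C0 fC] := f_growth.
have q0 : 0 < q by apply: lt_trans q1.
have qe : (q - 1) * q' = q.
  have := congr1 (fun t => t * (q * q')) qq'; rewrite mul1r mulrDl mulKf ?gt_eqF//.
  by rewrite [q * q']mulrC mulKf ?gt_eqF//; lra.
apply: (@Lpow_le _ _ _ _ _ _ (fun x => C * `|m x| `^ (q - 1) + C)) => //; first exact: coupling_meas.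
  apply: aeW => x; have m0 : 0 <= Num.max (m x) 0 by rewrite le_max lexx orbT.
  rewrite [leRHS]ger0_norm; last by rewrite addr_ge0 ?mulr_ge0 ?(ltW C0)// powR_ge0.
  apply: (le_trans (fC x _ m0)); rewrite mulrDr mulr1 addrC lerD2r ler_wpM2l ?(ltW C0)//.
  apply: ge0_ler_powR; rewrite ?nnegrE ?subr_ge0 ?(ltW q1)//.
  by rewrite ge_max normr_ge0 ler_norm.
apply: Lpow_lin => //; last exact: Lpow_cst.
split.
  by apply: (measurableT_comp (measurable_powR (q - 1))); exact: measurableT_comp.
have -> : (fun x => `| `|m x| `^ (q - 1) | `^ q') = (fun x => `|m x| `^ q); last exact: mi.
by apply/funext => x; rewrite ger0_norm ?powR_ge0// -powRrM qe.
Qed.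

End coupling.

(** * Ergodic and discounted solutions *)

Section solutions.
Context (R : realType) (d : nat).
Local Notation X := 'rV[R]_d.
Local Notation mu := (torus_measure R d).
Variables (s q s' q' : R) (s1 : 1 < s) (q1 : 1 < q) (s'1 : 1 < s') (q'1 : 1 < q').
Hypotheses (ss' : s^-1 + s'^-1 = 1) (qq' : q^-1 + q'^-1 = 1)
  (hs' : hoelder_conjugate s%:E = s'%:E) (hq' : hoelder_conjugate q%:E = q'%:E).
Hypothesis embedding : sobolev_embedding d s (hoelder_conjugate q%:E).
Variable H : X -> X -> R.
Hypotheses (pH : Zd_periodic H) (H_C1 : C1 (fun z : X * X => H z.1 z.2)).
Hypothesis H_conv : forall x p0 p1 (t : R), p0 != p1 -> 0 < t -> t < 1 ->
    H x (t *: p0 + (1 - t) *: p1) < t * H x p0 + (1 - t) * H x p1.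
Hypothesis H_coer : forall A : R, exists B : R, forall p : X, B < `|p| ->
    (A%:E < ereal_inf [set (H x p)%:E | x in [set: X]])%E.
Variable f : X -> R -> R.
Hypotheses (f_per : Zd_periodic f)
  (f_cont : {within [set z : X * R | 0 <= z.2], continuous (fun z => f z.1 z.2)})
  (f_incr : forall x r1 r2, 0 <= r1 -> r1 < r2 -> f x r1 < f x r2)
  (f_grow : exists2 C : R, 0 < C & forall x r, 0 <= r -> `|f x r| <= C * (1 + r `^ (q - 1))).

Let s0 : 0 < s. Proof. exact: lt_trans s1. Qed.
Let q0 : 0 < q. Proof. exact: lt_trans q1. Qed.
Let s'0 : 0 < s'. Proof. exact: lt_trans s'1. Qed.
Let q'0 : 0 < q'. Proof. exact: lt_trans q'1. Qed.

Lemma W1_Lpow w : W1 s w -> Lpow mu q' w.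
Proof. by move=> /embedding.1; rewrite hq' => /(LpP _ (ltW q'1))[]. Qed.

Lemma W1_mul_intg (m w : X -> R) : Lp q%:E m -> W1 s w -> intg mu (fun x => w x * m x).
Proof.
move=> /(LpP _ (ltW q1))[_ Lm] /W1_Lpow Lw.
by apply: (Lpow_mul q'0 q0 _ Lw Lm); rewrite addrC.
Qed.

Lemma dotZl (u w : X) a : dot (a *: u) w = a * dot u w.
Proof. by rewrite /dot mulr_sumr; apply: eq_bigr => i _; rewrite mxE mulrA. Qed.

(** The energy identity: the weak equation may be tested with Sobolev functions. *)
Lemma flux_test (u m k w : X -> R) :
  (forall i, Lp (hoelder_conjugate s%:E) (coord i \o flux H u m)) -> Lpow mu q k ->
  (forall phi, test_function phi ->
    \int[mu]_x dot (flux H u m x) (gradient phi x) + \int[mu]_x (k x * phi x) = 0) ->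
  W1 s w ->
  intg mu (fun x => m x * dot (DpH H x (Dw u x)) (Dw w x)) /\
  \int[mu]_x (m x * dot (DpH H x (Dw u x)) (Dw w x)) + \int[mu]_x (k x * w x) = 0.
Proof.
rewrite hs' => LF Lk hphi Ww; have /(W1P s1)[pw sw wD sD] := Ww.
have LF' i : Lpow mu s' (coord i \o flux H u m) by have /(LpP _ (ltW s'1))[] := LF i.
have LFi i : intg mu (coord i \o flux H u m) by exact: Lpow_intg (ltW s'1) (LF' i).
have E : (fun x => m x * dot (DpH H x (Dw u x)) (Dw w x)) =
    (fun x => \sum_i (coord i \o flux H u m) x * (coord i \o Dw w) x).
  by apply/funext => x; rewrite -dotZl.
have ii i : intg mu (fun x => (coord i \o flux H u m) x * (coord i \o Dw w) x).
  by apply: (Lpow_mul s'0 s0 _ (LF' i) (sD i).2); rewrite addrC.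
rewrite E; split; first exact: intg_sum.
rewrite Int_sum//; apply: (weak_form_extend s0 s'0 q0 q'0 _ qq' LF' Lk) => //.
- by rewrite addrC.
- move=> phi tphi; apply: etrans (hphi _ (trig_test tphi)); congr (_ + _).
  rewrite -(@Int_sum _ _ _ mu 'I_d _ (fun i x => (coord i \o flux H u m) x * partial phi i x)).
    apply: eq_Rintegral => x _; rewrite /dot; apply: eq_bigr => i _.
    by rewrite /gradient [X in _ = _ * X]mxE.
  by move=> i; apply: trig_mul_intg => //; exact: trig_partial.
- exact: (W1_pintg s1).
- exact: W1_Lpow.
- by move=> i; exact: (sD i).2.
Qed.

Lemma W1_sub (u v : X -> R) : W1 s u -> W1 s v ->
  W1 s (fun x => -1 * u x + v x) /\
  {ae mu, forall x, Dw (fun x => -1 * u x + v x) x = Dw v x - Dw u x}.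
Proof.
move=> Wu Wv; have [W E] := W1_lin s1 (-1) Wu Wv; split => //.
by apply: filterS E => x ->; rewrite scaleN1r addrC.
Qed.

Lemma DpH_coord_meas (u : X -> R) i : W1 s u ->
  measurable_fun setT (fun x => DpH H x (Dw u x) 0 i).
Proof.
move=> Wu; have mid : measurable_fun setT (fun x : X => x) by exact: measurable_id.
have h := @measurable_comp2 R _ X d d _ id (Dw u) (@DpH_coord_continuous _ _ _ H_C1 i) mid (W1_Dw_meas s1 Wu).
exact: h.
Qed.

(** Gradients and densities enter only almost everywhere, and the gradient matters
for the flux only where the density is positive. Away from that set a
subsolution may be modified freely. *)
Lemma ergodic_sol_ae u m v n lam : ergodic_sol H f s q u m lam -> W1 s v ->
  Lp q%:E n -> {ae mu, forall x, m x = n x} ->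
  {ae mu, forall x, 0 < n x -> Dw v x = Dw u x} ->
  {ae mu, forall x, H x (Dw v x) <= f x (n x) + lam} -> ergodic_sol H f s q v n lam.
Proof.
move=> [Wu [Lm [[m0 m1 LF] _ eq div]]] Wv Ln mn vu vineq.
have Fuv : {ae mu, forall x, flux H u m x = flux H v n x}.
  apply: filterS3 m0 mn vu => x; rewrite /flux => + <-.
  rewrite le_eqVlt => /predU1P[<- _|mx /(_ mx) -> //].
  exact: etrans (scale0r _) (esym (scale0r _)).
have /(LpP _ (ltW q1))[_ [mm _]] := Lm; have /(LpP _ (ltW q1))[pn [mn' _]] := Ln.
have mF (k w : X -> R) i : measurable_fun setT k -> W1 s w ->
    measurable_fun setT (coord i \o flux H w k).
  move=> mk Ww; rewrite (_ : _ \o _ = fun x => k x * DpH H x (Dw w x) 0 i).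
    by apply: measurable_funM => //; exact: DpH_coord_meas.
  by apply/funext => x; rewrite /coord /flux /= mxE.
split; first exact: Wv.
split; first exact: Ln.
split; [|exact: vineq| |].
- split; first by apply: filterS2 m0 mn => x + <-.
    by rewrite -m1; apply: eq_ae_Int => //; apply: filterS mn => x ->.
  move=> i; move: (LF i); rewrite hs' => /(LpP _ (ltW s'1))[_ Li].
  apply/(LpP _ (ltW s'1)); split.
    move=> j x; rewrite /coord /flux /= pn (W1_Dw_periodic s1 Wv) /DpH.
    by rewrite (_ : H (x + unit_vec R j) = H x)// pH.
  apply: Lpow_ae Li => //; first exact: mF.
  by apply: filterS Fuv => x; rewrite /coord /= => ->.
- by apply: filterS3 eq mn vu => x E mnx vux nx; rewrite -mnx in nx *; rewrite -E// vux// -mnx.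
- move=> phi tphi; rewrite -(div _ tphi).
  have mg i : measurable_fun setT (fun x => gradient phi x 0 i).
    rewrite (_ : (fun x => gradient phi x 0 i) = partial phi i).
      by apply: test_measurable; exact: test_partial.
    by apply/funext => x; rewrite mxE.
  have md (k w : X -> R) : measurable_fun setT k -> W1 s w ->
      measurable_fun setT (fun x => dot (flux H w k x) (gradient phi x)).
    move=> mk Ww; rewrite /dot; apply: measurable_sum => i.
    by apply: measurable_funM; [exact: (mF k w i mk Ww)|exact: mg].
  by apply: eq_ae_Int; [exact: md|exact: md|apply: filterS Fuv => x ->].
Qed.

Section ergodic.
Variables (m : X -> R) (lam : R).

Lemma erg_test u w : ergodic_sols H f s q m lam u -> W1 s w ->
  intg mu (fun x => m x * dot (DpH H x (Dw u x)) (Dw w x)) /\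
  \int[mu]_x (m x * dot (DpH H x (Dw u x)) (Dw w x)) = 0.
Proof.
move=> [Wu [Lm [[m0 m1 LF] _ _ eq]]] Ww.
have [|i E] := flux_test LF (Lpow_cst mu q 0) _ Ww.
  move=> phi tphi; rewrite eq// add0r.
  by under eq_Rintegral do rewrite mul0r; rewrite Int_cst.
split => //; rewrite -E; under [X in _ = _ + X]eq_Rintegral do rewrite mul0r.
by rewrite Int_cst addr0.
Qed.

(** Test with u1 - u0. On {m > 0} the Hamiltonians agree, so the tangent inequality
makes the integrand nonpositive; its integral is zero, hence so is the
integrand, and the tangent inequality is strict for distinct gradients. *)
Lemma erg_same_gradient u0 u1 :
  ergodic_sols H f s q m lam u0 -> ergodic_sols H f s q m lam u1 ->
  {ae mu, forall x, 0 < m x -> Dw u0 x = Dw u1 x}.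
Proof.
move=> E0 E1; have [W0 [Lm [[m0 m1 LF] _ eq0 _]]] := E0; have [W1' [_ [_ _ eq1 _]]] := E1.
have [Ww Dd] := W1_sub W0 W1'.
have [ii I0] := erg_test E0 Ww.
have : {ae mu, forall x, m x * dot (DpH H x (Dw u0 x)) (Dw (fun x => -1 * u0 x + u1 x) x) = 0}.
  have : {ae mu, forall x, - (m x * dot (DpH H x (Dw u0 x)) (Dw (fun x => -1 * u0 x + u1 x) x)) = 0}.
    apply: Int_eq0; first exact: intgN.
      apply: filterS3 (filterI Dd m0) eq0 eq1 => x [-> m0x] e0 e1.
      move: m0x; rewrite le_eqVlt => /predU1P[<-|mx]; first by rewrite mul0r oppr0.
      rewrite oppr_ge0 pmulr_rle0//; apply: (le_trans (tangent_le H_C1 H_conv x _ _)).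
      by rewrite e0// e1// subrr.
    by rewrite IntN// I0 oppr0.
  by apply: filterS => x /eqP; rewrite oppr_eq0 => /eqP.
move=> z0; apply: filterS3 (filterI Dd z0) eq0 eq1 => x [-> z0x] e0 e1 mx.
apply: contrapT => /eqP ne; move: z0x => /eqP; rewrite mulf_eq0 gt_eqF//= => /eqP z0x.
by have := strict_tangent H_C1 H_conv x ne; rewrite z0x e0// e1// subrr ltxx.
Qed.

Lemma erg_modify u v : ergodic_sols H f s q m lam u -> W1 s v ->
  {ae mu, forall x, 0 < m x -> Dw v x = Dw u x} ->
  {ae mu, forall x, H x (Dw v x) <= f x (m x) + lam} ->
  ergodic_sols H f s q m lam v.
Proof. by move=> Eu Wv; apply: ergodic_sol_ae Eu Wv Eu.2.1 _; exact: aeW. Qed.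

Lemma J_expand u : W1 s u -> Lp q%:E m -> \int[mu]_x m x = 1 ->
  J m u = \int[mu]_x (u x * m x) - mean u.
Proof.
move=> Wu Lm m1; have im : intg mu m.
  by have /(LpP _ (ltW q1))[_] := Lm; exact/Lpow_intg/ltW.
rewrite /J /centered; under eq_Rintegral do rewrite mulrBl.
rewrite IntB; [|exact: W1_mul_intg|exact: intgZ].
by rewrite IntZ// m1 mulr1.
Qed.

Lemma ae_countable (T : countType) (S : T -> X -> Prop) :
  (forall t, {ae mu, forall x, S t x}) -> {ae mu, forall x, forall t, S t x}.
Proof.
move=> aS; have : {ae mu, forall x, forall n : nat, oapp (fun t => S t x) True (unpickle n)}.
  apply: ae_foralln => n; case: (unpickle n) => [t|]; first exact: aS.
  exact: aeW.
by apply: filterS => x h t; have := h (pickle t); rewrite pickleK.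
Qed.

Lemma O_open : open (O_ m).
Proof. by apply: bigcup_open => U [oU _ _]. Qed.

Lemma O_periodic : Zd_periodic (O_ m).
Proof.
move=> i x; apply/propext; split=> -[U [oU pU U0] Ux]; exists U => //.
  by move: Ux; rewrite pU.
by rewrite pU.
Qed.

(** Lindelof's argument: O_m is covered by countably many rational boxes on which m
vanishes almost everywhere. *)
Lemma O_null : {ae mu, forall x, O_ m x -> m x = 0}.
Proof.
have : {ae mu, forall x, forall p : 'rV[rat]_d * nat,
    {ae mu, forall y, rat_box (R := R) p y -> m y = 0} -> rat_box (R := R) p x -> m x = 0}.
  apply: ae_countable => p.
  have [h|h] := pselect {ae mu, forall y, rat_box (R := R) p y -> m y = 0}; last exact: aeW.
  by apply: filterS h => x hx _.
apply: filterS => x hx [U [oU _ U0] Ux].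
have [p [px pU]] := rat_box_open oU Ux.
by apply: (hx p) => //; apply: filterS U0 => y h /pU.
Qed.

(** Three cases: m > 0; m = 0 with a gap; m = 0 without gap, where both gradients
minimise H(x, .). *)
Lemma MJ_off_O u0 u1 : MJ H f s q m lam u0 -> MJ H f s q m lam u1 ->
  {ae mu, forall x, R_gap H f m lam x -> Dw u0 x = Dw u1 x} ->
  {ae mu, forall x, ~ O_ m x -> Dw u0 x = Dw u1 x}.
Proof.
move=> [E0 _] [E1 _] gap; have same := erg_same_gradient E0 E1.
have [_ [_ [[m0 _ _] le0 _ _]]] := E0; have [_ [_ [_ le1 _ _]]] := E1.
apply: filterS3 (filterI gap same) (filterI le0 le1) m0 => x [gx sx] [l0 l1] m0x nO.
have [mx|mx] := ltP 0 (m x); first exact: sx.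
have mx0 : m x = 0 by apply/eqP; rewrite eq_le mx m0x.
have Rx : R_ m x by move=> [[]|//]; rewrite /= mx0 ltxx.
have [lH|lH] := ltP (Hmin H x) (ell f lam x); first exact: gx.
apply: (minimizer_unique H_C1 H_conv H_coer lH); rewrite /ell addrC.
  by rewrite -mx0.
by rewrite -mx0.
Qed.

(** On {m > 0} the gradients coincide and the equation persists; elsewhere the
inequality H <= f + lam is convex. The functional J is affine. *)
Lemma MJ_midpoint u0 u1 : MJ H f s q m lam u0 -> MJ H f s q m lam u1 ->
  exists v, MJ H f s q m lam v /\
    {ae mu, forall x, Dw v x = Dw u1 x + 2^-1 *: (Dw u0 x - Dw u1 x)}.
Proof.
move=> [E0 J0] [E1 J1]; have [W0 [Lm [[m0 m1 _] le0 eq0 _]]] := E0; have [W1' [_ [_ le1 eq1 _]]] := E1.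
have [Wd Dd] := W1_sub W1' W0.
have [Wv Dv] := W1_lin s1 (2^-1) Wd W1'.
pose v x := 2^-1 * (-1 * u1 x + u0 x) + u1 x.
have DvE : {ae mu, forall x, Dw v x = Dw u1 x + 2^-1 *: (Dw u0 x - Dw u1 x)}.
  by apply: filterS2 Dd Dv => x -> ->; rewrite addrC.
have Ev : ergodic_sols H f s q m lam v.
  apply: (erg_modify E1 Wv).
    by apply: filterS2 DvE (erg_same_gradient E0 E1) => x -> h /h ->; rewrite subrr scaler0 addr0.
  apply: filterS3 DvE le0 le1 => x -> l0 l1.
  have h2 : 0 <= (2^-1 : R) <= 1 by apply/andP; split; lra.
  apply: (le_trans (convex_le H_conv x _ _ h2)); lra.
exists v; split; [split; [exact: Ev|move=> w Ew]|exact: DvE].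
have mv : mean v = 2^-1 * (-1 * mean u1 + mean u0) + mean u1.
  have i0 := (W1_pintg s1 W0).2; have i1 := (W1_pintg s1 W1').2.
  rewrite /mean /v IntD//; last by apply/intgZ/intgD => //; exact: intgZ.
  rewrite IntZ; last by apply: intgD => //; exact: intgZ.
  by rewrite IntD ?IntZ//; exact: intgZ.
have Jv : J m v = 2^-1 * J m u0 + 2^-1 * J m u1.
  rewrite !J_expand// mv.
  have -> : \int[mu]_x (v x * m x) = 2^-1 * (-1 * (\int[mu]_x (u1 x * m x)) + \int[mu]_x (u0 x * m x)) + \int[mu]_x (u1 x * m x).
    have i0 := W1_mul_intg Lm W0; have i1 := W1_mul_intg Lm W1'.
    have -> : \int[mu]_x (v x * m x) = \int[mu]_x (2^-1 * (-1 * (u1 x * m x) + u0 x * m x) + u1 x * m x).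
      by apply: eq_Rintegral => x _; rewrite /v; ring.
    rewrite IntD//; last by apply/intgZ/intgD => //; exact: intgZ.
    rewrite IntZ; last by apply: intgD => //; exact: intgZ.
    by rewrite IntD ?IntZ//; exact: intgZ.
  by move: (\int[mu]_x (u1 x * m x)) (\int[mu]_x (u0 x * m x)) (mean u1) (mean u0) => a b c e; lra.
rewrite Jv; move: (J0 _ Ew) (J1 _ Ew).
by move: (J m u0) (J m u1) (J m w) => a b c ha hb; lra.
Qed.

Lemma ell_continuous : continuous (fun x => ell f lam x).
Proof.
have -> : (fun x => ell f lam x) = (fun x => lam + f x (Num.max 0 0)).
  by apply/funext => x; rewrite /ell maxxx.
move=> x; have cp : {for x, continuous (fun x : X => (x, 0 : R))}.
  by apply: (@cvg_pair2 X X R id (cst 0) x); [exact: cvg_id|exact: cst_continuous].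
have cf := @continuous_comp _ _ _ (fun x : X => (x, 0 : R)) _ x cp (@f_max_continuous _ _ _ f_cont (x, 0)).
apply: (@continuousD _ _ _ (cst lam) _ x); first exact: cst_continuous.
exact: cf.
Qed.

(** The gradients that leave room in the subsolution inequality at a point of O_m. *)
Definition slack (x : X) : set X := [set p | O_ m x /\ H x p < ell f lam x].

Lemma slack_periodic : Zd_periodic slack.
Proof.
move=> i x; apply/funext => p; rewrite /slack/= O_periodic /ell.
have -> : H (x + unit_vec R i) = H x by exact: pH.
by have -> : f (x + unit_vec R i) = f x by exact: f_per.
Qed.

Lemma slack_open x p : slack x p -> exists2 e : R, 0 < e &
  forall y p', ball x e y -> ball p e p' -> slack y p'.
Proof.
move=> [Ox Hp].
have n1 : \forall z \near (x, p), O_ m z.1.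
  by apply: (@cvg_fst _ _ (nbhs x) (nbhs p)); apply: open_nbhs_nbhs; split => //; exact: O_open.
have n2 : \forall z \near (x, p), 0 < ell f lam z.1 - H z.1 z.2.
  have c : (fun z : X * X => ell f lam z.1 - H z.1 z.2) @ (x, p) --> ell f lam x - H x p.
    apply: cvgB; last exact: (@H_continuous _ _ _ H_C1 (x, p)).
    apply: (@cvg_comp _ _ _ fst (fun x => ell f lam x) _ (nbhs x)); first exact: cvg_fst.
    exact: ell_continuous.
  by apply: (cvgr_gt _ c); rewrite subr_gt0.
have /nbhs_ballP[e e0 he] : nbhs ((x, p) : X * X) [set z : X * X | O_ m z.1 /\ 0 < ell f lam z.1 - H z.1 z.2].
  exact: filterI n1 n2.
exists e => // y p' yx pp; have [Oy Hy] := he (y, p') (conj yx pp).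
by split => //; rewrite -subr_gt0.
Qed.

Definition margin (b : ('rV[rat]_d * nat) * ('rV[rat]_d * nat)) := exists2 eta : R, 0 < eta &
  forall x p y p' : X, rat_box b.1 x -> rat_box b.2 p -> `|y| < eta ->
    (forall i, `|p' 0 i - p 0 i| < eta) -> slack (x + y) p'.

(** Slack is an open condition in (x, p), so it is covered by countably many pairs
of boxes with a margin. If it holds on a non-null set, then some single pair
already carries a non-null set, with the uniform eta needed to raise v. *)
Lemma slack_cover x p : slack x p ->
  exists b, [/\ margin b, rat_box b.1 x & rat_box b.2 p].
Proof.
move=> /slack_open[e e0 he]; have e2 : 0 < e / 2 by rewrite divr_gt0.
have [b1 [b1x hb1]] := rat_box_open (ball_open x (e / 2)) (ballxx x e2).
have [b2 [b2p hb2]] := rat_box_open (ball_open p (e / 2)) (ballxx p e2).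
exists (b1, b2); split => //; exists (e / 2) => // y r z r' /hb1 yx /hb2 rp hz hr.
apply: he; rewrite [e]splitr.
  by apply: (ball_triangle yx); rewrite -ball_normE /ball_/= opprD addNKr normrN.
apply: (ball_triangle rp); split => // i j.
by rewrite (ord1 i) /ball/= distrC.
Qed.

(** Otherwise v can be raised inside O_m by local_improvement. Since m vanishes
there, the raised function is still a solution and has the same integral
against m, but a larger mean, hence a smaller J. *)
Lemma MJ_no_slack v : MJ H f s q m lam v -> {ae mu, forall x, ~ slack x (Dw v x)}.
Proof.
move=> [Ev Jv]; have [Wv [Lm [[m0 m1 _] le0 _ _]]] := Ev; have /(W1P s1)[pv sv vD sD] := Wv.
have [C C0 fC] := f_grow.
have [L L0 HL] := coercive_bound H_coer (lam + C).
have OL i : {ae mu, forall x, O_ m x -> `|(coord i \o Dw v) x| <= L}.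
  apply: filterS2 O_null le0 => x h hx Ox; apply: (le_trans (norm_coord _ _)); apply: (HL x).
  apply: (le_trans hx); rewrite h// addrC lerD2l; apply: (le_trans (ler_norm _)).
  have := fC x 0 (lexx _); rewrite powR0 ?addr0 ?mulr1//.
  by rewrite subr_eq0 gt_eqF.
suff : {ae mu, forall x b, margin b -> rat_box b.1 x -> ~ rat_box b.2 (Dw v x)}.
  apply: filterS => x h /slack_cover[b [mb b1 b2]]; exact: (h b mb b1 b2).
apply: ae_countable => b.
have [[eta eta0 heta]|nb] := pselect (margin b); last by apply: aeW => x /nb.
pose A : set X := rat_box b.1 `&` (Dw v @^-1` rat_box b.2).
have mA : measurable A.
  apply: measurableI; first exact: measurable_rat_box.
  by rewrite -[X in measurable X]setTI; apply: (W1_Dw_meas s1 Wv) => //; exact: measurable_rat_box.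
have [A0|Apos] := eqVneq (mu A) 0%E.
  by exists A; split => // x /= nx; apply: contrapT => nA; apply: nx => _ b1 b2; exact: nA.
have muA : (0 < mu A)%E by rewrite lt0e Apos measure_ge0.
have AO x y : A x -> `|y| < eta -> O_ m (x + y).
  move=> [b1 b2] hy; have [] := heta x (Dw v x) y (Dw v x) b1 b2 hy _; last by [].
  by move=> i; rewrite subrr normr0.
have AW x y (p : X) : A x -> `|y| < eta -> (forall i, `|p 0 i - (coord i \o Dw v) x| < eta) -> slack (x + y) p.
  by move=> [b1 b2] hy hp; apply: heta b1 b2 hy hp.
have [w [th [P [pw [M wM] Iw wG ath]]]] :=
  local_improvement (W1_pintg s1 Wv) vD O_open O_periodic L0 OL mA eta0 AO muA slack_periodic AW.
exfalso.
have Lw : Lpow mu s w.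
  apply: (Lpow_bounded (M := M) s0); first exact: intg_meas pw.2.
  by apply: filterS wM => x /andP[w0 w1]; rewrite ger0_norm.
have [] := @W1_intro R d s s1 w (fun i x => th x * (P x 0 i - (coord i \o Dw v) x)) pw.1 Lw (fun i => (wG i).1).
  move=> i; have [wGi [N hN]] := wG i; apply: (Lpow_bounded (M := N) s0) => //.
  exact: intg_meas wGi.1.2.
move=> Ww Dww.
have [Wu Du] := W1_lin s1 1 Wv Ww.
pose u x := 1 * v x + w x.
have DuE : {ae mu, forall x, Dw u x = Dw v x + th x *: (P x - Dw v x)}.
  apply: filterS2 Du Dww => x -> h; rewrite scale1r; congr (_ + _).
  by apply/rowP => i; rewrite h !mxE.
have wm0 : {ae mu, forall x, w x * m x = 0}.
  apply: filterS2 ath O_null => x [_ _ nO] h; have [Ox|/nO[-> _]] := pselect (O_ m x).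
    by rewrite h// mulr0.
  by rewrite mul0r.
have Eu : ergodic_sols H f s q m lam u.
  apply: (erg_modify Ev Wu).
    apply: filterS3 DuE ath O_null => x -> [_ _ nO] h mx.
    have [/h m00|/nO[_ ->]] := pselect (O_ m x); first by move: mx; rewrite m00 ltxx.
    by rewrite scale0r addr0.
  apply: filterS3 (filterI DuE le0) ath O_null => x [-> lex] [th01 thW _] h.
  apply: (le_trans (convex_le H_conv x _ _ th01)).
  have [->|/thW[Ox HP]] := eqVneq (th x) 0; first by rewrite subr0 mul1r mul0r addr0.
  have : H x (P x) <= f x (m x) + lam by rewrite h// addrC ltW.
  by move: th01 => /andP[t0 t1]; nra.
have := Jv _ Eu; rewrite !J_expand//; apply/negP; rewrite -ltNge.
have iv := W1_mul_intg Lm Wv; have iw := W1_mul_intg Lm Ww.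
have -> : \int[mu]_x (u x * m x) = \int[mu]_x (v x * m x).
  apply: eq_ae_Int.
  - exact: intg_meas (W1_mul_intg Lm Wu).
  - exact: intg_meas iv.
  - by apply: filterS wm0 => x h; rewrite /u mulrDl h mul1r addr0.
have -> : mean u = mean v + \int[mu]_x w x.
  have ivv := (W1_pintg s1 Wv).2; rewrite /mean /u IntD; [|exact: intgZ|exact: pw.2].
  by rewrite IntZ// mul1r.
by rewrite opprD addrA gtrDl oppr_lt0.
Qed.

(** Where the gradients differ in O_m, strict convexity gives slack to the midpoint. *)
Lemma MJ_same_gradient u0 u1 : MJ H f s q m lam u0 -> MJ H f s q m lam u1 ->
  {ae mu, forall x, R_gap H f m lam x -> Dw u0 x = Dw u1 x} ->
  {ae mu, forall x, Dw u0 x = Dw u1 x}.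
Proof.
move=> M0 M1 gap; have off := MJ_off_O M0 M1 gap.
have [v [Mv DvE]] := MJ_midpoint M0 M1; have nos := MJ_no_slack Mv.
have [[_ [_ [_ le0 _ _]]] _] := M0; have [[_ [_ [_ le1 _ _]]] _] := M1.
apply: filterS3 (filterI off nos) (filterI DvE O_null) (filterI le0 le1) => x [offx nosx] [Dvx Onx] [l0 l1].
have [Ox|/offx//] := pselect (O_ m x).
apply: contrapT => /eqP ne; apply: nosx; split => //; rewrite Dvx.
have h2 : 0 < 2^-1 :> R by [].
have h1 : (2^-1 : R) < 1 by rewrite invf_lt1// ltr1n.
have := H_conv x ne h2 h1.
have -> : 2^-1 *: Dw u0 x + (1 - 2^-1) *: Dw u1 x = Dw u1 x + 2^-1 *: (Dw u0 x - Dw u1 x).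
  by apply/rowP => i; rewrite !mxE; lra.
move: l0 l1; rewrite (Onx Ox) /ell; lra.
Qed.

End ergodic.
(** By weak_lipschitz with constant 0, for every y the translate by y agrees with w
almost everywhere. By ae_swap there is one x with w (x + y) = w x for almost
all y. *)
Lemma zero_gradient_cst w : W1 s w -> {ae mu, forall x, Dw w x = 0} ->
  exists c, {ae mu, forall x, w x = c}.
Proof.
move=> Ww D0; have /(W1P s1)[pw sw wD _] := Ww; have pin := W1_pintg s1 Ww.
have G0 i : {ae mu, forall x, setT x -> `|(coord i \o Dw w) x| <= 0}.
  by apply: filterS D0 => x h _; rewrite /coord /= h mxE normr0.
have shift_eq y : {ae mu, forall x, `|w (x + y) - w x| = 0}.
  have pT : Zd_periodic (setT : set X) by [].
  have := @weak_lipschitz R d w _ pin wD setT 0 measurableT pT (lexx _) G0 setT y (fun _ _ _ _ => I).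
  apply: filterS => x /(_ I); rewrite mulr0 => h.
  by apply/eqP; rewrite eq_le h normr_ge0.
have mF : measurable_fun setT (fun z : X * X => `|w (z.1 + z.2) - w z.1|).
  apply: measurableT_comp => //; apply: measurable_funB; last exact: (measurableT_comp sw.1 measurable_fst).
  apply: (measurableT_comp sw.1); apply: measurable_coordP => i; rewrite /comp /coord.
  under eq_fun do rewrite mxE.
  by apply: measurable_funD; [exact: (measurableT_comp (@measurable_coord R d i) measurable_fst)|
    exact: (measurableT_comp (@measurable_coord R d i) measurable_snd)].
have sw2 : {ae mu, forall x, {ae mu, forall y, `|w (x + y) - w x| = 0}}.
  exact: (ae_swap mF (fun z => normr_ge0 _) (aeW _ shift_eq)).
have [x0 [hx0 _]] := near0_ae sw2 (@nearT X (nbhs (0 : X)) _).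
exists (w x0).
have : {ae mu, forall y, w (x0 + (y - x0)) = w x0}.
  apply: (ae_shift (S := fun y => w (x0 + y) = w x0)); first by move=> i y; rewrite addrA pw.
  by apply: filterS hx0 => y /= /eqP; rewrite normr_eq0 subr_eq0 => /eqP.
by apply: filterS => y; rewrite addrCA subrr addr0.
Qed.

Lemma MJ_unique m lam u0 u1 : MJ H f s q m lam u0 -> MJ H f s q m lam u1 ->
  {ae mu, forall x, R_gap H f m lam x -> Dw u0 x = Dw u1 x} ->
  exists c, {ae mu, forall x, u0 x - u1 x = c}.
Proof.
move=> M0 M1 gap; have D01 := MJ_same_gradient M0 M1 gap.
have [W E] := W1_sub M1.1.1 M0.1.1.
have [|c hc] := zero_gradient_cst W.
  by apply: filterS2 E D01 => x -> ->; rewrite subrr.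
by exists c; apply: filterS hc => x <-; ring.
Qed.

Section comparison.
Variables (m : X -> R).
Hypotheses (Lm : Lp q%:E m) (m_ge0 : {ae mu, forall x, 0 <= m x}) (m_mass : \int[mu]_x m x = 1).

Let im : intg mu m.
Proof. by have /(LpP _ (ltW q1))[_] := Lm; exact/Lpow_intg/ltW. Qed.

Lemma mass_cst (a : R) : intg mu (fun x => m x * a) /\ \int[mu]_x (m x * a) = a.
Proof.
have E : (fun x => m x * a) = (fun x => a * m x) by apply/funext => x; rewrite mulrC.
by rewrite E; split; [exact: intgZ|rewrite IntZ// m_mass mulr1].
Qed.

Lemma mass_Lpow g : Lpow mu q' g -> intg mu (fun x => m x * g x).
Proof. by move=> Lg; have /(LpP _ (ltW q1))[_ Lm'] := Lm; exact: Lpow_mul Lm' Lg. Qed.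

Lemma mass_coupling (n : X -> R) : Lp q%:E n ->
  intg mu (fun x => m x * f x (Num.max (n x) 0)).
Proof.
by move=> /(LpP _ (ltW q1))[_ Ln]; apply: mass_Lpow; exact: (coupling_Lpow q1 f_cont q'0 qq' f_grow).
Qed.

(** Convexity turns the tested equation into an inequality between Hamiltonians,
weighted by m. *)
Lemma tangent_ineq u w (g h : X -> R) : W1 s u -> W1 s w ->
  intg mu (fun x => m x * dot (DpH H x (Dw u x)) (Dw (fun x => -1 * u x + w x) x)) ->
  {ae mu, forall x, 0 < m x -> H x (Dw u x) = h x} -> {ae mu, forall x, H x (Dw w x) <= g x} ->
  intg mu (fun x => m x * (g x - h x)) ->
  \int[mu]_x (m x * dot (DpH H x (Dw u x)) (Dw (fun x => -1 * u x + w x) x)) <=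
    \int[mu]_x (m x * (g x - h x)).
Proof.
move=> Wu Ww ii eq le ig; have [_ Dd] := W1_sub Wu Ww.
apply: Int_le => //; apply: filterS3 (filterI Dd m_ge0) eq le => x [-> m0] e l.
move: m0; rewrite le_eqVlt => /predU1P[<-|mx]; first by rewrite !mul0r.
rewrite ler_pM2l//; apply: (le_trans (tangent_le H_C1 H_conv x _ _)).
by rewrite e// lerD2r.
Qed.

End comparison.

(** The right-hand side g is kept general: it will be a coupling at another density,
both for another ergodic solution and for a discounted one. *)
Lemma ergodic_ineq u m lam w (g : X -> R) : ergodic_sol H f s q u m lam -> W1 s w ->
  {ae mu, forall x, H x (Dw w x) <= g x} -> intg mu (fun x => m x * g x) ->
  lam + \int[mu]_x (m x * f x (Num.max (m x) 0)) <= \int[mu]_x (m x * g x).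
Proof.
move=> Eu Ww le ig; have [Wu [Lm [[m0 m1 _] _ eq _]]] := Eu.
have [Wd _] := W1_sub Wu Ww; have [ii I0] := erg_test Eu Wd.
pose h x := f x (Num.max (m x) 0) + lam.
have ih : intg mu (fun x => m x * h x).
  have -> : (fun x => m x * h x) = (fun x => m x * f x (Num.max (m x) 0) + m x * lam).
    by apply/funext => x; rewrite mulrDr.
  by apply: intgD; [exact: (mass_coupling Lm Lm)|exact: (mass_cst Lm m1 lam).1].
have igh : intg mu (fun x => m x * (g x - h x)).
  have -> : (fun x => m x * (g x - h x)) = (fun x => m x * g x - m x * h x).
    by apply/funext => x; rewrite mulrBr.
  exact: intgB.
have eqh : {ae mu, forall x, 0 < m x -> H x (Dw u x) = h x}.
  by apply: filterS eq => x e mx; rewrite e// /h max_l// ltW.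
have := tangent_ineq m0 Wu Ww ii eqh le igh; rewrite I0.
have -> : \int[mu]_x (m x * (g x - h x)) = \int[mu]_x (m x * g x) - \int[mu]_x (m x * h x).
  by rewrite -IntB//; apply: eq_Rintegral => x _; rewrite mulrBr.
have -> : \int[mu]_x (m x * h x) = \int[mu]_x (m x * f x (Num.max (m x) 0)) + lam.
  have [il Il] := mass_cst Lm m1 lam.
  rewrite -[X in _ = _ + X]Il -IntD//; last exact: (mass_coupling Lm Lm).
  by apply: eq_Rintegral => x _; rewrite mulrDr.
by rewrite subr_ge0 addrC.
Qed.

Lemma discounted_ineq eps u m w (g : X -> R) : discounted_sol H f s q eps u m -> W1 s w ->
  {ae mu, forall x, H x (Dw w x) <= g x} -> intg mu (fun x => m x * g x) ->
  eps * mean w - eps * mean u - eps * \int[mu]_x (w x * m x) +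
    \int[mu]_x (m x * f x (Num.max (m x) 0)) <= \int[mu]_x (m x * g x).
Proof.
move=> [Wu [Lm [[m0 m1 LF] _ eq div]]] Ww le ig.
have [Wd _] := W1_sub Wu Ww.
have /(LpP _ (ltW q1))[pm Lpm] := Lm; have im := Lpow_intg (ltW q1) Lpm.
pose k x := eps * m x + - eps.
have Lk : Lpow mu q k by apply: Lpow_lin => //; exact: Lpow_cst.
have ikt phi : intg mu phi -> intg mu (fun x => phi x * m x) ->
    \int[mu]_x (k x * phi x) = eps * \int[mu]_x (phi x * m x) - eps * \int[mu]_x phi x.
  move=> ip ipm; rewrite -!IntZ// -IntB; [|exact: intgZ|exact: intgZ].
  by apply: eq_Rintegral => x _; rewrite /k; ring.
have [|ii Itest] := flux_test LF Lk _ Wd.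
  move=> phi tphi; have := div _ tphi; rewrite ikt.
  - have -> : \int[mu]_x (m x * phi x) = \int[mu]_x (phi x * m x).
      by apply: eq_Rintegral => x _; rewrite mulrC.
    by move=> <-; ring.
  - by have := test_intg_mul tphi (intg_cst mu 1); under eq_fun do rewrite mul1r.
  - by under eq_fun do rewrite mulrC; exact: test_intg_mul.
pose h x := f x (Num.max (m x) 0) - eps * u x.
have ium := W1_mul_intg Lm Wu; have iwm := W1_mul_intg Lm Ww.
have iu := (W1_pintg s1 Wu).2; have iw := (W1_pintg s1 Ww).2.
have imf := mass_coupling Lm Lm.
have ih : intg mu (fun x => m x * h x).
  have -> : (fun x => m x * h x) = (fun x => m x * f x (Num.max (m x) 0) - eps * (u x * m x)).
    by apply/funext => x; rewrite /h; ring.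
  by apply: intgB => //; exact: intgZ.
have igh : intg mu (fun x => m x * (g x - h x)).
  have -> : (fun x => m x * (g x - h x)) = (fun x => m x * g x - m x * h x).
    by apply/funext => x; rewrite mulrBr.
  exact: intgB.
have eqh : {ae mu, forall x, 0 < m x -> H x (Dw u x) = h x}.
  by apply: filterS eq => x e mx; rewrite /h (max_l (ltW mx)) -e//; ring.
have := tangent_ineq m0 Wu Ww ii eqh le igh.
have -> : \int[mu]_x (m x * (g x - h x)) = \int[mu]_x (m x * g x) -
    (\int[mu]_x (m x * f x (Num.max (m x) 0)) - eps * \int[mu]_x (u x * m x)).
  have -> : \int[mu]_x (m x * (g x - h x)) =
      \int[mu]_x (m x * g x - (m x * f x (Num.max (m x) 0) - eps * (u x * m x))).
    by apply: eq_Rintegral => x _; rewrite /h; ring.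
  rewrite IntB//; last by apply: intgB => //; exact: intgZ.
  by rewrite IntB ?IntZ//; exact: intgZ.
move: Itest; rewrite ikt; last 2 first.
- exact: (W1_pintg s1 Wd).2.
- exact: W1_mul_intg.
have -> : \int[mu]_x ((-1 * u x + w x) * m x) = \int[mu]_x (w x * m x) - \int[mu]_x (u x * m x).
  by rewrite -IntB//; apply: eq_Rintegral => x _; ring.
have -> : \int[mu]_x (-1 * u x + w x) = mean w - mean u.
  by rewrite /mean -IntB//; apply: eq_Rintegral => x _; ring.
move: (\int[mu]_x (m x * dot _ _)) => T.
move: (\int[mu]_x (w x * m x)) (\int[mu]_x (u x * m x)) (\int[mu]_x (m x * g x)) => a b c.
by move: (\int[mu]_x (m x * f x _)) (mean w) (mean u) => e mw mmu; lra.
Qed.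

(** Strict monotonicity of f, in the product form used by Lasry and Lions. *)
Lemma coupling_mono x (a b : R) : 0 <= a -> 0 <= b -> (a - b) * (f x b - f x a) <= 0 /\
  ((a - b) * (f x b - f x a) = 0 -> a = b).
Proof.
move=> a0 b0; have [ab|ba|->] := ltgtP a b; last by rewrite subrr mul0r.
  have fab := f_incr x a0 ab; have h : (a - b) * (f x b - f x a) < 0.
    by rewrite nmulr_rlt0 ?subr_gt0// subr_lt0.
  by split; [exact: ltW|move=> e; rewrite e ltxx in h].
have fba := f_incr x b0 ba; have h : (a - b) * (f x b - f x a) < 0.
  by rewrite pmulr_rlt0 ?subr_gt0// subr_lt0.
by split; [exact: ltW|move=> e; rewrite e ltxx in h].
Qed.

(** Lasry-Lions monotonicity: testing each solution with the other and adding, the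
integral of (m0 - m1) (f(m0) - f(m1)) is nonpositive, while the integrand is
nonnegative and vanishes only where m0 = m1. The constants are then compared in
the same inequalities. *)
Lemma ergodic_pair_unique u0 m0 l0 u1 m1 l1 :
  ergodic_sol H f s q u0 m0 l0 -> ergodic_sol H f s q u1 m1 l1 ->
  {ae mu, forall x, m0 x = m1 x} /\ l0 = l1.
Proof.
move=> E0 E1; have [W0 [L0 [[p0 I0 _] le0 _ _]]] := E0; have [W1' [L1 [[p1 I1 _] le1 _ _]]] := E1.
pose F0 x := f x (Num.max (m0 x) 0); pose F1 x := f x (Num.max (m1 x) 0).
have i00 := mass_coupling L0 L0; have i01 := mass_coupling L0 L1.
have i10 := mass_coupling L1 L0; have i11 := mass_coupling L1 L1.
have lem u m (Lm : Lp q%:E m) (I : \int[mu]_x m x = 1) n (Ln : Lp q%:E n) (pn : {ae mu, forall x, 0 <= n x}) l v :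
    {ae mu, forall x, H x (Dw v x) <= f x (n x) + l} -> W1 s v -> forall k, ergodic_sol H f s q u m k ->
    k + \int[mu]_x (m x * f x (Num.max (m x) 0)) <= \int[mu]_x (m x * f x (Num.max (n x) 0)) + l.
  move=> le Wv k Eu; have [il Il] := mass_cst Lm I l; have imn := mass_coupling Lm Ln.
  have E : (fun x => m x * (f x (Num.max (n x) 0) + l)) = (fun x => m x * f x (Num.max (n x) 0) + m x * l).
    by apply/funext => x; rewrite mulrDr.
  have := @ergodic_ineq u m k v (fun x => f x (Num.max (n x) 0) + l) Eu Wv.
  have -> : \int[mu]_x (m x * (f x (Num.max (n x) 0) + l)) = \int[mu]_x (m x * f x (Num.max (n x) 0)) + l.
    by rewrite -[X in _ = _ + X]Il -IntD//; apply: eq_Rintegral => x _; rewrite mulrDr.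
  apply; last by rewrite E; exact: intgD.
  by apply: filterS2 le pn => x + nx; rewrite max_l.
have j0 := lem u0 m0 L0 I0 m1 L1 p1 l1 u1 le1 W1' l0 E0.
have j1 := lem u1 m1 L1 I1 m0 L0 p0 l0 u0 le0 W0 l1 E1.
pose D x := - ((m0 x - m1 x) * (F1 x - F0 x)).
have DE : D = (fun x => m0 x * F0 x - m0 x * F1 x - (m1 x * F0 x - m1 x * F1 x)).
  by apply/funext => x; rewrite /D; ring.
have iD : intg mu D by rewrite DE; apply: intgB; exact: intgB.
have m01 : {ae mu, forall x, m0 x = m1 x}.
  have : {ae mu, forall x, D x = 0}.
    apply: Int_eq0 => //.
      apply: filterS2 p0 p1 => x a0 a1; rewrite /D /F0 /F1 !max_l// oppr_ge0.
      exact: (coupling_mono x a0 a1).1.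
    rewrite DE IntB; [|exact: intgB|exact: intgB].
    rewrite !IntB//; move: j0 j1; rewrite /F0 /F1.
    move: (\int[mu]_x (m0 x * f x (Num.max (m0 x) 0))) (\int[mu]_x (m0 x * f x (Num.max (m1 x) 0))) => a b.
    by move: (\int[mu]_x (m1 x * f x (Num.max (m0 x) 0))) (\int[mu]_x (m1 x * f x (Num.max (m1 x) 0))) => c e; lra.
  apply: filterS3 p0 p1 => x a0 a1; rewrite /D /F0 /F1 !max_l// => /eqP; rewrite oppr_eq0 => /eqP.
  exact: (coupling_mono x a0 a1).2.
split => //.
have e0 : \int[mu]_x (m0 x * f x (Num.max (m0 x) 0)) = \int[mu]_x (m0 x * f x (Num.max (m1 x) 0)).
  by apply: eq_ae_Int; [exact: intg_meas i00|exact: intg_meas i01|apply: filterS m01 => x ->].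
have e1 : \int[mu]_x (m1 x * f x (Num.max (m0 x) 0)) = \int[mu]_x (m1 x * f x (Num.max (m1 x) 0)).
  by apply: eq_ae_Int; [exact: intg_meas i10|exact: intg_meas i11|apply: filterS m01 => x ->].
apply/eqP; rewrite eq_le; apply/andP; split.
  by move: j0; rewrite e0 addrC lerD2l.
by move: j1; rewrite e1 addrC lerD2l.
Qed.

(** Test the discounted equation with v - ue and the ergodic one with ue - v, and
add. The constant lam cancels, the coupling terms have a sign by monotonicity,
and all remaining terms carry a factor eps; dividing by it leaves the assertion. *)
Lemma selection_ineq eps ue me m lam v : 0 < eps ->
  discounted_sol H f s q eps ue me -> ergodic_sols H f s q m lam v ->
  J m ue <= \int[mu]_x (me x * centered v x).
Proof.
move=> e0 De Ev; have [Wue [Le [[p0 Ie _] lee _ _]]] := De; have [Wv [Lm [[pm Im _] lev _ _]]] := Ev.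
have iee := mass_coupling Le Le; have iem := mass_coupling Le Lm.
have ime := mass_coupling Lm Le; have imm := mass_coupling Lm Lm.
have iuem := W1_mul_intg Lm Wue; have ivme := W1_mul_intg Le Wv.
have [il Il] := mass_cst Le Ie lam.
have d1 : eps * mean v - eps * mean ue - eps * \int[mu]_x (v x * me x) +
    \int[mu]_x (me x * f x (Num.max (me x) 0)) <= \int[mu]_x (me x * f x (Num.max (m x) 0)) + lam.
  have E : \int[mu]_x (me x * (f x (Num.max (m x) 0) + lam)) = \int[mu]_x (me x * f x (Num.max (m x) 0)) + lam.
    by rewrite -[X in _ = _ + X]Il -IntD//; apply: eq_Rintegral => x _; rewrite mulrDr.
  rewrite -E; apply: discounted_ineq De Wv _ _.
    by apply: filterS2 lev pm => x + mx; rewrite max_l.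
  have -> : (fun x => me x * (f x (Num.max (m x) 0) + lam)) = (fun x => me x * f x (Num.max (m x) 0) + me x * lam).
    by apply/funext => x; rewrite mulrDr.
  exact: intgD.
have d2 : lam + \int[mu]_x (m x * f x (Num.max (m x) 0)) <=
    \int[mu]_x (m x * f x (Num.max (me x) 0)) - eps * \int[mu]_x (ue x * m x).
  have iE : intg mu (fun x => m x * (f x (Num.max (me x) 0) - eps * ue x)).
    have -> : (fun x => m x * (f x (Num.max (me x) 0) - eps * ue x)) =
        (fun x => m x * f x (Num.max (me x) 0) - eps * (ue x * m x)).
      by apply/funext => x; ring.
    by apply: intgB => //; exact: intgZ.
  have E : \int[mu]_x (m x * (f x (Num.max (me x) 0) - eps * ue x)) =
      \int[mu]_x (m x * f x (Num.max (me x) 0)) - eps * \int[mu]_x (ue x * m x).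
    rewrite -IntZ// -IntB//; last exact: intgZ.
    by apply: eq_Rintegral => x _; ring.
  rewrite -E; apply: ergodic_ineq Ev Wue _ iE.
  by apply: filterS2 lee p0 => x + mx; rewrite max_l// -lerBrDl.
have mono : \int[mu]_x (me x * f x (Num.max (m x) 0)) - \int[mu]_x (me x * f x (Num.max (me x) 0)) -
    (\int[mu]_x (m x * f x (Num.max (m x) 0)) - \int[mu]_x (m x * f x (Num.max (me x) 0))) <= 0.
  rewrite -!IntB//; [|exact: intgB|exact: intgB].
  rewrite -[leRHS](Int_cst mu); apply: Int_le; [by apply: intgB; exact: intgB|exact: intg_cst|].
  apply: filterS2 p0 pm => x a0 b0; rewrite !max_l//.
  have [+ _] := coupling_mono x a0 b0; congr (_ <= _); ring.
have -> : \int[mu]_x (me x * centered v x) = \int[mu]_x (v x * me x) - mean v.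
  have [ivl Ivl] := mass_cst Le Ie (mean v).
  by rewrite -[X in _ = _ - X]Ivl -IntB//; apply: eq_Rintegral => x _; rewrite /centered; ring.
rewrite J_expand// -(ler_pM2l e0).
move: d1 d2 mono.
move: (\int[mu]_x (me x * f x (Num.max (m x) 0))) (\int[mu]_x (me x * f x (Num.max (me x) 0))) => a b.
move: (\int[mu]_x (m x * f x (Num.max (m x) 0))) (\int[mu]_x (m x * f x (Num.max (me x) 0))) => c e.
move: (\int[mu]_x (v x * me x)) (\int[mu]_x (ue x * m x)) => g h.
by move: (mean v) (mean ue) => k l; lra.
Qed.

Lemma ergodic_transfer u m n lam : ergodic_sol H f s q u m lam -> Lp q%:E n ->
  {ae mu, forall x, m x = n x} -> ergodic_sols H f s q n lam u.
Proof.
move=> Eu Ln mn; have [Wu [_ [_ ineq _ _]]] := Eu.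
apply: (ergodic_sol_ae Eu Wu Ln mn); first exact: aeW.
by apply: filterS2 ineq mn => x + <-.
Qed.

Lemma norm_Lp_ge0 (p : R) (g : X -> R) : 0 <= norm_Lp p%:E g.
Proof. by rewrite /norm_Lp fine_ge0// Lnorm_ge0. Qed.

(** Here the Sobolev embedding is used: W1 functions pair with L^q. *)
Lemma dual_W1 k : Lp q%:E k -> dual_functional (W1 s) (norm_W1 s) (fun w => \int[mu]_x (w x * k x)).
Proof.
move=> Lk; split=> [a u v Wu Wv|].
  have iu := W1_mul_intg Lk Wu; have iv := W1_mul_intg Lk Wv.
  rewrite -IntZ// -IntD//; last exact: intgZ.
  by apply: eq_Rintegral => x _; rewrite mulrDl mulrA.
have [C hC] := embedding.2; exists (C * norm_Lp q%:E k) => w Ww.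
have Lw := embedding.1 _ Ww; rewrite hq' in Lw.
have q'q : q'^-1 + q^-1 = 1 by rewrite addrC.
apply: (le_trans (Lpow_hoelder (ltW q'1) (ltW q1) q'q Lw.2 Lk.2)).
rewrite mulrAC; apply: ler_wpM2r; first exact: norm_Lp_ge0.
by have := hC _ Ww; rewrite hq'.
Qed.

Lemma dual_Lp k : Lp q'%:E k -> dual_functional (Lp q%:E) (norm_Lp q%:E) (fun g : X -> R => \int[mu]_x (g x * k x)).
Proof.
move=> Lk; have /(LpP _ (ltW q'1))[_ Lk'] := Lk; split=> [a u v /(LpP _ (ltW q1))[_ Lu] /(LpP _ (ltW q1))[_ Lv]|].
  have iu := Lpow_mul q0 q'0 qq' Lu Lk'; have iv := Lpow_mul q0 q'0 qq' Lv Lk'.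
  rewrite -IntZ// -IntD//; last exact: intgZ.
  by apply: eq_Rintegral => x _; rewrite mulrDl mulrA.
exists (norm_Lp q'%:E k) => g Lg; rewrite mulrC.
exact: (Lpow_hoelder (ltW q1) (ltW q'1) qq' Lg.2 Lk.2).
Qed.

Lemma W1_centered (u : X -> R) : W1 s u -> W1 s (centered u).
Proof.
move=> Wu; have [W _] := W1_lin s1 1 Wu (W1_cst d s1 (- mean u)).1.
have -> : centered u = (fun x => 1 * u x + - mean u) by apply/funext => x; rewrite mul1r.
exact: W.
Qed.

Lemma mean_centered (u : X -> R) : W1 s u -> mean (centered u) = 0.
Proof.
move=> Wu; have iu := (W1_pintg s1 Wu).2.
rewrite /mean /centered IntB; [|exact: iu|exact: intg_cst].
by rewrite Int_cst subrr.
Qed.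

Lemma dual_ae (Phi : (X -> R) -> R) u v : dual_functional (W1 s) (norm_W1 s) Phi ->
  W1 s u -> W1 s v -> {ae mu, forall x, u x = v x} -> Phi u = Phi v.
Proof.
move=> [lin [C hC]] Wu Wv uv; have [Wd _] := W1_sub Wu Wv.
have := hC _ Wd; rewrite norm_W1_ae0//; last by apply: filterS uv => x ->; ring.
rewrite mulr0 normr_le0 (lin (-1) u v Wu Wv) mulN1r addrC subr_eq0 => /eqP.
by move=> ->.
Qed.

(** Pass to the limit in selection_ineq: the left side is linear in <ue>, the right
side is linear in me, and both converge weakly. *)
Lemma limit_minimizer (ue me : R -> X -> R) m lam (e : nat -> R) :
  (forall eps, 0 < eps -> discounted_sol H f s q eps (ue eps) (me eps)) ->
  compact_stable H f s q ue me -> ergodic_pair H f s q m lam ->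
  (forall n, 0 < e n) -> e n @[n --> \oo] --> 0 ->
  exists (k : nat -> nat) (u : X -> R), [/\ MJ H f s q m lam u, mean u = 0 &
    weakly_cvg_W1 s \oo (fun n => centered (ue (e (k n)))) u].
Proof.
move=> De cs [Lm [v0 Ev0]] e0 ec; have [k [u [m' [l' [_ [Eu' [cu cm _]]]]]]] := cs e e0 ec.
have [m'm l'l] := ergodic_pair_unique Eu' Ev0; rewrite l'l in Eu'.
have Eu := ergodic_transfer Eu' Lm m'm.
have [Wu [_ [[pm Im _] _ _ _]]] := Eu; have [_ [Lm' _]] := Eu'.
have c1 : Lp q%:E (fun _ : X => 1 : R) by apply/LpP; [exact: ltW|split => //; exact: Lpow_cst].
have Wn n : W1 s (ue (e (k n))) := (De _ (e0 _)).1.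
have mean0 : mean u = 0.
  have := cu _ (dual_W1 c1).
  have -> : (fun n => \int[mu]_x (centered (ue (e (k n))) x * 1)) = cst 0.
    apply/funext => n; rewrite /= -(mean_centered (Wn n)) /mean.
    by apply: eq_Rintegral => x _; rewrite mulr1.
  have -> : \int[mu]_x (u x * 1) = mean u by apply: eq_Rintegral => x _; rewrite mulr1.
  move=> h; apply: esym; apply: (@cvg_unique _ (@Rhausdorff R) _ _ _ _ (cvg_cst 0) h).
exists k, u; split => //; split => // v Ev.
have Lv : Lp q'%:E (centered v) by rewrite -hq'; apply: embedding.1; exact/W1_centered/Ev.1.
have cJ := cu _ (dual_W1 Lm); have cv := cm _ (dual_Lp Lv).
have -> : J m u = \int[mu]_x (u x * m x) by rewrite J_expand// mean0 subr0.
have -> : J m v = \int[mu]_x (m' x * centered v x).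
  apply: eq_ae_Int.
  - exact: intg_meas (W1_mul_intg Lm (W1_centered Ev.1)).
  - apply: measurable_funM; first by have /(LpP _ (ltW q1))[_ []] := Lm'.
    exact: intg_meas (W1_pintg s1 (W1_centered Ev.1)).2.
  - by apply: filterS m'm => x ->; rewrite mulrC.
apply: (ler_cvg_to cJ cv); apply: nearW => n.
exact: selection_ineq (e0 _) (De _ (e0 _)) Ev.
Qed.

End solutions.

(** * Uniqueness and convergence of the whole family *)

Theorem theorem1p10 (R : realType) (d : nat) (d_gt0 : (0 < d)%N) (s q : R)
  (s_gt1 : 1 < s) (q_gt1 : 1 < q)
  (embedding : sobolev_embedding d s (hoelder_conjugate q%:E))
  (H : 'rV[R]_d -> 'rV[R]_d -> R)
  (H_periodic : Zd_periodic H)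
  (H_C1 : C1 (fun z : 'rV[R]_d * 'rV[R]_d => H z.1 z.2))
  (H_strictly_convex : forall x p0 p1 (t : R), p0 != p1 -> 0 < t -> t < 1 ->
    H x (t *: p0 + (1 - t) *: p1) < t * H x p0 + (1 - t) * H x p1)
  (H_coercive : forall A : R, exists B : R, forall p : 'rV[R]_d, B < `|p| ->
    (A%:E < ereal_inf [set (H x p)%:E | x in [set: 'rV[R]_d]])%E)
  (f : 'rV[R]_d -> R -> R)
  (f_periodic : Zd_periodic f)
  (f_continuous : {within [set z : 'rV[R]_d * R | 0 <= z.2],
    continuous (fun z => f z.1 z.2)})
  (f_increasing : forall x r1 r2, 0 <= r1 -> r1 < r2 -> f x r1 < f x r2)
  (f_growth : exists2 C : R, 0 < C &
    forall x r, 0 <= r -> `|f x r| <= C * (1 + r `^ (q - 1)))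
  (m : 'rV[R]_d -> R) (lam : R)
  (m_lam_ergodic : ergodic_pair H f s q m lam)
  (gap_gradient : forall u0 u1, MJ H f s q m lam u0 -> MJ H f s q m lam u1 ->
    {ae torus_measure R d,
      forall x, R_gap H f m lam x -> Dw u0 x = Dw u1 x}) :
  (forall u0 u1, MJ H f s q m lam u0 -> MJ H f s q m lam u1 ->
    exists c : R, {ae torus_measure R d, forall x, u0 x - u1 x = c}) /\
  (forall ue me : R -> 'rV[R]_d -> R,
    (forall eps, 0 < eps -> discounted_sol H f s q eps (ue eps) (me eps)) ->
    compact_stable H f s q ue me ->
    exists ustar : 'rV[R]_d -> R,
      [/\ MJ H f s q m lam ustar,
          mean ustar = 0,
          forall v, MJ H f s q m lam v -> mean v = 0 ->
            {ae torus_measure R d, forall x, v x = ustar x} &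
          weakly_cvg_W1 s 0^'+ (fun eps => centered (ue eps)) ustar]).
Proof.
have [s' [hs' s'1 ss']] := hoelder_conjugate_real s_gt1.
have [q' [hq' q'1 qq']] := hoelder_conjugate_real q_gt1.
have uniq u0 u1 (M0 : MJ H f s q m lam u0) (M1 : MJ H f s q m lam u1) :
    exists c : R, {ae torus_measure R d, forall x, u0 x - u1 x = c}.
  apply: (MJ_unique s_gt1 q_gt1 s'1 q'1 ss' qq' hs' hq' embedding H_periodic H_C1
    H_strictly_convex H_coercive f_periodic f_continuous f_growth M0 M1).
  exact: gap_gradient.
have uniq0 u0 u1 : MJ H f s q m lam u0 -> MJ H f s q m lam u1 -> mean u0 = 0 -> mean u1 = 0 ->
    {ae torus_measure R d, forall x, u0 x = u1 x}.
  move=> M0 M1 m0 m1; have [c hc] := uniq _ _ M0 M1.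
  have i0 := (W1_pintg s_gt1 M0.1.1).2; have i1 := (W1_pintg s_gt1 M1.1.1).2.
  have c0 : c = 0.
    rewrite -[c](Int_cst (torus_measure R d)) -[RHS](subrr 0) -{1}m0 -m1 /mean -IntB//.
    apply: eq_ae_Int; first exact: measurable_cst.
      by apply: measurable_funB; [exact: intg_meas i0|exact: intg_meas i1].
    by apply: filterS hc => x ->.
  by apply: filterS hc => x; rewrite c0 => /eqP; rewrite subr_eq0 => /eqP.
split=> [//|ue me De cs].
have lim := limit_minimizer s_gt1 q_gt1 s'1 q'1 ss' qq' hs' hq' embedding H_periodic H_C1
    H_strictly_convex f_continuous f_increasing f_growth De cs m_lam_ergodic.
have h0 n : 0 < (n.+1%:R^-1 : R) by rewrite invr_gt0.
have [_ [us [Ms ms _]]] := lim (fun n => n.+1%:R^-1) h0 (@cvg_harmonic R).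
exists us; split => //; first by move=> v Mv mv; exact: uniq0.
(* a failure of convergence would be witnessed along some sequence tending to 0 *)
move=> Phi PhiP; apply/cvgrPdist_le => eps eps0; apply: contrapT => nh.
have bad n : {t : R | 0 < t < n.+1%:R^-1 & ~ `|Phi us - Phi (centered (ue t))| <= eps}.
  apply: cid2; apply: contrapT => no; apply: nh.
  have : \forall t \near 0^'+, (0 : R) < t < n.+1%:R^-1.
    by near=> t; apply/andP; split; near: t; [exact: nbhs_right_gt|exact: nbhs_right_lt].
  apply: filterS => t t0n; apply: contrapT => nt; apply: no; exists t => //.
pose e n := s2val (bad n).
have en n : 0 < e n < n.+1%:R^-1 := s2valP (bad n).
have eP n : ~ `|Phi us - Phi (centered (ue (e n)))| <= eps := s2valP' (bad n).
have e0 n : 0 < e n by have /andP[] := en n.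
have ec : e n @[n --> \oo] --> 0.
  apply: (@squeeze_cvgr _ _ _ _ (cst 0) (fun n => n.+1%:R^-1)).
  - by apply: nearW => n /=; have /andP[/ltW -> /ltW ->] := en n.
  - exact: cvg_cst.
  - exact: cvg_harmonic.
have [k [u [Mu mu0 cu]]] := lim e e0 ec.
have E : Phi u = Phi us.
  by apply: (dual_ae s_gt1 PhiP Mu.1.1 Ms.1.1); exact: uniq0.
have /cvgrPdist_le/(_ _ eps0) := cu _ PhiP.
rewrite E => -[N _ /(_ N)]/=; rewrite leqnn => /(_ isT).
exact: eP.
Unshelve. all: by end_near.
Qed.
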